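(* Let $V_{D,n}$ be the expected payoff function in the $n$-scaled Cramér–Lundberg model when dividends are paid according to the barrier strategy with barrier $b_D$, where $b_D$ is the optimal barrier for the diffusion approximation, and let $V_D$ be the value function of the optimal dividend problem for the diffusion approximation (all defined in the context). Assume that there exists $\varepsilon>0$ such that $\mathbb{E}(e^{\varepsilon Y})<\infty$, and that there exists $\varepsilon>0$ such that $\sup_{d\ge 0}\mathbb{E}\big(e^{\varepsilon(Y-d)}\,\big|\,Y>d\big)<\infty$. Then there exist constants $C'>0$, $N>0$ and $N'>0$ (independent of $n$ and $x$) such that, for all real $n>\max(N,N')$ and all $x\ge 0$, $$\big|V_{D,n}(x)-V_D(x)\big|\le \frac{C'}{\sqrt n}.$$
   Context: Data: $\lambda>0$, $\theta>0$, $\delta>0$ are constants; $Y$ is a (strictly) positive random variable with cumulative distribution function $F_Y$ whose moment generating function is finite in a neighborhood of $0$. Put $c=(1+\theta)\lambda\mathbb{E}Y$. Scaled Cramér–Lundberg (CL) model: for real $n>0$, set $\lambda_n=n\lambda$, $Y_n=Y/\sqrt n$, $c_n=c+(\sqrt n-1)\lambda\mathbb{E}Y=(\sqrt n+\theta)\lambda\mathbb{E}Y$. The surplus before dividends is $U_t=x+c_nt-\sum_{i=1}^{N_t}Y_{n,i}$, where $x\ge 0$, $(N_t)_{t\ge0}$ is a homogeneous Poisson process of intensity $\lambda_n$, and $Y_{n,1},Y_{n,2},\dots$ are i.i.d. copies of $Y_n$, independent of $(N_t)$. If $D_t$ denotes the cumulative dividends paid up to and including time $t$ ($D_{0-}=0$),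 the surplus after dividends is $X_t=U_t-D_t$ and the ruin time is $\tau=\inf\{t\ge0:X_t<0\}$. Diffusion approximation: the surplus before dividends has dynamics $\theta\lambda\mathbb{E}Y\,dt+\sqrt{\lambda\mathbb{E}(Y^2)}\,dB_t$ with $B$ a standard Brownian motion. The value function $V_D$ of the corresponding problem of maximizing expected dividends discounted at rate $\delta$ until ruin, and its optimal barrier $b_D$, are given explicitly as follows. Let $$\gamma_1=\frac{-\theta\lambda\mathbb{E}Y+\sqrt{(\theta\lambda\mathbb{E}Y)^2+2\delta\lambda\mathbb{E}(Y^2)}}{\lambda\mathbb{E}(Y^2)},\qquad \gamma_2=\frac{\theta\lambda\mathbb{E}Y+\sqrt{(\theta\lambda\mathbb{E}Y)^2+2\delta\lambda\mathbb{E}(Y^2)}}{\lambda\mathbb{E}(Y^2)},\qquad b_D=\frac{2}{\gamma_1+\gamma_2}\ln\Big(\frac{\gamma_2}{\gamma_1}\Big).$$ Then $$V_D(x)=\frac{e^{\gamma_1x}-e^{-\gamma_2x}}{\gamma_1e^{\gamma_1b_D}+\gamma_2e^{-\gamma_2b_D}}\ \ (0\le x\le b_D),\qquad V_D(x)=V_D(b_D)+(x-b_D)\ \ (x>b_D).$$ Barrier payoff: the barrier strategy with barrier $b_D$ in the scaled CL model is $D_t=\max\big(0,\sup_{0\le s\le t}U_s-b_D\big)$, i.e. any surplus above $b_D$ is paid out immediately, and while the surplus equals $b_D$ the premium income is paid out at rate $c_n$. Its expected payoff is $V_{D,n}(x)=\mathbb{E}\big[\int_0^\tau e^{-\delta t}\,dD_t\big]$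 for initial surplus $x\ge0$, the integral including the lump sum $D_0=\max(0,x-b_D)$. Convention: in suprema over $d$ of quantities conditioned on $Y>d$, only those $d\ge0$ with $\mathbb{P}(Y>d)>0$ are considered. *)

(* Defs.v *)
From HB Require Import structures.
From mathcomp Require Import all_boot all_order all_algebra.
From mathcomp Require Import finmap ring lra.
From mathcomp Require Import all_classical all_reals all_analysis.

Set Implicit Arguments.
Unset Strict Implicit.
Unset Printing Implicit Defensive.

Import Order.TTheory GRing.Theory Num.Def Num.Theory.
Import numFieldNormedType.Exports.

Local Open Scope classical_set_scope.
Local Open Scope ring_scope.

Section independence.
Context {R : realType} {d} {T : measurableType d} (P : probability T R).

Definition indep_sets (F G : set_system T) : Prop :=
  forall A B, F A -> G B -> P (A `&` B) = (P A * P B)%E.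

Definition sigma_rv {d'} {T' : measurableType d'} (X : T -> T') : set_system T :=
  preimage_set_system setT X measurable.

Definition sigma_family {I : Type} {d'} {T' : measurableType d'}
    (J : set I) (X : I -> T -> T') : set_system T :=
  <<s \bigcup_(i in J) sigma_rv (X i) >>.

Definition mutually_independent {d'} {T' : measurableType d'}
    (X : nat -> T -> T') : Prop :=
  forall (J : {fset nat}) (A : nat -> set T'),
    (forall i, measurable (A i)) ->
    P (\bigcap_(i in [set` J]) X i @^-1` A i) =
    (\prod_(i <- J) P (X i @^-1` A i))%E.

Definition cond_expectation (A : set T) (X : T -> R) : \bar R :=
  ((\int[P]_(w in A) (X w)%:E) / P A)%E.

End independence.

Section counting_process.
Context {R : realType} {d} {T : measurableType d}.

(* The values at negative times are irrelevant. *)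
Record counting_process (P : probability T R) := CountingProcess {
  counting_fun :> R -> {RV P >-> nat} ;
  counting0 : forall w, counting_fun 0 w = 0%N ;
  counting_nd : forall w s t, 0 <= s -> s <= t ->
    (counting_fun s w <= counting_fun t w)%N ;
  counting_rc : forall w t, 0 <= t ->
    \forall u \near t^'+, counting_fun u w = counting_fun t w }.

Definition poisson_process (P : probability T R) (rate : R)
    (N : counting_process P) : Prop :=
  (forall s t k, 0 <= s -> s < t ->
     P [set w | (N t w - N s w)%N = k] = (poisson_pmf (rate * (t - s)) k)%:E) /\
  (forall s t, 0 <= s -> s < t ->
     indep_sets P (sigma_family [set u | 0 <= u <= s] (fun u => N u : T -> nat))
                  (sigma_rv (fun w => N t w - N s w)%N)).

End counting_process.

Section barrier_strategy.
Context {R : realType} {d} {T : measurableType d} {P : probability T R}.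
Variables (N : counting_process P) (Z : nat -> {RV P >-> R}).
Variables (c x b : R).

Definition surplus (t : R) (w : T) : R :=
  x + c * t - \sum_(i < N t w) Z i w.

(* D vanishes on negative times (D_{0-} = 0), so that the Stieltjes measure of
   t |-> D_t has mass D_0 at 0. *)
Definition dividends (w : T) (t : R) : R :=
  if 0 <= t then Num.max 0 (sup [set surplus s w | s in `[0, t]] - b) else 0.

Definition ruin_time (w : T) : \bar R :=
  ereal_inf [set t%:E | t in [set t | 0 <= t /\ surplus t w - dividends w t < 0]].

Let bnd (w : T) (t : R) : R :=
  `|x| + `|c| * t + \sum_(i < N t w) `|Z i w|.

Let surplus_le_bnd w (s t : R) : 0 <= s -> s <= t -> surplus s w <= bnd w t.
Proof.
move=> s0 st; rewrite /surplus /bnd lerD//.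
  rewrite lerD ?ler_norm//; apply: (le_trans (ler_norm _)).
  by rewrite normrM (ger0_norm s0) ler_wpM2l.
apply: (le_trans (ler_norm _)); rewrite normrN.
apply: (le_trans (ler_norm_sum _ _ _)).
rewrite -!(big_mkord xpredT (fun i => `|Z i w|)).
rewrite [leRHS](big_cat_nat (n := N s w))//=; last exact: counting_nd.
by rewrite lerDl sumr_ge0.
Qed.

Let run (w : T) (t : R) := [set surplus s w | s in `[0, t]].

Let has_sup_run w (t : R) : 0 <= t -> has_sup (run w t).
Proof.
move=> t0; split.
  by exists (surplus 0 w), 0 => //=; rewrite in_itv/= lexx t0.
exists (bnd w t) => y [s]; rewrite /= in_itv/= => /andP[s0 st] <-.
exact: surplus_le_bnd.
Qed.

Let run_nd w (s t : R) : 0 <= s -> s <= t -> sup (run w s) <= sup (run w t).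
Proof.
move=> s0 st; apply: ge_sup; first exact: (@has_sup_run w s s0).1.
move=> y [u]; rewrite /= in_itv/= => /andP[u0 us] <-.
apply: sup_upper_bound; first exact: has_sup_run (le_trans s0 st).
by exists u => //=; rewrite in_itv/= u0 (le_trans us).
Qed.

Let dividends_nd w : nondecreasing (dividends w).
Proof.
move=> s t st; rewrite /dividends; case: ifPn => s0.
  rewrite (le_trans s0 st) ge_max le_max lexx/= le_max; apply/orP; right.
  by rewrite lerD2r run_nd.
by case: ifPn => // _; rewrite le_max lexx.
Qed.

Let sup_run_le w (t u : R) : 0 <= t -> t <= u ->
    (forall s : R, t <= s -> s <= u -> N s w = N t w) ->
  sup (run w u) <= sup (run w t) + `|c| * (u - t).
Proof.
move=> t0 tu Nt; apply: ge_sup; first exact: (@has_sup_run w u (le_trans t0 tu)).1.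
move=> y [s]; rewrite /= in_itv/= => /andP[s0 su] <-.
have ub v : 0 <= v -> v <= t -> surplus v w <= sup (run w t).
  move=> v0 vt; apply: sup_upper_bound; first exact: has_sup_run.
  by exists v => //=; rewrite in_itv/= v0.
have cut0 : 0 <= `|c| * (u - t) by rewrite mulr_ge0// subr_ge0.
have [st|ts] := leP s t; first by rewrite -[leLHS]addr0 lerD// ub.
have -> : surplus s w = surplus t w + c * (s - t).
  by rewrite /surplus Nt// ?ltW//; ring.
rewrite lerD ?ub//; apply: (le_trans (ler_norm _)).
rewrite normrM (@ger0_norm _ (s - t)) ?subr_ge0 ?(ltW ts)//.
by rewrite ler_wpM2l// lerB.
Qed.

Let dividends_rc w : right_continuous (dividends w).
Proof.
move=> t; have [t0|t0] := leP 0 t; last first.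
  apply: (@cvg_trans _ (cst (dividends w t) @ t^'+)); last exact: cvg_cst.
  apply: near_eq_cvg; near=> u; rewrite /dividends leNgt t0/=.
  have u0 : u < 0 by near: u; exact: nbhs_right_lt.
  by rewrite leNgt u0.
apply/cvgrPdist_le => e e0.
have [r /= r0 Nr] := counting_rc N w t0.
near=> u.
have tu : t < u by near: u; exact: nbhs_right_gt.
have ur : u < t + r by near: u; apply: nbhs_right_lt; rewrite ltrDl.
have uc : u <= t + e / (`|c| + 1).
  near: u; apply: nbhs_right_le; rewrite ltrDl divr_gt0//.
have Nt s : t <= s -> s <= u -> N s w = N t w.
  rewrite le_eqVlt => /predU1P[->//|ts] su; apply: Nr => //=.
  by rewrite ltr0_norm ?subr_lt0// opprB ltrBlDl (le_lt_trans su).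
have cu : `|c| * (u - t) <= e.
  rewrite (@le_trans _ _ ((`|c| + 1) * (u - t)))//.
    by rewrite ler_wpM2r ?subr_ge0 ?(ltW tu)// lerDl.
  by rewrite mulrC -ler_pdivlMr ?ltr_wpDl// lerBlDl.
rewrite distrC ger0_norm ?subr_ge0 ?dividends_nd ?(ltW tu)//.
rewrite lerBlDl /dividends t0 (le_trans t0 (ltW tu)).
rewrite ge_max; apply/andP; split.
  by rewrite addr_ge0 ?(ltW e0)// le_max lexx.
have := sup_run_le t0 (ltW tu) Nt; rewrite -/(run w u) -/(run w t) => h.
have h2 : sup (run w t) - b <= Num.max 0 (sup (run w t) - b).
  by rewrite le_max lexx orbT.
by move: h h2 cu; lra.
Unshelve. all: by end_near. Qed.

HB.instance Definition _ w :=
  isCumulative.Build R _ R (dividends w) (@dividends_nd w) (@dividends_rc w).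

Definition barrier_payoff (delta : R) : \bar R :=
  (\int[P]_w \int[lebesgue_stieltjes_measure (dividends w)]_(t in
      [set t : R | (0 <= t)%R /\ t%:E <= ruin_time w])
      (expR (- delta * t))%:E)%E.

End barrier_strategy.

(* The claims Z i have the law of Y_n = Y / sqrt n. *)
Record cramer_lundberg {R : realType} {d0} {T0 : measurableType d0}
    {P0 : probability T0 R} (Y : {RV P0 >-> R}) (lambda n : R)
    {d} {T : measurableType d} {P : probability T R}
    (N : counting_process P) (Z : nat -> {RV P >-> R}) : Prop := {
  claim_number_poisson : poisson_process (n * lambda) N ;
  claim_law : forall i (A : set R), measurable A ->
    P (Z i @^-1` A) = P0 [set w | A (Y w / Num.sqrt n)] ;
  claims_independent : mutually_independent P (fun i => Z i : T -> R) ;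
  claims_indep_number :
    indep_sets P (sigma_family [set t | 0 <= t] (fun t => N t : T -> nat))
                 (sigma_family [set: nat] (fun i => Z i : T -> R)) }.

Section moments.
Context {R : realType} {d} {T : measurableType d} {P : probability T R}.
Variable Y : {RV P >-> R}.

Definition moment (k : nat) : R := fine 'E_P[fun w => Y w ^+ k].

Definition scaled_premium (lambda theta n : R) : R :=
  let c := (1 + theta) * lambda * moment 1 in
  c + (Num.sqrt n - 1) * lambda * moment 1.

End moments.

(* Brownian motion with drift mu and variance parameter sigma2. *)
Section diffusion.
Context {R : realType}.
Variables (mu sigma2 delta : R).

Definition gamma1 : R :=
  (- mu + Num.sqrt (mu ^+ 2 + 2 * delta * sigma2)) / sigma2.

Definition gamma2 : R :=
  (mu + Num.sqrt (mu ^+ 2 + 2 * delta * sigma2)) / sigma2.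

Definition diffusion_barrier : R :=
  2 / (gamma1 + gamma2) * ln (gamma2 / gamma1).

Definition diffusion_value (x : R) : R :=
  let b := diffusion_barrier in
  let v y := (expR (gamma1 * y) - expR (- gamma2 * y)) /
             (gamma1 * expR (gamma1 * b) + gamma2 * expR (- gamma2 * b)) in
  if x <= b then v x else v b + (x - b).

End diffusion.

(* Main.v *)
From HB Require Import structures.
Require Import Defs.
From mathcomp Require Import all_boot all_order all_algebra.
From mathcomp Require Import finmap ring lra.
From mathcomp Require Import all_classical all_reals all_analysis.
From mathcomp Require Import measurable_realfun.

Set Implicit Arguments.
Unset Strict Implicit.
Unset Printing Implicit Defensive.

Import Order.TTheory GRing.Theory Num.Theory.
Import numFieldNormedType.Exports.

Local Open Scope classical_set_scope.
Local Open Scope ring_scope.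

(** Fix [n] and observe the model on the grid [k h].  Let [F] be [V_D], continued
   to negative arguments by its second order Taylor polynomial at [0]; it is [C^2]
   with Lipschitz second derivative, also across the barrier.  On the grid the
   surplus after dividends becomes the chain [X' = min (X + c h - J) b], where [J]
   is the claim total of one step, and since [F] has slope 1 above [b], [F X'] plus
   the dividend of the step equals [F (X + c h - J)].  Up to [O(h^2)] only 0 or 1
   claim occurs in a step, so a Taylor expansion to second order and the ODE of
   [V_D] show that the discounted [F X] plus past dividends is a martingale up to an
   error [h C / sqrt n + O(h^2)] per step.  Before ruin is taken into account this
   is two-sided.  At ruin [F <= 0], which is harmless for the lower bound; for the
   upper bound [F] is replaced by [F + K / sqrt n] on [[0, +oo)] and by [0] below,
   and the assumption on [Y - d] given [Y > d] says exactly that the mean deficit at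
   ruin is paid for by dropping [K / sqrt n].  Path by path the true payoff differs
   from the payoff on the grid by at most [c h], and finally [h] tends to [0]. *)

(** * Taylor expansion *)

(** The premium rate grows like [sqrt n] and is compensated by claims of mean size of order
    [1 / sqrt n] at rate [n lambda]; all estimates are arranged around this cancellation, which
    leaves the generator of the diffusion. The rate in the theorem is that of the Taylor remainder:
    third moments of order [n ^ (- 3 / 2)] times the claim rate. Discounting adds these errors up to
    a multiple of [1 / delta]. The grid replaces stochastic calculus. Since [n] is fixed while [h]
    tends to [0], constants in front of powers of [h] may depend on [n] in any way. What has to be
    built by hand is the one-step Markov property: the number of the next claim is random, and the
    independence of that claim from the past is put together from the events that fix this number.
    [F] is quadratic below [0] because the exponential formula has no globally Lipschitz second
    derivative there; with a constant one the Taylor remainder is uniform, and a deficit [u] costs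
    at most a multiple of [u + u ^+ 2], which the excess assumption controls. *)

Section calculus.
Context {R : realType}.
Implicit Types (u v f df ddf : R -> R) (p x y z L : R).

(** Only [p] needs an argument: there the Caratheodory slope functions of [u] and [v] take the
    common value [du p = dv p], so the glued slope is continuous. *)
Lemma is_derive_glue u v du dv p :
  (forall x, is_derive x 1 u (du x)) -> (forall x, is_derive x 1 v (dv x)) ->
  u p = v p -> du p = dv p ->
  forall x, is_derive x 1 (fun y => if y <= p then u y else v y)
                      (if x <= p then du x else dv x).
Proof.
move=> hu hv uvp duvp x; have [xp|px|->] := ltgtP x p.
- apply: near_eq_is_derive (hu x).
  by near=> y; rewrite ifT//; near: y; exact: lt_le_nbhsl.
- apply: near_eq_is_derive (hv x).
  near=> y; rewrite ifF//; apply/negbTE; rewrite -ltNge.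
  by near: y; exact: lt_nbhsr.
have /is_derive1_caratheodory[gu [guE cgu gup]] := hu p.
have /is_derive1_caratheodory[gv [gvE cgv gvp]] := hv p.
apply/is_derive1_caratheodory.
exists (fun y => if y <= p then gu y else gv y); split.
- by move=> z; rewrite lexx; case: ifP => _; rewrite ?guE// uvp gvE.
- apply/cvgrPdist_le => e e0; rewrite lexx.
  move/cvgrPdist_le : cgu => /(_ _ e0) cgu.
  move/cvgrPdist_le : cgv => /(_ _ e0) cgv.
  near=> y; case: ifPn => _; first by near: y.
  by rewrite gup duvp -gvp; near: y.
- by rewrite lexx.
Unshelve. all: by end_near. Qed.

Lemma mvt_bound f df x y M : (forall z, is_derive z 1 f (df z)) ->
  (forall z, Num.min x y <= z <= Num.max x y -> `|df z| <= M) ->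
  `|f x - f y| <= M * `|x - y|.
Proof.
move=> fdf; wlog xy : x y / x <= y => [h|] dfM.
  have [xy|yx] := leP x y; first exact: h.
  by rewrite distrC (distrC x y) h ?(ltW yx)// => z; rewrite minC maxC; exact: dfM.
have [|z zxy fE] := @MVT_segment R f df x y xy.
- by apply/derivable_within_continuous => z _; have [] := fdf z.
rewrite distrC fE normrM (distrC x y) ler_wpM2r//.
by apply: dfM; rewrite min_l// max_r//; move: zxy; rewrite in_itv.
Qed.

(** Two mean value bounds, for [df] and then for [f], replace a third derivative, which [F] lacks at
    [0] and at the barrier; the price is [L] instead of [L / 6]. The displacement is to the left
    because claims lower the surplus. *)
Lemma left_taylor2 f df ddf L :
  (forall x, is_derive x 1 f (df x)) -> (forall x, is_derive x 1 df (ddf x)) ->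
  (forall x y, `|ddf x - ddf y| <= L * `|x - y|) ->
  forall x z, 0 <= z ->
    `|f (x - z) - f x + df x * z - ddf x / 2 * z ^+ 2| <= L * z ^+ 3.
Proof.
move=> f1 f2 Lf x z z0.
have L0 : 0 <= L.
  by have := le_trans (normr_ge0 _) (Lf 0 1); rewrite sub0r normrN1 mulr1.
have rem1 s : 0 <= s -> s <= z -> `|df (x - s) - df x + ddf x * s| <= L * z ^+ 2.
  move=> s0 sz.
  pose g y := df y - ddf x * y.
  have gd y : is_derive y 1 g (ddf y - ddf x).
    by apply: is_derive_eq; rewrite /GRing.scale/=; ring.
  have := @mvt_bound g _ (x - s) x (L * z) gd.
  have -> : g (x - s) - g x = df (x - s) - df x + ddf x * s by rewrite /g; ring.
  have -> : x - s - x = - s by ring.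
  rewrite normrN (ger0_norm s0) => h.
  apply: (le_trans (h _)).
    move=> y; rewrite min_l ?gerBl// max_r ?gerBl// => /andP[ys yx].
    rewrite (le_trans (Lf _ _))// ler_wpM2l// ler0_norm ?subr_le0//; lra.
  by rewrite -mulrA ler_wpM2l// expr2 ler_wpM2l.
pose g s := f (x - s) + df x * s - ddf x / 2 * s ^+ 2.
have gd y : is_derive y 1 g (- (df (x - y) - df x + ddf x * y)).
  have h : is_derive y 1 (fun s => f (x - s)) (- df (x - y)).
    have -> : - df (x - y) = df (x - y) * (0 - 1) by ring.
    by apply: (is_derive1_comp (f := f) (g := fun s => x - s)).
  by apply: is_derive_eq; rewrite /GRing.scale/=; field.
have := @mvt_bound g _ z 0 (L * z ^+ 2) gd.
rewrite subr0 (ger0_norm z0) /g => h.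
have -> : f (x - z) - f x + df x * z - ddf x / 2 * z ^+ 2 =
   f (x - z) + df x * z - ddf x / 2 * z ^+ 2 -
   (f (x - 0) + df x * 0 - ddf x / 2 * 0 ^+ 2) by rewrite subr0; ring.
have -> : L * z ^+ 3 = L * z ^+ 2 * z by ring.
by apply: h => y; rewrite min_r// max_l// => /andP[y0 yz]; rewrite normrN rem1.
Qed.

End calculus.

(** * The value function of the diffusion *)

(** The interface between the diffusion and the grid argument; one [L] serves for all bounds. The
    slack [s] in [sv_gen_ge] is there because premium income lifts the surplus up to [b + c h],
    where the ODE fails by at most [delta s]. [sv_neg] measures the cost of a deficit [u]. *)
Record smooth_value {R : realType} (mu sigma2 delta b L : R) (F F1 F2 : R -> R)
    : Prop := {
  sv_deriv1 : forall y : R, is_derive y 1 F (F1 y) ;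
  sv_deriv2 : forall y : R, is_derive y 1 F1 (F2 y) ;
  sv_lip : forall y z, `|F2 y - F2 z| <= L * `|y - z| ;
  sv_F2_bnd : forall y, `|F2 y| <= L ;
  sv_F1_bnd : forall y, 0 <= y -> 0 <= F1 y <= L ;
  sv_gen_le : forall y, 0 <= y -> mu * F1 y + sigma2 / 2 * F2 y <= delta * F y ;
  sv_gen_ge : forall y s, 0 <= y -> 0 <= s -> y <= b + s ->
    delta * F y - delta * s <= mu * F1 y + sigma2 / 2 * F2 y ;
  sv_linear : forall y, b <= y -> F y = F b + (y - b) ;
  sv_0 : F 0 = 0 ;
  sv_neg : forall u, 0 <= u -> 0 <= - F (- u) <= L * (u + u ^+ 2) }.

(* [b_crit] is smooth fit, [V_D'' (b) = 0]; [K] normalises [V_D' (b)] to [1]. *)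
Section exponential_value.
Context {R : realType}.
Variables mu sigma2 delta g1 g2 b : R.
Hypotheses (delta_gt0 : 0 < delta) (g1_gt0 : 0 < g1) (g1_lt_g2 : g1 < g2).
Hypothesis g1_root : mu * g1 + sigma2 / 2 * g1 ^+ 2 = delta.
Hypothesis g2_root : sigma2 / 2 * g2 ^+ 2 - mu * g2 = delta.
Hypothesis b_gt0 : 0 < b.
Hypothesis b_crit : g1 ^+ 2 * expR (g1 * b) = g2 ^+ 2 * expR (- g2 * b).

Let K := g1 * expR (g1 * b) + g2 * expR (- g2 * b).
Let g2_gt0 : 0 < g2. Proof. exact: lt_trans g1_lt_g2. Qed.

Let K_gt0 : 0 < K.
Proof. by rewrite /K addr_gt0 ?mulr_gt0 ?expR_gt0. Qed.

Let E0 y := (expR (g1 * y) - expR (- g2 * y)) / K.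
Let E1 y := (g1 * expR (g1 * y) + g2 * expR (- g2 * y)) / K.
Let E2 y := (g1 ^+ 2 * expR (g1 * y) - g2 ^+ 2 * expR (- g2 * y)) / K.
Let E3 y := (g1 ^+ 3 * expR (g1 * y) + g2 ^+ 3 * expR (- g2 * y)) / K.

Let is_derive_exp (k y : R) : is_derive y 1 (fun y => expR (k * y)) (k * expR (k * y)).
Proof.
rewrite mulrC.
apply: (is_derive1_comp (f := expR) (g := fun y => k * y)).
by apply: is_derive_eq; rewrite /GRing.scale/= mulr1.
Qed.

Let is_derive_comb (k l m y : R) :
  is_derive y 1 (fun y => (k * expR (g1 * y) + l * expR (- g2 * y)) / m)
    ((k * g1 * expR (g1 * y) - l * g2 * expR (- g2 * y)) / m).
Proof.
have := is_derive_exp g1 y; have := is_derive_exp (- g2) y => h1 h2.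
by apply: is_derive_eq; rewrite /GRing.scale/=; ring.
Qed.

Let dE0 (y : R) : is_derive y 1 E0 (E1 y).
Proof.
have := is_derive_comb 1 (- 1) K y; congr (is_derive _ _ _ _); rewrite /E0 /E1.
  by apply/funext => z; rewrite mul1r mulN1r.
by congr (_ / _); ring.
Qed.

Let dE1 (y : R) : is_derive y 1 E1 (E2 y).
Proof.
have := is_derive_comb g1 g2 K y; congr (is_derive _ _ _ _).
Qed.

Let dE2 (y : R) : is_derive y 1 E2 (E3 y).
Proof.
have := is_derive_comb (g1 ^+ 2) (- g2 ^+ 2) K y; congr (is_derive _ _ _ _);
  rewrite /E2 /E3.
  by apply/funext => z; congr (_ / _); ring.
by congr (_ / _); ring.
Qed.

Let q y := E1 0 * y + E2 0 / 2 * y ^+ 2.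
Let q1 y := E1 0 + E2 0 * y.

Let F y := if y <= b then (if y <= 0 then q y else E0 y) else E0 b + (y - b).
Let F1 y := if y <= b then (if y <= 0 then q1 y else E1 y) else 1.
Let F2 y := if y <= b then (if y <= 0 then E2 0 else E2 y) else 0.

Let E0_0 : E0 0 = 0. Proof. by rewrite /E0 !mulr0 subrr mul0r. Qed.
Let E1_b : E1 b = 1. Proof. by rewrite /E1 divff// lt0r_neq0. Qed.
Let E2_b : E2 b = 0. Proof. by rewrite /E2 b_crit subrr mul0r. Qed.

Let dF (y : R) : is_derive y 1 F (F1 y).
Proof.
apply: (is_derive_glue (u := fun y => if y <= 0 then q y else E0 y)
  (v := fun y => E0 b + (y - b)) (du := fun y => if y <= 0 then q1 y else E1 y)
  (dv := fun=> 1)) => [||{y}|{y}].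
- apply: is_derive_glue => // [{}y|{y}|{y}].
  + by apply: is_derive_eq; rewrite /q1 /GRing.scale/=; field.
  + by rewrite /q E0_0 expr0n/=; ring.
  + by rewrite /q1 mulr0 addr0.
- by move=> {}y; apply: is_derive_eq; rewrite /GRing.scale/=; ring.
- by rewrite leNgt b_gt0/= subrr addr0.
- by rewrite leNgt b_gt0.
Qed.

Let dF1 (y : R) : is_derive y 1 F1 (F2 y).
Proof.
apply: (is_derive_glue (u := fun y => if y <= 0 then q1 y else E1 y)
  (v := fun y => 1) (du := fun y => if y <= 0 then E2 0 else E2 y)
  (dv := fun=> 0)) => [|{y}|{y}].
- apply: is_derive_glue => // [{}y|{y}].
  + by apply: is_derive_eq; rewrite /GRing.scale/=; ring.
  + by rewrite /q1 mulr0 addr0.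
- by rewrite leNgt b_gt0.
- by rewrite leNgt b_gt0.
Qed.

(** [F2] is [E2] after projection onto [[0, b]] (at the upper end because [E2 b = 0]), so its
    Lipschitz bound across [0] and [b] reduces to a bound on [E3] over [[0, b]]. *)
Let clamp y := Num.min (Num.max y 0) b.

Let clamp_itv y : 0 <= clamp y <= b.
Proof. by rewrite /clamp le_min le_max lexx orbT (ltW b_gt0)/= ge_min lexx orbT. Qed.

Let clamp_lip y z : `|clamp y - clamp z| <= `|y - z|.
Proof.
rewrite /clamp; move: b_gt0 => b0.
have [y0|y0] := leP y 0; have [z0|z0] := leP z 0;
  rewrite ?(min_l (ltW b0)); (try have [yb|yb] := leP y b); (try have [zb|zb] := leP z b);
  rewrite ler_norml; apply/andP; split; 
  have := ler_norm (y - z); have := ler_norm (z - y); rewrite (distrC z y); lra.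
Qed.

Let F2_clamp y : F2 y = E2 (clamp y).
Proof.
rewrite /F2 /clamp; move: b_gt0 => b0.
have [y0|y0] := leP y 0; first by rewrite (le_trans y0 (ltW b0)) min_l// ltW.
by case: leP => // _; rewrite E2_b.
Qed.

(** In [E3] the exponential with [g1] increases and is largest at [b]; the one with [g2] decreases
    and is at most [1]. *)
Let C3 := E3 b + g2 ^+ 3 / K.

Let E3_bnd y : 0 <= y <= b -> `|E3 y| <= C3.
Proof.
move=> /andP[y0 yb].
rewrite ger0_norm; last by rewrite divr_ge0 ?addr_ge0 ?mulr_ge0 ?exprn_ge0 ?expR_ge0// ltW.
rewrite /C3 /E3 -mulrDl ler_pM2r ?invr_gt0//.
have : g2 ^+ 3 * expR (- g2 * y) <= g2 ^+ 3.
  rewrite ler_piMr ?exprn_ge0 ?(ltW g2_gt0)// -expR0 ler_expR mulNr oppr_le0.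
  by rewrite mulr_ge0 ?(ltW g2_gt0).
have : g1 ^+ 3 * expR (g1 * y) <= g1 ^+ 3 * expR (g1 * b).
  by rewrite ler_pM2l ?exprn_gt0// ler_expR ler_pM2l.
have : 0 <= g2 ^+ 3 * expR (- g2 * b)
  by rewrite mulr_ge0 ?expR_ge0 ?exprn_ge0 ?(ltW g2_gt0).
lra.
Qed.

Let F2_lip y z : `|F2 y - F2 z| <= C3 * `|y - z|.
Proof.
have C30 : 0 <= C3.
  by rewrite (le_trans (normr_ge0 (E3 0)))// E3_bnd// lexx (ltW b_gt0).
rewrite !F2_clamp (le_trans (@mvt_bound _ _ _ _ _ C3 dE2 _))//.
  move=> w /andP[w0 wb]; apply: E3_bnd.
  have /andP[y0 yb] := clamp_itv y; have /andP[z0 zb] := clamp_itv z.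
  by apply/andP; split; [apply: le_trans w0; rewrite le_min y0|apply: (le_trans wb);
    rewrite ge_max yb].
by rewrite ler_wpM2l// clamp_lip.
Qed.

Let F2_bnd y : `|F2 y| <= C3 * b.
Proof.
rewrite -[F2 y]subr0 -[in X in _ - X]E2_b F2_clamp.
have C30 : 0 <= C3.
  by rewrite (le_trans (normr_ge0 (E3 0)))// E3_bnd// lexx (ltW b_gt0).
have /andP[y0 yb] := clamp_itv y.
rewrite (le_trans (@mvt_bound _ _ _ _ _ C3 dE2 _))//.
  move=> w /andP[w0 wb]; apply: E3_bnd.
  apply/andP; split; first by apply: le_trans w0; rewrite le_min y0 ltW.
  by apply: (le_trans wb); rewrite ge_max yb lexx.
by rewrite ler_wpM2l// ler0_norm ?subr_le0// opprB gerBl.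
Qed.

Let E1_ge0 y : 0 <= E1 y.
Proof. by rewrite divr_ge0 ?addr_ge0 ?mulr_ge0 ?expR_ge0// ltW. Qed.

Let F1_bnd y : 0 <= y -> 0 <= F1 y <= 1 + g2 / K.
Proof.
move=> y0; rewrite /F1; have [yb|yb] := leP y b; last first.
  by rewrite ler01 lerDl divr_ge0 ?ltW.
have -> : (if y <= 0 then q1 y else E1 y) = E1 y.
  case: ifPn => // y0'; have -> : y = 0 by apply/eqP; rewrite eq_le y0 y0'.
  by rewrite /q1 mulr0 addr0.
rewrite E1_ge0/= -E1_b /E1 -mulrDl ler_pM2r ?invr_gt0//.
have : g2 * expR (- g2 * y) <= g2.
  rewrite ler_piMr ?(ltW g2_gt0)// -expR0 ler_expR mulNr oppr_le0.
  by rewrite mulr_ge0 ?(ltW g2_gt0).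
have : g1 * expR (g1 * y) <= g1 * expR (g1 * b).
  by rewrite ler_pM2l// ler_expR ler_pM2l.
have : 0 <= g2 * expR (- g2 * b) by rewrite mulr_ge0 ?expR_ge0 ?(ltW g2_gt0).
lra.
Qed.

Let E_ode y : mu * E1 y + sigma2 / 2 * E2 y = delta * E0 y.
Proof.
rewrite [in RHS]/E0 mulrBl mulrBr -{1}g1_root -{1}g2_root /E1 /E2; ring.
Qed.

Let F_itv y : 0 <= y -> y <= b -> [/\ F y = E0 y, F1 y = E1 y & F2 y = E2 y].
Proof.
move=> y0 yb; rewrite /F /F1 /F2 yb; case: ifPn => // y0'.
have -> : y = 0 by apply/eqP; rewrite eq_le y0 y0'.
by split=> //; rewrite /q /q1 ?E0_0; ring.
Qed.

Let F_gt y : b < y -> [/\ F y = E0 b + (y - b), F1 y = 1 & F2 y = 0].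
Proof. by move=> yb; rewrite /F /F1 /F2 leNgt yb. Qed.

(** The ODE at [b], with slope 1 and curvature 0 there. Above [b] the generator of the linear
    continuation is the constant [mu], so this identity gives both generator inequalities. *)
Let mu_E0b : mu = delta * E0 b.
Proof. by rewrite -E_ode E1_b E2_b; ring. Qed.

Lemma exponential_value_smooth :
  exists (F F1 F2 : R -> R) (L : R),
    smooth_value mu sigma2 delta b L F F1 F2 /\
    (forall y, 0 <= y -> F y = if y <= b then E0 y else E0 b + (y - b)).
Proof.
have b0 := b_gt0.
exists F, F1, F2, (C3 + C3 * b + (1 + g2 / K)); split; last first.
  move=> y y0; have [yb|yb] := leP y b; first by have [-> _ _] := F_itv y0 yb.
  by have [-> _ _] := F_gt yb.
have C30 : 0 <= C3.
  by rewrite (le_trans (normr_ge0 (E3 0)))// E3_bnd// lexx (ltW b_gt0).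
have C3b0 : 0 <= C3 * b by rewrite mulr_ge0// ltW.
have gK : 0 <= 1 + g2 / K by rewrite addr_ge0// divr_ge0 ?ltW.
split=> //.
- move=> y z; apply: (le_trans (F2_lip y z)); rewrite ler_wpM2r//; lra.
- move=> y; apply: (le_trans (F2_bnd y)); lra.
- move=> y /F1_bnd/andP[-> h] /=; lra.
- move=> y y0; have [yb|yb] := leP y b.
    by have [-> -> ->] := F_itv y0 yb; rewrite E_ode.
  have [-> -> ->] := F_gt yb; rewrite {1}mu_E0b.
  have : 0 <= delta * (y - b) by rewrite mulr_ge0 ?(ltW delta_gt0)// subr_ge0 ltW.
  lra.
- move=> y s y0 s0 ys; have [yb|yb] := leP y b.
    have [-> -> ->] := F_itv y0 yb; rewrite E_ode.
    have : 0 <= delta * s by rewrite mulr_ge0 ?(ltW delta_gt0).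
    lra.
  have [-> -> ->] := F_gt yb; rewrite {1}mu_E0b.
  have : 0 <= delta * (b + s - y) by rewrite mulr_ge0 ?(ltW delta_gt0)// subr_ge0.
  lra.
- move=> y; rewrite le_eqVlt => /predU1P[<-|yb]; first by rewrite subrr addr0.
  have [-> _ _] := F_gt yb.
  by have [->] := F_itv (ltW b0) (lexx b).
- by have [->] := F_itv (lexx 0) (ltW b0).
- move=> u u0; rewrite /F.
  have -> : - u <= b by lra.
  rewrite oppr_le0 u0.
  (* Concavity at [0], from [g1 < g2]; it makes both terms of [- q (- u)] nonnegative. *)
  have E20 : E2 0 <= 0.
    rewrite /E2 !mulr0 expR0 !mulr1 pmulr_lle0 ?invr_gt0//.
    rewrite subr_le0 ler_sqr ?nnegrE ?(ltW g1_lt_g2)//; exact: ltW.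
  have := F2_bnd 0; rewrite F2_clamp /clamp maxxx min_l ?(ltW b0)// ler0_norm// => E2b.
  have [_ F10 _] := F_itv (lexx 0) (ltW b0).
  have := F1_bnd (lexx 0); rewrite F10 => /andP[h1 h2].
  have -> : - q (- u) = E1 0 * u + (- E2 0) / 2 * u ^+ 2 by rewrite /q; ring.
  move: (E1 0) (E2 0) E20 E2b h1 h2 (sqr_ge0 u) => e1 e2 *.
  set L := _ + _ + _.
  have e1u : 0 <= e1 * u <= L * u.
    by rewrite mulr_ge0//= ler_wpM2r// /L; lra.
  have e2u : 0 <= - e2 / 2 * u ^+ 2 <= L * u ^+ 2.
    by rewrite mulr_ge0 ?ler_wpM2r//= /L; lra.
  by move: e1u e2u; rewrite mulrDr; lra.
Qed.

End exponential_value.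


(** * Roots of the characteristic equation and the barrier *)

Section diffusion_value.
Context {R : realType}.
Variables mu sigma2 delta : R.
Hypotheses (mu_gt0 : 0 < mu) (sigma2_gt0 : 0 < sigma2) (delta_gt0 : 0 < delta).

Let g1 := gamma1 mu sigma2 delta.
Let g2 := gamma2 mu sigma2 delta.
Let b := diffusion_barrier mu sigma2 delta.
Let disc := Num.sqrt (mu ^+ 2 + 2 * delta * sigma2).

Let disc2 : disc ^+ 2 = mu ^+ 2 + 2 * delta * sigma2.
Proof. by rewrite sqr_sqrtr// addr_ge0// ?sqr_ge0// !mulr_ge0// ltW. Qed.

Let mu_lt_disc : mu < disc.
Proof.
have : 0 < delta * sigma2 by rewrite mulr_gt0.
have := disc2; have : 0 <= disc := sqrtr_ge0 _.
nra.
Qed.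

Let g1_gt0 : 0 < g1.
Proof. by rewrite /g1 /gamma1 divr_gt0// -/disc; move: mu_lt_disc; lra. Qed.

Let g1_lt_g2 : g1 < g2.
Proof. by rewrite /g1 /g2 /gamma1 /gamma2 ltr_pM2r ?invr_gt0//; move: mu_gt0; lra. Qed.

Let g1_root : mu * g1 + sigma2 / 2 * g1 ^+ 2 = delta.
Proof.
have s0 := lt0r_neq0 sigma2_gt0.
have -> : mu * g1 + sigma2 / 2 * g1 ^+ 2 = (disc ^+ 2 - mu ^+ 2) / (2 * sigma2).
  by rewrite /g1 /gamma1 -/disc; field.
by rewrite disc2; field.
Qed.

Let g2_root : sigma2 / 2 * g2 ^+ 2 - mu * g2 = delta.
Proof.
have s0 := lt0r_neq0 sigma2_gt0.
have -> : sigma2 / 2 * g2 ^+ 2 - mu * g2 = (disc ^+ 2 - mu ^+ 2) / (2 * sigma2).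
  by rewrite /g2 /gamma2 -/disc; field.
by rewrite disc2; field.
Qed.

Let g2_gt0 : 0 < g2. Proof. exact: lt_trans g1_lt_g2. Qed.

Lemma diffusion_barrier_gt0 : 0 < b.
Proof.
rewrite /b /diffusion_barrier -/g1 -/g2 mulr_gt0//.
  by rewrite divr_gt0// addr_gt0.
by rewrite ln_gt0// ltr_pdivlMr// mul1r.
Qed.

(** The barrier solves [(g1 + g2) b = 2 ln (g2 / g1)]; exponentiate. *)
Let b_crit : g1 ^+ 2 * expR (g1 * b) = g2 ^+ 2 * expR (- g2 * b).
Proof.
have s0 : g1 + g2 != 0 by rewrite gt_eqF// addr_gt0.
have h : expR (g1 * b) = expR (- g2 * b) * (g2 / g1 * (g2 / g1)).
  have g0 : g2 / g1 \is Num.pos by rewrite posrE divr_gt0.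
  rewrite -(lnK g0) -!expRD; congr expR.
  by rewrite /b /diffusion_barrier -/g1 -/g2; field.
by rewrite h; field; exact: lt0r_neq0.
Qed.

Lemma diffusion_value_smooth :
  exists (F F1 F2 : R -> R) (L : R),
    smooth_value mu sigma2 delta b L F F1 F2 /\
    (forall y, 0 <= y -> F y = diffusion_value mu sigma2 delta y).
Proof.
exact: (exponential_value_smooth delta_gt0 g1_gt0 g1_lt_g2 g1_root g2_root
  diffusion_barrier_gt0 b_crit).
Qed.

End diffusion_value.

(** * The surplus on a grid *)

(** The preimage is split along the countably many values of [N]. This serves for sums over a random
    range of claims and for the claim with a random number. *)
Lemma measurable_random_index d d' (T : measurableType d) (T' : measurableType d')
    (N : T -> nat) (f : nat -> T -> T') :
  measurable_fun setT N -> (forall j, measurable_fun setT (f j)) ->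
  measurable_fun setT (fun w => f (N w) w).
Proof.
move=> mN mf _ A mA; rewrite setTI.
have -> : (fun w => f (N w) w) @^-1` A =
    \bigcup_j ((N @^-1` [set j]) `&` (f j @^-1` A)).
  apply/seteqP; split => [w /= fA|w [j _ [/= ->]]//].
  by exists (N w).
by apply: bigcupT_measurable => j; apply: measurableI;
  rewrite -[X in measurable X]setTI; [exact: mN|exact: mf].
Qed.

(* [M k] is the number of claims up to the [k]-th grid time, [s] the premium income
   of a grid step, [b] the barrier; the chain is frozen (ruin) once it is below [a]. *)
Section killed_chain.
Context {R : realType} {T : Type}.
Variables (M : nat -> T -> nat) (Z : nat -> T -> R) (s a b x : R).

Definition claims_between (k : nat) (w : T) : R :=
  \sum_(M k w <= i < M k.+1 w) Z i w.

Fixpoint killed_chain (k : nat) (w : T) : R :=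
  if k is k.+1 then
    let y := killed_chain k w in
    if y < a then y else Num.min (y + s - claims_between k w) b
  else x.

End killed_chain.

(** Up to grid time [k] the chain reads only claims that have already occurred. Hence, where [M k w]
    is [j], the claims from number [j] on may be changed at will; the measurability of the chain
    with respect to its history rests on this. *)
Lemma eq_killed_chain (R : realType) (T : Type) (M : nat -> T -> nat)
    (Z Z' : nat -> T -> R) (s a b x : R) (w : T) (k : nat) :
  (forall k, (M k w <= M k.+1 w)%N) ->
  (forall i, (i < M k w)%N -> Z i w = Z' i w) ->
  killed_chain M Z s a b x k w = killed_chain M Z' s a b x k w.
Proof.
move=> ndM; elim: k => [//|k IH] ZZ' /=.
have -> : claims_between M Z k w = claims_between M Z' k w.
  by apply: eq_big_nat => i /andP[_]; exact: ZZ'.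
by rewrite IH// => i iM; apply: ZZ'; exact: leq_trans (ndM k).
Qed.

Lemma killed_chain_le (R : realType) (T : Type) (M : nat -> T -> nat)
    (Z : nat -> T -> R) (s a b x : R) (w : T) (k : nat) :
  x <= b -> killed_chain M Z s a b x k w <= b.
Proof.
move=> xb; elim: k => [//|k IH] /=; case: ifP => _; first exact: IH.
by rewrite ge_min lexx orbT.
Qed.

Section measurable_chain.
Context {R : realType} {d} {T : measurableType d}.
Variables (M : nat -> T -> nat) (Z : nat -> T -> R) (s a b x : R).
Hypothesis mZ : forall i, measurable_fun setT (Z i).

Lemma measurable_claims_between k :
  measurable_fun setT (M k) -> measurable_fun setT (M k.+1) ->
  measurable_fun setT (claims_between M Z k).
Proof.
move=> mM mM'.
apply: (measurable_random_index (f := fun i w => \sum_(i <= l < M k.+1 w) Z l w)) => // i.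
apply: (measurable_random_index (f := fun j w => \sum_(i <= l < j) Z l w)) => // j.
exact: measurable_sum.
Qed.

Lemma measurable_killed_chain k :
  (forall i, (i <= k)%N -> measurable_fun setT (M i)) ->
  measurable_fun setT (killed_chain M Z s a b x k).
Proof.
elim: k => [|k IH] mM /=; first exact: measurable_cst.
have {}IH : measurable_fun setT (killed_chain M Z s a b x k).
  by apply: IH => i ik; apply: mM; exact: leqW.
apply: measurable_fun_ifT => //; first exact: measurable_fun_ltr.
apply: measurable_minr => //; apply: measurable_funB.
  exact: measurable_funD.
by apply: measurable_claims_between; apply: mM.
Qed.

End measurable_chain.

(** Both sides are measures in [A] with the same finite total mass that agree on the pi-system [C],
    hence on the sigma-algebra it generates. *)
Lemma pi_system_indep d (T : measurableType d) (R : realType)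
    (P : probability T R) (C : set_system T) (E : set T) :
  measurable E -> C `<=` measurable -> setI_closed C ->
  (forall A, C A -> P (A `&` E) = P A * P E)%E ->
  forall A, <<s C >> A -> P (A `&` E) = (P A * P E)%E.
Proof.
move=> mE Cm CI CE.
pose q : {nonneg R} := NngNum (fine_ge0 (measure_ge0 P E)).
have PEq : P E = q%:num%:E by rewrite fineK ?fin_num_measure.
pose m1 := [the measure _ _ of mrestr P mE].
pose m2 := [the measure _ _ of mscale q P].
have HC : [set X | C X /\ X `<=` [set: T]] = C.
  by apply/seteqP; split => [X []//|X CX]; split.
move=> A; rewrite -{1}HC => sA.
have := @g_sigma_algebra_measure_unique_trace d R T C setT measurableT _ _ m1 m2.
rewrite HC => /(_ Cm CI) h; have := h _ _ _ _ A.
rewrite -HC /m1 /m2 /= /mrestr /mscale PEq /= => {}h.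
rewrite muleC; apply: h => //.
- by rewrite setTI PEq probability_setT mule1.
- by move=> B [CB _]; rewrite muleC -PEq CE.
- by rewrite setTI PEq ltry.
Qed.

(** * Independence of the next claim from the past *)

Section joint_law.
Local Open Scope ereal_scope.
Context {R : realType} d d1 d2 (T : measurableType d) (T1 : measurableType d1)
  (T2 : measurableType d2).
Variables (P : probability T R).

Lemma ge0_integral_mrestr (E : set T) (mE : measurable E) (f : T -> \bar R) :
  measurable_fun setT f -> (forall w, 0 <= f w) ->
  \int[mrestr P mE]_w f w = \int[P]_(w in E) f w.
Proof.
move=> mf f0.
have mEC := measurableC mE.
have dE : [disjoint E & ~` E] by rewrite disj_set2E setICr.
have mf' : measurable_fun (E `|` ~` E) f by rewrite setUv.
rewrite -(setUv E) ge0_integral_setU//=.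
rewrite [X in _ + X](_ : _ = 0) ?adde0.
  apply: eq_measure_integral => A mA AE.
  by rewrite /= /mrestr setIidl.
apply: null_set_integral => //; first exact: measurable_funTS.
by rewrite /= /mrestr setICl measure0.
Qed.

Variables (X1 : {mfun T >-> T1}) (X2 : {mfun T >-> T2}).
Variables (m2 : probability T2 R) (E : set T) (mE : measurable E) (p : R).
Hypothesis p_gt0 : (0 < p)%R.
Hypothesis rect : forall A B, measurable A -> measurable B ->
  P (X1 @^-1` A `&` (E `&` X2 @^-1` B)) = P (X1 @^-1` A) * (p%:E * m2 B).

(** By [rect], the law of [(X1, X2)] on [E] is [p] times a product of probabilities on rectangles.
    Division by [p] identifies it with the product measure, and Tonelli splits the integral. *)
Lemma ge0_integral_joint (f : T1 * T2 -> \bar R) :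
  measurable_fun setT f -> (forall z, 0 <= f z) ->
  \int[P]_(w in E) f (X1 w, X2 w) = p%:E * \int[P]_w \int[m2]_v f (X1 w, v).
Proof.
move=> mf f0.
have mX : measurable_fun setT (fun w => (X1 w, X2 w)) by exact: measurable_fun_pair.
have pV0 : (0 <= p^-1)%R by rewrite invr_ge0 ltW.
pose qV : {nonneg R} := NngNum pV0.
have nuP : exists nu : {measure set (T1 * T2) -> \bar R},
    (nu : set _ -> \bar R) = pushforward (mrestr P mE) (fun w => (X1 w, X2 w)).
  unshelve (eexists [the measure _ _ of
    pushforward (mrestr P mE) (fun w => (X1 w, X2 w))]); first exact: mX.
  by [].
have [nu nuE] := nuP.
pose m' := [the measure _ _ of mscale qV nu].
have h : forall A, measurable A -> (distribution P X1 \x m2) A = m' A.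
  apply: product_measure_unique => A B mA mB.
  rewrite /m' /= /mscale nuE /= /pushforward /mrestr /=.
  have -> : (fun w => (X1 w, X2 w)) @^-1` (A `*` B) `&` E =
      X1 @^-1` A `&` (E `&` X2 @^-1` B).
    by apply/seteqP; split => [w [[]]|w [? []]].
  rewrite rect// muleCA; congr (_ * _).
  by rewrite muleA -EFinM mulVf ?gt_eqF// mul1e.
rewrite -(ge0_integral_mrestr mE (f := fun w => f (X1 w, X2 w)))//; last first.
  exact: measurableT_comp.
have -> : \int[mrestr P mE]_w f (X1 w, X2 w) = \int[nu]_z f z.
  have /= := ge0_integral_pushforward mX (mrestr P mE) measurableT mf.
  rewrite preimage_setT => <-//.
  apply: eq_measure_integral.
  by move=> A mA _; rewrite nuE.
have -> : \int[nu]_z f z = p%:E * \int[m']_z f z.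
  rewrite ge0_integral_mscale// muleA -EFinM /= divff ?gt_eqF// mul1e//.
congr (_ * _).
transitivity (\int[(distribution P X1 \x m2)%E]_z f z).
  by apply: eq_measure_integral => A mA _; apply/esym; exact: h.
rewrite fubini_tonelli1//= ge0_integral_pushforward//.
- exact: measurable_fun_fubini_tonelli_F.
- by move=> x _; exact: integral_ge0.
Qed.

End joint_law.

Section sigma_family_theory.
Context {d d'} {T : measurableType d} {T' : measurableType d'} {I : Type}.
Implicit Types (J : set I) (X : I -> T -> T').

Lemma sub_sigma_family J J' X : J `<=` J' ->
  sigma_family J X `<=` sigma_family J' X.
Proof. by move=> JJ'; apply: sub_sigma_algebra2; exact: bigcup_subset. Qed.

Lemma sigma_family_measurable J X : (forall i, J i -> measurable_fun setT (X i)) ->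
  sigma_family J X `<=` measurable.
Proof.
move=> mX; apply: smallest_sub; first exact: sigma_algebra_measurable.
by move=> _ [i Ji [B mB <-]]; exact: mX.
Qed.

Lemma sigma_family_preimage J X i (B : set T') : J i -> measurable B ->
  sigma_family J X (X i @^-1` B).
Proof.
by move=> Ji mB; apply: sub_sigma_algebra; exists i => //; exists B => //; rewrite setTI.
Qed.

Lemma sigma_familyI J X (A B : set T) :
  sigma_family J X A -> sigma_family J X B -> sigma_family J X (A `&` B).
Proof. exact: (@measurableI _ (g_sigma_algebraType _)). Qed.

Lemma sigma_family_bigcup J X (A : (set T)^nat) :
  (forall i, sigma_family J X (A i)) -> sigma_family J X (\bigcup_i A i).
Proof. exact: (@bigcupT_measurable _ (g_sigma_algebraType _)). Qed.

Lemma sigma_familyC J X (A : set T) : sigma_family J X A -> sigma_family J X (~` A).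
Proof. exact: sigma_algebraC. Qed.

Lemma sigma_family_set0 J X : sigma_family J X set0.
Proof. exact: sigma_algebra0. Qed.

Lemma sigma_family_setT J X : sigma_family J X setT.
Proof. exact: (@measurableT _ (g_sigma_algebraType _)). Qed.

End sigma_family_theory.

Section claims_independence.
Context {R : realType} {d} {T : measurableType d} {P : probability T R}.
Variables (N : counting_process P) (Z : nat -> {RV P >-> R}) (rate h : R).
Hypotheses (rate_gt0 : 0 < rate) (h_gt0 : 0 < h).
Hypothesis N_poisson : poisson_process rate N.
Hypothesis Z_indep : mutually_independent P (fun i => Z i : T -> R).
Hypothesis NZ_indep : indep_sets P
  (sigma_family [set t | 0 <= t] (fun t => N t : T -> nat))
  (sigma_family [set: nat] (fun i => Z i : T -> R)).
Hypothesis Z_law : forall i (B : set R), measurable B ->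
  P (Z i @^-1` B) = P (Z 0%N @^-1` B).

Let M (k : nat) (w : T) : nat := N (k%:R * h) w.
Let past t := sigma_family [set u | 0 <= u <= t] (fun u => N u : T -> nat).
Let incr (k m : nat) : set T := [set w | (M k.+1 w - M k w)%N = m].

Let kh_ge0 k : 0 <= k%:R * h. Proof. by rewrite mulr_ge0// ltW. Qed.
Let kh_lt k : k%:R * h < k.+1%:R * h. Proof. by rewrite ltr_pM2r// ltr_nat. Qed.

Let past_measurable t : past t `<=` measurable.
Proof. by apply: sigma_family_measurable => u _. Qed.

Let incrE k m : incr k m = \bigcup_i (M k @^-1` [set i] `&`
  M k.+1 @^-1` [set j | (j - i)%N = m]).
Proof.
by apply/seteqP; split => [w im|w [i _ [/= <-]]//]; exists (M k w).
Qed.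

Let incr_sigma k m :
  sigma_family [set t | 0 <= t] (fun t => N t : T -> nat) (incr k m).
Proof.
rewrite incrE; apply: sigma_family_bigcup => i; apply: sigma_familyI.
  exact: (@sigma_family_preimage _ _ _ _ _ [set t | 0 <= t]
    (fun t => N t : T -> nat) (k%:R * h) _ (kh_ge0 k)).
exact: (@sigma_family_preimage _ _ _ _ _ [set t | 0 <= t]
  (fun t => N t : T -> nat) (k.+1%:R * h) _ (kh_ge0 k.+1)).
Qed.

Lemma measurable_incr k m : measurable (incr k m).
Proof. by apply: (sigma_family_measurable _ (incr_sigma k m)) => t _. Qed.

Let past_incr k m A : past (k%:R * h) A ->
  P (A `&` incr k m) = (P A * (poisson_pmf (rate * h) m)%:E)%E.
Proof.
move=> pA; have [Npmf Nind] := N_poisson.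
rewrite (Nind _ _ (kh_ge0 k) (kh_lt k))//.
  rewrite (Npmf _ _ _ (kh_ge0 k) (kh_lt k)); congr (_ * (poisson_pmf _ _)%:E)%E.
  by rewrite -mulrBl -natrB// subSnn mul1r.
exists [set m] => //; rewrite setTI.
by apply/seteqP; split.
Qed.

Let J (j : nat) : {fset nat} := [fset i in iota 0 j]%fset.
Let inJ j i : (i \in J j) = (i < j)%N.
Proof. by rewrite /J in_fset /= mem_iota. Qed.

Let cyl (j : nat) (B : nat -> set R) := \bigcap_(i in [set` J j]) Z i @^-1` B i.

Let cyl_sigma j B : (forall i, measurable (B i)) ->
  sigma_family [set: nat] (fun i => Z i : T -> R) (cyl j B).
Proof.
move=> mB.
have -> : cyl j B = ~` \bigcup_i (if (i < j)%N then ~` (Z i @^-1` B i) else set0).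
  rewrite setC_bigcup; apply/seteqP; split => [w cw i _|w cw i].
    by case: ifPn => [ij|_ //]; rewrite setCK; apply: cw; rewrite /= inJ.
  by rewrite /= inJ => ij; have := cw i Logic.I; rewrite ij setCK.
apply: sigma_familyC; apply: sigma_family_bigcup => i.
case: ifPn => _; last exact: sigma_family_set0.
apply: sigma_familyC.
exact: (sigma_family_preimage (X := fun i => Z i : T -> R)).
Qed.

(** Mutual independence speaks of one family of sets, so [B'] is inserted at index [j] and the index
    set [J j] is enlarged by [j]. *)
Let cyl_next j B B' : (forall i, measurable (B i)) -> measurable B' ->
  P (cyl j B `&` Z j @^-1` B') = (P (cyl j B) * P (Z 0%N @^-1` B'))%E.
Proof.
move=> mB mB'; pose C i := if i == j then B' else B i.
have mC i : measurable (C i) by rewrite /C; case: ifP.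
have jJ : j \notin J j by rewrite inJ ltnn.
have cC : cyl j B = cyl j C.
  apply: eq_bigcapr => i; rewrite /= inJ /C => ij.
  by rewrite ifF// ltn_eqF.
have Cj : B' = C j by rewrite /C eqxx.
rewrite -(Z_law j mB') Cj cC setIC /cyl.
rewrite -(bigcap_fsetU1 (fun i => Z i @^-1` C i) j) !Z_indep//.
by rewrite big_fsetU1//= muleC.
Qed.

(* Events before the k-th grid time, restricted to the first [j] claims. *)
Let hist k j : set_system T := [set G | exists A B,
  [/\ past (k%:R * h) A, (forall i, measurable (B i)) & G = A `&` cyl j B]].

Let hist_measurable k j : hist k j `<=` measurable.
Proof.
move=> _ [A [B [pA mB ->]]]; apply: measurableI; first exact: (past_measurable pA).
by apply: (sigma_family_measurable _ (cyl_sigma j mB)) => i _; exact: measurable_funPT.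
Qed.

Let histI k j : setI_closed (hist k j).
Proof.
move=> _ _ [A [B [pA mB ->]]] [A' [B' [pA' mB' ->]]].
exists (A `&` A'), (fun i => B i `&` B' i); split.
- exact: sigma_familyI.
- by move=> i; exact: measurableI.
- rewrite setIACA; congr (_ `&` _); rewrite /cyl -bigcapI.
  by apply: eq_bigcapr => i _; rewrite preimage_setI.
Qed.

(** Three independences combine: of the increment from the past of [N], of claim number [j] from the
    earlier ones, and of all claims from [N]. They give the product formula on [hist], which is
    closed under intersection. *)
Let hist_indep k j m (B' : set R) : measurable B' -> forall G, <<s hist k j >> G ->
  P (G `&` (incr k m `&` Z j @^-1` B')) =
  (P G * ((poisson_pmf (rate * h) m)%:E * P (Z 0%N @^-1` B')))%E.
Proof.
move=> mB'.
have ZB : measurable (Z j @^-1` B') by rewrite -[X in measurable X]setTI;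
  exact: measurable_funPT.
have sZ : sigma_family [set: nat] (fun i => Z i : T -> R) (Z j @^-1` B').
  exact: (sigma_family_preimage (X := fun i => Z i : T -> R)).
have past_all A : past (k%:R * h) A ->
    sigma_family [set t | 0 <= t] (fun t => N t : T -> nat) A.
  by apply: sub_sigma_family => t /= /andP[].
have PE : P (incr k m `&` Z j @^-1` B') =
    ((poisson_pmf (rate * h) m)%:E * P (Z 0%N @^-1` B'))%E.
  rewrite NZ_indep// Z_law//; congr (_ * _)%E.
  have := @past_incr k m setT; rewrite setTI probability_setT mul1e; apply.
  exact: sigma_family_setT.
rewrite -PE; apply: (pi_system_indep (C := hist k j)) => //.
- by apply: measurableI => //; exact: measurable_incr.
- move=> _ [A [B [pA mB ->]]]; rewrite PE setIACA.
  rewrite NZ_indep//; last 2 first.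
  + by apply: sigma_familyI => //; exact: past_all.
  + by apply: sigma_familyI => //; exact: cyl_sigma.
  rewrite past_incr// cyl_next// NZ_indep//; last 2 first.
  + exact: past_all.
  + exact: cyl_sigma.
  by rewrite !muleA; congr (_ * _)%E; rewrite -!muleA; congr (_ * _)%E; rewrite muleC.
Qed.

Variables (s a b x : R) (zf : R -> R).
Hypothesis mzf : measurable_fun setT zf.

Let chain := killed_chain M (fun i w => zf (Z i w)) s a b x.

Let ndM w k : (M k w <= M k.+1 w)%N.
Proof. by apply: counting_nd; rewrite ?kh_ge0// ltW. Qed.

Lemma measurable_chain k : measurable_fun setT (chain k).
Proof.
by apply: measurable_killed_chain => [i|i _];
  [exact: measurableT_comp|exact: measurable_funPT].
Qed.

(** With the claims from number [j] on set to [0], the chain is built from functions measurable for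
    [hist k j] alone; where [M k] is [j] this changes nothing. *)
Let chain_hist k j (A : set R) : measurable A ->
  <<s hist k j >> (M k @^-1` [set j] `&` chain k @^-1` A).
Proof.
move=> mA.
pose Zj i : T -> R := if (i < j)%N then fun w => zf (Z i w) else fun=> 0.
have -> : M k @^-1` [set j] `&` chain k @^-1` A =
    M k @^-1` [set j] `&` killed_chain M Zj s a b x k @^-1` A.
  have E w : M k w = j -> chain k w = killed_chain M Zj s a b x k w.
    by move=> Mj; apply: eq_killed_chain => // i; rewrite Mj /Zj => ->.
  by apply/seteqP; split => w [/= Mj]; rewrite (E _ Mj).
have mM i : (i <= k)%N ->
    measurable_fun (setT : set (g_sigma_algebraType (hist k j))) (M i).
  move=> ik _ Y mY; rewrite setTI; apply: sub_sigma_algebra.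
  exists (M i @^-1` Y), (fun=> setT); split => //.
  - have ikh : [set u | 0 <= u <= k%:R * h] (i%:R * h).
      by rewrite /= kh_ge0 ler_pM2r// ler_nat.
    exact: (sigma_family_preimage (X := fun t => N t : T -> nat) ikh).
  - by rewrite /cyl; apply/seteqP; split => [w Mw|w []//]; split.
have mZj i : measurable_fun (setT : set (g_sigma_algebraType (hist k j))) (Zj i).
  rewrite /Zj; case: ifPn => ij; last exact: measurable_cst.
  apply: (measurableT_comp mzf) => _ Y mY; rewrite setTI; apply: sub_sigma_algebra.
  exists setT, (fun l => if l == i then Y else setT); split.
  - exact: sigma_family_setT.
  - by move=> l; case: ifP.
  - rewrite setTI; apply/seteqP; split => [w Yw l /=|w /(_ i)].
      by case: eqVneq => [->|].
    by rewrite /= inJ eqxx; exact.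
apply: (@measurableI _ (g_sigma_algebraType (hist k j))).
  by rewrite -[X in measurable X]setTI; exact: mM.
rewrite -[X in measurable X]setTI.
exact: (measurable_killed_chain (T := g_sigma_algebraType (hist k j)) s a b x mZj mM).
Qed.

(** Claims are numbered from [0], so the first claim after grid time [k] has number [M k]. *)
Let next_claim k w := Z (M k w) w.

Lemma measurable_next_claim k : measurable_fun setT (next_claim k).
Proof.
by apply: (measurable_random_index (f := fun i => Z i)) => [|j]; exact: measurable_funPT.
Qed.

(** On the piece where [M k] is [j] the next claim is [Z j], independent of the history and with a
    law that does not depend on [j]; therefore the pieces sum up to a product. *)
Lemma chain_rect k m (A B : set R) : measurable A -> measurable B ->
  P (chain k @^-1` A `&` (incr k m `&` next_claim k @^-1` B)) =
  (P (chain k @^-1` A) * ((poisson_pmf (rate * h) m)%:E * P (Z 0%N @^-1` B)))%E.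
Proof.
move=> mA mB.
have mc : measurable (chain k @^-1` A).
  by rewrite -[X in measurable X]setTI; exact: measurable_chain.
have mn : measurable (incr k m `&` next_claim k @^-1` B).
  apply: measurableI; first exact: measurable_incr.
  by rewrite -[X in measurable X]setTI; exact: measurable_next_claim.
have mMk j : measurable (M k @^-1` [set j]).
  by rewrite -[X in measurable X]setTI; exact: measurable_funPT.
have split_j (E : set T) : measurable E ->
    P E = (\sum_(j <oo) P (M k @^-1` [set j] `&` E))%E.
  move=> mE; rewrite -measure_semi_bigcup//.
  - congr (P _); rewrite -setI_bigcupl.
    rewrite [X in X `&` _](_ : _ = setT) ?setTI//.
    by apply/seteqP; split => // w _; exists (M k w).
  - by move=> j; exact: measurableI.
  - apply: trivIset_setIr; apply/trivIsetP => i j _ _ ij.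
    by apply/seteqP; split => // w [/= -> ij']; rewrite ij' eqxx in ij.
  - by apply: bigcupT_measurable => j; exact: measurableI.
rewrite (split_j _ (measurableI _ _ mc mn)) (split_j _ mc).
set q := ((poisson_pmf _ _)%:E * _)%E.
have qE : q = (fine q)%:E.
  rewrite fineK// fin_numM// fin_num_measure//.
  by rewrite -[X in measurable X]setTI; exact: measurable_funPT.
rewrite muleC qE -nneseriesZl//.
apply: eq_eseriesr => j _; rewrite -qE setIA muleC.
rewrite -(@hist_indep k j m B mB); last exact: chain_hist.
congr (P _); apply/seteqP; split => w [[/= Mj cA] [im]]; rewrite /= /next_claim Mj//.
Qed.

Lemma ge0_integral_chain k m (f : R * R -> \bar R) :
  measurable_fun setT f -> (forall z, 0 <= f z)%E ->
  (\int[P]_(w in incr k m) f (chain k w, next_claim k w) =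
  (poisson_pmf (rate * h) m)%:E * \int[P]_w \int[P]_v f (chain k w, Z 0 v))%E.
Proof.
move=> mf f0.
pose X1 : {mfun T >-> R} := HB.pack (chain k) (isMeasurableFun.Build _ _ _ _ _
  (measurable_chain k)).
pose X2 : {mfun T >-> R} := HB.pack (next_claim k) (isMeasurableFun.Build _ _ _ _ _
  (measurable_next_claim k)).
have p_gt0 : 0 < poisson_pmf (rate * h) m.
  have rh : 0 < rate * h by rewrite mulr_gt0.
  rewrite /poisson_pmf rh; apply: mulr_gt0; last exact: expR_gt0.
  by apply: divr_gt0; [exact: exprn_gt0|rewrite ltr0n fact_gt0].
have := @ge0_integral_joint _ _ _ _ _ _ _ P X1 X2 (distribution P (Z 0%N)) _
  (measurable_incr k m) _ p_gt0 (@chain_rect k m) f mf f0.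
rewrite /= => ->; congr (_ * _)%E; apply: eq_integral => w _.
rewrite ge0_integral_distribution//.
by apply: (measurableT_comp mf); exact: pair1_measurable.
Qed.

End claims_independence.

(** * Pathwise comparison with the grid *)

(** Summation by parts: against decreasing weights, a sequence that stays in [[0, m]] contributes at
    most [m] times the first weight, however often it oscillates. It is meant for the gap between
    true and grid dividends. *)
Lemma abel_le (R : realType) (v e : nat -> R) (m : R) K :
  (forall k, 0 <= v k) -> (forall k, v k.+1 <= v k) -> (forall k, 0 <= e k <= m) ->
  \sum_(k < K) v k * (e k.+1 - e k) <= m * v 0%N.
Proof.
move=> v0 vd em.
(* The induction has to carry the boundary term of the summation by parts. *)
suff : \sum_(k < K) v k * (e k.+1 - e k) <= m * v 0%N + v K * (e K - m).
  have := em K; have := v0 K; nra.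
elim: K => [|K IH].
  rewrite big_ord0; have := em 0; have := v0 0%N; nra.
rewrite big_ord_recr/=; have := em K.+1; have := vd K; nra.
Qed.

Lemma abel_ge (R : realType) (v e : nat -> R) K :
  (forall k, 0 <= v k) -> (forall k, v k.+1 <= v k) -> (forall k, 0 <= e k) ->
  - (v 0%N * e 0%N) <= \sum_(k < K) v k * (e k.+1 - e k).
Proof.
move=> v0 vd em.
suff : v K * e K - v 0%N * e 0%N <= \sum_(k < K) v k * (e k.+1 - e k).
  have := em K; have := v0 K; nra.
elim: K => [|K IH]; first by rewrite big_ord0 subrr.
rewrite big_ord_recr/=; have := em K.+1; have := vd K; nra.
Qed.


(* The measurability of the payoff as a function of the path is never established:
   the integral of a nonnegative function is a supremum over simple functions, so
   it is monotone anyway. *)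
Lemma lower_integral_le d (T : measurableType d) (R : realType)
    (mu : {measure set T -> \bar R}) (f g : T -> \bar R) :
  (forall x, 0 <= f x)%E -> (forall x, f x <= g x)%E ->
  (\int[mu]_x f x <= \int[mu]_x g x)%E.
Proof.
move=> f0 fg; have g0 x : (0 <= g x)%E by exact: le_trans (fg x).
rewrite !ge0_integralTE//; apply: le_ereal_sup => _ [k kf <-].
by exists k => // x; exact: le_trans (fg x).
Qed.

Lemma integral_scale_indic d (T : measurableType d) (R : realType)
    (mu : {measure set T -> \bar R}) (r : R) (A : set T) :
  0 <= r -> measurable A -> (\int[mu]_x (r * \1_A x)%:E = r%:E * mu A)%E.
Proof.
move=> r0 mA; under eq_integral do rewrite EFinM.
rewrite ge0_integralZl_EFin ?integral_indic ?setIT//.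
exact/measurable_EFinP.
Qed.

(** * Step function bounds for Stieltjes integrals *)

Section stieltjes.
Context {R : realType} (f : cumulative R R).
Let mu := lebesgue_stieltjes_measure f.

Lemma stieltjes_itv_oc (s t : R) : s <= t -> mu `]s, t]%classic = (f t - f s)%:E.
Proof.
move=> st; rewrite /mu /lebesgue_stieltjes_measure /measure_extension/=.
by rewrite measurable_mu_extE/= ?wlength_itv_bnd//; exact: is_ocitv.
Qed.

(** The mass of the initial lump sum. The open interval before [0] is exhausted by half-open
    intervals without mass, so all mass of []-1, 0]] sits at [0]. *)
Lemma stieltjes_set1_0 : (forall t, t < 0 -> f t = 0) -> mu [set 0] = (f 0)%:E.
Proof.
move=> f_neg; have f1 : f (- 1) = 0 by rewrite f_neg// oppr_lt0.
have neg0 : mu `]-1, 0[%classic = 0%E.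
  apply: (@subset_measure0 _ _ _ mu _ (\bigcup_n `](- 1), (- n.+1%:R^-1)]%classic)).
  - by [].
  - exact: bigcupT_measurable.
  - move=> t /=; rewrite in_itv/= => /andP[t1 t0].
    have [n nt] : exists n, n.+1%:R^-1 <= - t.
      exists (Num.bound (- t)^-1);
        rewrite -[leRHS]invrK lef_pV2 ?posrE ?invr_gt0 ?oppr_gt0//.
      rewrite -natr1 ltW// ltr_wpDr// archi_boundP// invr_ge0; lra.
    by exists n => //=; rewrite in_itv/= t1/= lerNr.
  - apply/eqP; rewrite eq_le measure_ge0 andbT.
    apply: (le_trans (measure_sigma_subadditive _ _ _ (@subset_refl _ _))) => //.
      exact: bigcupT_measurable.
    rewrite eseries0// => n _ _.
    apply: (etrans (@stieltjes_itv_oc (- 1) (- n.+1%:R^-1) _)).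
      by rewrite lerN2 invf_le1// ler1n.
    by rewrite f1 f_neg ?subrr// oppr_lt0 invr_gt0.
have := @stieltjes_itv_oc (- 1) 0; rewrite f1 subr0 => <-; last by rewrite oppr_le0.
have -> : `](- 1), 0]%classic = `]-1, 0[%classic `|` [set 0 : R].
  apply/seteqP; split => t /=; rewrite !in_itv/=; last first.
    by case=> [/andP[-> /ltW]//|->]; rewrite lexx oppr_lt0 ltr01.
  by case/andP=> -> /=; rewrite le_eqVlt => /predU1P[->|->]; [right|left].
apply/esym; apply: (etrans (measureU mu _ _ _)) => //.
  by apply/seteqP; split => // t [/=]; rewrite in_itv/= => /andP[_ /[swap] ->];
    rewrite ltxx.
by rewrite [X in (X + _)%E]neg0 add0e.
Qed.

Variables (h : R) (h_gt0 : 0 < h).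

Let cell (k : nat) : set R := `](k%:R * h), (k.+1%:R * h)]%classic.

Let cell_cover (t : R) : 0 < t -> exists k, cell k t.
Proof.
move=> t0; have ex : exists k, t <= k%:R * h.
  exists (Num.bound (t / h)); rewrite -ler_pdivrMr// ltW// archi_boundP//.
  by rewrite divr_ge0// ltW.
case: (ex_minnP ex) => -[|k] tk min_k; first by move: tk; rewrite mul0r leNgt t0.
exists k; rewrite /cell /= in_itv/= tk andbT ltNge; apply/negP => /min_k.
by rewrite ltnn.
Qed.

Let mu_cell k : mu (cell k) = (f (k.+1%:R * h) - f (k%:R * h))%:E.
Proof. by rewrite stieltjes_itv_oc// ler_pM2r// ler_nat. Qed.

(** An upper step function on half-open cells, which leave out [0]; the jump there is charged
    through []-1, 0]], on whose negative part [g] is zero. *)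
Lemma stieltjes_integral_le (g : R -> \bar R) (v0 : R) (v : nat -> R) :
  (forall t, 0 <= g t)%E -> 0 <= v0 -> (forall k, 0 <= v k) ->
  (forall t, t < 0 -> g t = 0%E) -> (g 0%R <= v0%:E)%E ->
  (forall k t, k%:R * h < t -> t <= k.+1%:R * h -> (g t <= (v k)%:E)%E) ->
  (\int[mu]_t g t <= (v0 * (f 0 - f (- 1)))%:E +
     \sum_(k <oo) (v k * (f (k.+1%:R * h) - f (k%:R * h)))%:E)%E.
Proof.
move=> g_ge0 v0_ge0 v_ge0 g_neg g_0 g_v.
pose G0 t := (v0 * \1_(`](- 1), 0]%classic : set R) t)%:E.
pose Gk k t := (v k * \1_(cell k) t)%:E.
have G0_ge0 t : (0 <= G0 t)%E by rewrite lee_fin mulr_ge0.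
have Gk_ge0 k t : (0 <= Gk k t)%E by rewrite lee_fin mulr_ge0.
have mG0 : measurable_fun setT G0.
  by apply/measurable_EFinP; apply: measurable_funM => //.
have mGk k : measurable_fun setT (Gk k).
  apply/measurable_EFinP; apply: measurable_funM => //; apply: measurable_indic.
  exact: measurable_itv.
apply: (@le_trans _ _ (\int[mu]_t (G0 t + (\sum_(k <oo) Gk k t)%E))%E).
  apply: lower_integral_le => // t.
  have S_ge0 u : (0 <= \sum_(k <oo) Gk k u)%E by exact: nneseries_ge0.
  have [t0|t0|->] := ltgtP t 0.
  - by rewrite g_neg// adde_ge0.
  - have [k kt] := cell_cover t0.
    apply: (@le_trans _ _ (Gk k t)).
      rewrite /Gk indicE mem_set// mulr1; move: kt.
      by rewrite /cell /= in_itv/= => /andP[]; exact: g_v.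
    apply: (@le_trans _ _ (\sum_(k <oo) Gk k t)%E); last by rewrite leeDr.
    apply: (le_trans _ (nneseries_lim_ge k.+1 _)) => //.
    by rewrite big_nat_recr//= leeDr// sume_ge0.
  - rewrite (le_trans g_0)// (@le_trans _ _ (G0 0))//; last by rewrite leeDl.
    by rewrite /G0 indicE mem_set ?mulr1//= in_itv/= lexx oppr_lt0 ltr01.
rewrite ge0_integralD//; last 2 first.
- by move=> t _; exact: nneseries_ge0.
- by apply: ge0_emeasurable_sum => [k x _ _|k _]; [exact: Gk_ge0|exact: mGk].
rewrite integral_nneseries// /G0 integral_scale_indic//.
rewrite [X in (_ * X)%E]stieltjes_itv_oc ?oppr_le0// -EFinM leeD2l//.
apply: lee_nneseries => k _ => [_|]; first exact: integral_ge0.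
rewrite /Gk integral_scale_indic; [|by []|exact: measurable_itv].
by rewrite [X in (_ * X)%E]mu_cell -EFinM.
Qed.

Lemma stieltjes_integral_ge (g : R -> \bar R) (v0 : R) (v : nat -> R) (K : nat) :
  (forall t, t < 0 -> f t = 0) ->
  (forall t, 0 <= g t)%E -> 0 <= v0 -> (forall k, 0 <= v k) ->
  (v0%:E <= g 0%R)%E ->
  (forall k t, k%:R * h < t -> t <= k.+1%:R * h -> ((v k)%:E <= g t)%E) ->
  ((v0 * f 0 + \sum_(k < K) v k * (f (k.+1%:R * h) - f (k%:R * h)))%:E <=
     \int[mu]_t g t)%E.
Proof.
move=> f_neg g_ge0 v0_ge0 v_ge0 g_0 g_v.
(* The single point instead of []-1, 0]], since a lower step function has to stay below [g], of
   which only nonnegativity is known before [0]. *)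
pose G0 t := (v0 * \1_([set 0] : set R) t)%:E.
pose Gk k t := (v k * \1_(cell k) t)%:E.
have G0_ge0 t : (0 <= G0 t)%E by rewrite lee_fin mulr_ge0.
have Gk_ge0 k t : (0 <= Gk k t)%E by rewrite lee_fin mulr_ge0.
have mG0 : measurable_fun setT G0.
  by apply/measurable_EFinP; apply: measurable_funM => //.
have mGk k : measurable_fun setT (Gk k).
  apply/measurable_EFinP; apply: measurable_funM => //; apply: measurable_indic.
  exact: measurable_itv.
have cell_inj i j t : cell i t -> cell j t -> (i <= j)%N.
  rewrite /cell /= !in_itv/= => /andP[it _] /andP[_ tj].
  have := lt_le_trans it tj; rewrite ltr_pM2r// ltr_nat ltnS//.
apply: (@le_trans _ _ (\int[mu]_t (G0 t + (\sum_(k < K) Gk k t)%E))%E).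
  rewrite ge0_integralD//; last 2 first.
  - by move=> t _; exact: sume_ge0.
  - by apply: emeasurable_sum => k _; exact: mGk.
  have -> : (\int[mu]_t G0 t = (v0 * f 0)%:E)%E.
    rewrite /G0 integral_scale_indic; [|by []|exact: measurable_set1].
    by rewrite [X in (_ * X)%E]stieltjes_set1_0.
  rewrite EFinD; apply: leeD2l; rewrite ge0_integral_sum//; last by move=> k; exact: mGk.
  rewrite -sumEFin; apply: lee_sum => k _.
  rewrite /Gk integral_scale_indic; [|by []|exact: measurable_itv].
  by rewrite [X in (_ * X)%E]mu_cell -EFinM.
apply: lower_integral_le => t; first by rewrite adde_ge0// sume_ge0.
have cell_pos i : cell i t -> 0 < t.
  by rewrite /cell /= in_itv/= => /andP[+ _]; apply: le_lt_trans; rewrite mulr_ge0// ltW.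
have [ex|no] := pselect (exists i, cell i t); last first.
  rewrite big1 ?adde0; last first.
    move=> k _; rewrite /Gk indicE memNset ?mulr0// => kt; apply: no; by exists k.
  rewrite /G0 indicE; have [->|t0] := eqVneq t 0; first by rewrite mem_set// mulr1.
  by rewrite memNset ?mulr0//; exact/eqP.
have [i it] := ex.
rewrite /G0 indicE memNset ?mulr0 ?add0e; last by move=> /= t0; have := cell_pos _ it;
  rewrite t0 ltxx.
have gi : ((v i)%:E <= g t)%E.
  by move: it; rewrite /cell /= in_itv/= => /andP[]; exact: g_v.
have other j : j != i -> Gk j t = 0%E.
  move=> ji; rewrite /Gk indicE memNset ?mulr0// => jt.
  by move/eqP : ji; apply; apply/eqP;
    rewrite eqn_leq (cell_inj _ _ _ it jt) (cell_inj _ _ _ jt it).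
have [iK|Ki] := ltnP i K; last first.
  rewrite big1// => k _; apply: other; rewrite neq_ltn (leq_trans (ltn_ord k) Ki)//.
rewrite (bigD1 (Ordinal iK))//= big1 ?adde0; last by move=> k ki; exact: other.
apply: le_trans gi; rewrite lee_fin ler_piMr// indicE; by case: (_ \in _).
Qed.

End stieltjes.

(** The overflow that the minimum with [b] in [killed_chain] cuts off. *)
Definition chain_dividend {R : realType} {T : Type} (M : nat -> T -> nat)
    (Z : nat -> T -> R) (s a b x : R) (k : nat) (w : T) : R :=
  let y := killed_chain M Z s a b x k w in
  if y < a then 0 else Num.max 0 (y + s - claims_between M Z k w - b).

(** * The barrier strategy and its grid version on a single path *)

Section pathwise.
Context {R : realType} {d} {T : measurableType d} {P : probability T R}.
Variables (N : counting_process P) (Z : nat -> {RV P >-> R}).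
Variables (c x b h delta : R) (w : T).
Hypotheses (c_gt0 : 0 < c) (h_gt0 : 0 < h)
  (delta_gt0 : 0 < delta) (Z_ge0 : forall i, 0 <= Z i w).

Let U t := surplus N Z c x t w.
Let D := dividends N Z c x b w.
Let X t := U t - D t.
Let M (k : nat) (w : T) : nat := N (k%:R * h) w.
Let t_ (k : nat) : R := k%:R * h.
Let J k := claims_between M (fun i w => Z i w) k w.

Let t_ge0 k : 0 <= t_ k. Proof. by rewrite mulr_ge0// ltW. Qed.
Let t_S k : t_ k.+1 = t_ k + h. Proof. by rewrite /t_ -natr1 mulrDl mul1r. Qed.
Let t_le i j : (i <= j)%N -> t_ i <= t_ j.
Proof. by move=> ij; rewrite ler_pM2r// ler_nat. Qed.

Let sum_claims_le i j : (i <= j)%N -> \sum_(l < i) Z l w <= \sum_(l < j) Z l w.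
Proof.
move=> ij; rewrite -!(big_mkord xpredT (fun l => Z l w)).
by rewrite [leRHS](big_cat_nat (n := i))//= lerDl sumr_ge0.
Qed.

Let U_incr s t : 0 <= s -> s <= t -> U t <= U s + c * (t - s).
Proof.
move=> s0 st; rewrite /U /surplus.
have := sum_claims_le (counting_nd N w s0 st); lra.
Qed.

Let U0 : U 0 = x.
Proof. by rewrite /U /surplus counting0 big_ord0 mulr0 addr0 subr0. Qed.

Let J_E k : J k = U (t_ k) - U (t_ k.+1) + c * h.
Proof.
have E : \sum_(i < N (t_ k.+1) w) Z i w = \sum_(i < N (t_ k) w) Z i w + J k.
  rewrite -!(big_mkord xpredT (fun l => Z l w)) [LHS](big_cat_nat (n := M k w))//=.
  by apply: counting_nd; [exact: t_ge0|exact: t_le].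
by rewrite /U /surplus E t_S; ring.
Qed.

Let has_sup_run t : 0 <= t -> has_sup [set surplus N Z c x s w | s in `[0, t]].
Proof.
move=> t0; split; first by exists (U 0), 0 => //=; rewrite in_itv/= lexx.
exists (x + c * t) => _ [s /= + <-]; rewrite in_itv /= => /andP[s0 st].
by rewrite (le_trans (U_incr (lexx 0) s0))// U0 subr0 lerD2l ler_pM2l.
Qed.

Let U_le_D s t : 0 <= s -> s <= t -> U s - b <= D t.
Proof.
move=> s0 st; have t0 := le_trans s0 st; rewrite /D /dividends t0 le_max lerD2r.
apply/orP; right; apply: sup_upper_bound; first exact: has_sup_run.
by exists s => //=; rewrite in_itv/= s0.
Qed.

Let D_le t v : 0 <= t -> 0 <= v -> (forall s, 0 <= s -> s <= t -> U s - b <= v) ->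
  D t <= v.
Proof.
move=> t0 v0 Uv; rewrite /D /dividends t0 ge_max v0/= lerBlDr.
apply: ge_sup; first by have [] := has_sup_run t0.
by move=> _ [s /= + <-]; rewrite in_itv/= => /andP[s0 st]; rewrite -lerBlDr Uv.
Qed.

Let D_ge0 t : 0 <= D t.
Proof. by rewrite /D /dividends; case: ifP => // _; rewrite le_max lexx. Qed.

Let D_nd s t : s <= t -> D s <= D t.
Proof. exact: cumulative_is_nondecreasing. Qed.

Let D_neg t : t < 0 -> D t = 0.
Proof. by move=> t0; rewrite /D /dividends leNgt t0. Qed.

(** The running supremum of [dividends] restricted to grid times; like [dividends] it takes no
    account of ruin. *)
Fixpoint grid_dividends (k : nat) : R :=
  if k is l.+1 then Num.max (grid_dividends l) (U (t_ k) - b)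
  else Num.max 0 (x - b).
Let Dh := grid_dividends.
Let Xh k := U (t_ k) - Dh k.

Let Dh_ge0 k : 0 <= Dh k.
Proof. by elim: k => [|k IH]; rewrite /Dh /= le_max ?lexx// IH. Qed.

Let Dh_le_D k : Dh k <= D (t_ k).
Proof.
elim: k => [|k IH]; rewrite /Dh /= ge_max.
  by rewrite D_ge0/= -U0 U_le_D.
by rewrite (le_trans IH) ?D_nd ?t_le//= U_le_D.
Qed.

(** Claims being nonnegative, the surplus between two grid times exceeds its value at the earlier
    one by at most the premium [c h]. *)
Let D_le_Dh k : D (t_ k) <= Dh k + c * h.
Proof.
have ch0 : 0 <= c * h by rewrite mulr_ge0// ltW.
apply: D_le => //; first by rewrite addr_ge0.
elim: k => [|k IH] s s0 st.
  have -> : s = 0 by apply/eqP; rewrite eq_le s0 andbT; move: st; rewrite /t_ mul0r.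
  rewrite U0 (@le_trans _ _ (Dh 0))//; last by rewrite lerDl.
  by rewrite /Dh/= le_max lexx orbT.
have DS : Dh k <= Dh k.+1 by rewrite {2}/Dh/= le_max lexx.
have [stk|tks] := leP s (t_ k).
  by rewrite (le_trans (IH _ s0 stk))// lerD2r.
rewrite lerBlDr (le_trans (U_incr (t_ge0 k) (ltW tks)))//.
have : U (t_ k) - b <= Dh k.
  by case: (k) => [|l]; rewrite /Dh/= le_max ?lexx ?orbT// /t_ mul0r U0 lexx orbT.
have : c * (s - t_ k) <= c * h by rewrite ler_pM2l// lerBlDl -t_S.
lra.
Qed.

Let D_Dh0 : D 0 = Dh 0.
Proof.
apply/eqP; rewrite eq_le; apply/andP; split; last first.
  by have := Dh_le_D 0; rewrite /t_ mul0r.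
apply: D_le => // s s0 s0'; have -> : s = 0 by apply/eqP; rewrite eq_le s0 s0'.
by rewrite U0 /Dh/= le_max lexx orbT.
Qed.

Let X_incr s t : 0 <= s -> s <= t -> X t <= X s + c * (t - s).
Proof. by move=> s0 st; have := U_incr s0 st; have := D_nd st; rewrite /X; lra. Qed.

Let X_le_Xh k : X (t_ k) <= Xh k. Proof. by rewrite /X /Xh; have := Dh_le_D k; lra. Qed.

Let Xh_le_X k : Xh k <= X (t_ k) + c * h.
Proof. by rewrite /X /Xh; have := D_le_Dh k; lra. Qed.

Let Xh_S k : Xh k.+1 = Num.min (Xh k + c * h - J k) b.
Proof.
rewrite J_E /Xh {1}/Dh/=.
have -> : U (t_ k) - Dh k + c * h - (U (t_ k) - U (t_ k.+1) + c * h) =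
  U (t_ k.+1) - Dh k by ring.
rewrite -/(Dh k); case: leP => h1; case: leP => h2; lra.
Qed.

Let Dh_S k : Dh k.+1 - Dh k = Num.max 0 (Xh k + c * h - J k - b).
Proof.
rewrite J_E /Xh {1}/Dh/= -/(Dh k).
have -> : U (t_ k) - Dh k + c * h - (U (t_ k) - U (t_ k.+1) + c * h) - b =
  U (t_ k.+1) - b - Dh k by ring.
case: leP => h1; case: leP => h2; lra.
Qed.

Let Xh0 : Xh 0 = Num.min x b.
Proof. by rewrite /Xh /Dh /= /t_ mul0r U0; case: leP => h1; case: leP => h2; lra. Qed.

Let Y a := killed_chain M (fun i w => Z i w) (c * h) a b (Num.min x b).

Let alive_Y a k : (forall j, (j <= k)%N -> a <= Xh j) -> Y a k w = Xh k.
Proof.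
elim: k => [|k IH] aX; first by rewrite Xh0.
have E : Y a k w = Xh k by apply: IH => j jk; rewrite aX// leqW.
rewrite /Y /= -/(Y a k w) E ifF; first by rewrite Xh_S.
by apply/negbTE; rewrite -leNgt aX.
Qed.

Let Y_alive a k : a <= Y a k w -> forall j, (j <= k)%N -> a <= Xh j.
Proof.
elim: k => [|k IH] aY j.
  by rewrite leqn0 => /eqP ->; rewrite Xh0.
have aYk : a <= Y a k w.
  rewrite leNgt; apply/negP => Ya; move: aY; rewrite /Y/= -/(Y a k w) Ya.
  by rewrite leNgt Ya.
rewrite leq_eqVlt => /predU1P[->|]; last exact: IH.
have E : Y a k w = Xh k by apply: alive_Y; exact: IH.
by move: aY; rewrite /Y/= -/(Y a k w) ltNge aYk/= E Xh_S.
Qed.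

Let Y_nd a k : a <= Y a k.+1 w -> a <= Y a k w.
Proof.
move=> aY; rewrite leNgt; apply/negP => Ya; move: aY; rewrite /Y/= -/(Y a k w) Ya.
by rewrite leNgt Ya.
Qed.

Let tau := ruin_time N Z c x b w.

Let ruin_le t : 0 <= t -> X t < 0 -> (tau <= t%:E)%E.
Proof.
by move=> t0 Xt; apply: ereal_inf_lbound; exists t.
Qed.

Let dividend a := chain_dividend M (fun i w => Z i w) (c * h) a b (Num.min x b).

Let dividend_ge0 a k : 0 <= dividend a k w.
Proof. by rewrite /dividend /chain_dividend; case: ifP => // _; rewrite le_max lexx. Qed.

Let dividend_E a k : a <= Y a k w -> dividend a k w = Dh k.+1 - Dh k.
Proof.
move=> aY; rewrite /dividend /chain_dividend ltNge -/(Y a) aY/= Dh_S.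
by rewrite -(alive_Y (Y_alive aY)).
Qed.

Let e_ k := D (t_ k) - Dh k.

Let e_itv k : 0 <= e_ k <= c * h.
Proof. by rewrite /e_; have := Dh_le_D k; have := D_le_Dh k; lra. Qed.

Let e_0 : e_ 0 = 0. Proof. by rewrite /e_ /t_ mul0r D_Dh0 subrr. Qed.

Let I := (\int[lebesgue_stieltjes_measure (dividends N Z c x b w)]_(t in
  [set t : R | (0 <= t)%R /\ t%:E <= tau]) (expR (- delta * t))%:E)%E.

Let g := (fun t : R => (expR (- delta * t))%:E) \_ [set t : R | 0 <= t /\ (t%:E <= tau)%E].

Let I_E : I = (\int[lebesgue_stieltjes_measure (dividends N Z c x b w)]_t g t)%E.
Proof. by rewrite /I integral_mkcond. Qed.

Let g_ge0 t : (0 <= g t)%E.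
Proof. by rewrite /g patchE; case: ifP => // _; rewrite lee_fin expR_ge0. Qed.

Let exp_le s t : s <= t -> expR (- delta * t) <= expR (- delta * s).
Proof. by move=> st; rewrite ler_expR !mulNr lerN2 ler_pM2l. Qed.

Let DE k : dividends N Z c x b w (k.+1%:R * h) - dividends N Z c x b w (k%:R * h) =
  (e_ k.+1 - e_ k) + (Dh k.+1 - Dh k).
Proof. by rewrite /e_ /D /t_; move: (Dh k) (Dh k.+1) => u v; ring. Qed.

(** On a cell the discount is at most its value at the left end. The cell counts only if its left
    end precedes ruin, and then the chain with threshold [0] is alive, since it dominates the true
    surplus. The increments of [D] are those of the grid dividends plus those of the gap [e_], which
    cost [c h] by summation by parts. *)
Lemma path_payoff_le :
  (I <= (Num.max 0 (x - b) + c * h)%:E +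
    \sum_(k <oo) (expR (- delta * t_ k) * dividend 0 k w)%:E)%E.
Proof.
pose v k := if ((t_ k)%:E < tau)%E then expR (- delta * t_ k) else 0.
have v_ge0 k : 0 <= v k by rewrite /v; case: ifP => // _; exact: expR_ge0.
have v_nd k : v k.+1 <= v k.
  rewrite /v; case: ifPn => [tk|_]; last exact: v_ge0.
  rewrite (le_lt_trans _ tk) ?lee_fin ?t_le// exp_le// t_le//.
have v01 : v 0%N <= 1.
  by rewrite /v; case: ifP => // _; rewrite /t_ mul0r mulr0 expR0.
have alive k : ((t_ k)%:E < tau)%E -> 0 <= Y 0 k w.
  move=> tk; have XX j : (j <= k)%N -> 0 <= Xh j.
    move=> jk; apply: le_trans (X_le_Xh j); rewrite leNgt; apply/negP.
    move/(ruin_le (t_ge0 j)); apply/negP; rewrite -ltNge.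
    by rewrite (le_lt_trans _ tk)// lee_fin t_le.
  by rewrite (alive_Y XX) XX.
have lsm_le := @stieltjes_integral_le R (dividends N Z c x b w) h h_gt0 g 1 v.
rewrite I_E; apply: (le_trans (lsm_le _ _ _ _ _ _)) => //.
- by move=> t t0; rewrite /g patchE memNset//= => -[]; rewrite leNgt t0.
- by rewrite /g patchE; case: ifP => // _; rewrite mulr0 expR0.
- move=> k t; rewrite -!/(t_ _) => kt tk; rewrite /g patchE; case: ifPn => [|_];
  last by rewrite lee_fin.
  rewrite inE => -[t0 ttau]; rewrite /v (lt_le_trans _ ttau) ?lte_fin//.
  by rewrite lee_fin exp_le// ltW.
have D1 : dividends N Z c x b w (- 1) = 0 by apply: D_neg; rewrite oppr_lt0.
have D0 : dividends N Z c x b w 0 = Dh 0 := D_Dh0.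
rewrite /= mul1r D1 subr0 D0 /=.
rewrite EFinD -addeA leeD2l//.
apply: lime_le.
  apply: is_cvg_nneseries => k _ _; rewrite lee_fin mulr_ge0// subr_ge0.
  exact: (D_nd (t_le (leqnSn k))).
apply: nearW => K; rewrite big_mkord sumEFin.
have h1 : (\sum_(0 <= k < K) (expR (- delta * t_ k) * dividend 0 k w)%:E <=
    \sum_(k <oo) (expR (- delta * t_ k) * dividend 0 k w)%:E)%E.
  by apply: nneseries_lim_ge => k _ _; rewrite lee_fin mulr_ge0// expR_ge0.
apply: (le_trans _ (leeD2l _ h1)).
rewrite big_mkord sumEFin -EFinD lee_fin.
under eq_bigr do rewrite DE mulrDr.
rewrite big_split.
apply: lerD.
  rewrite (le_trans (abel_le K v_ge0 v_nd e_itv))// ler_piMr// mulr_ge0// ltW//.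
apply: ler_sum => k _; rewrite {1}/v; case: ifPn => [/alive aY|_].
  by rewrite dividend_E.
by rewrite mul0r mulr_ge0// expR_ge0.
Qed.

(** If the chain is at least [2 c h] at the end of a cell, the surplus within the cell is
    nonnegative: one [c h] covers the gap between true and grid dividends, the other the premium
    income up to the end of the cell. Discounts are taken at right ends. *)
Lemma path_payoff_ge a K : 2 * (c * h) <= a -> a <= b ->
  ((Num.max 0 (x - b) +
    \sum_(k < K) expR (- delta * t_ k.+1) * dividend a k w)%:E <= I)%E.
Proof.
move=> cha ab.
pose v k := if a <= Y a k.+1 w then expR (- delta * t_ k.+1) else 0.
have v_ge0 k : 0 <= v k by rewrite /v; case: ifP => // _; exact: expR_ge0.
have v_nd k : v k.+1 <= v k.
  rewrite /v; case: ifPn => [aY|_]; last exact: v_ge0.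
  by rewrite (Y_nd aY) exp_le// t_le.
have ch0 : 0 < c * h by rewrite mulr_gt0.
have alive k : a <= Y a k.+1 w -> ((t_ k.+1)%:E <= tau)%E.
  move=> aY; apply: le_ereal_inf_tmp => _ [s [s0 Xs] <-]; rewrite lee_fin leNgt.
  apply/negP => sk; move: Xs; apply/negP; rewrite -leNgt -/(U s) -/(D s) -/(X s).
  have [j jk sj] : exists2 j, (j <= k)%N & t_ j <= s <= t_ j.+1.
    elim: k {aY} sk => [|k IH] sk; first by exists 0 => //; rewrite /t_ mul0r s0 ltW.
    have [/IH[j jk jE]|ks] := ltP s (t_ k.+1); first by exists j => //; exact: leqW.
    by exists k.+1 => //; rewrite ks ltW.
  have := Y_alive aY (j := j.+1) jk => aX.
  have := Xh_le_X j.+1; case/andP: sj => js sj; have := X_incr s0 sj.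
  have : c * (t_ j.+1 - s) <= c * h.
    by rewrite ler_pM2l// lerBlDr t_S addrC lerD2l.
  move: aX cha ch0; lra.
have g_E t : 0 <= t -> (t%:E <= tau)%E -> g t = (expR (- delta * t))%:E.
  by move=> t0 tt; rewrite /g patchE mem_set.
have tau0 : (0%:E <= tau)%E by apply: le_ereal_inf_tmp => _ [s [s0 _] <-]; rewrite lee_fin.
have lsm_ge := @stieltjes_integral_ge R (dividends N Z c x b w) h h_gt0 g 1 v K.
rewrite I_E; apply: (le_trans _ (lsm_ge _ _ _ _ _ _)) => //; last first.
- move=> k t; rewrite -!/(t_ _) => kt tk; rewrite /v; case: ifPn => [aY|_];
  last exact: g_ge0.
  rewrite g_E ?lee_fin ?exp_le//; first by rewrite (le_trans (t_ge0 k))// ltW.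
  by rewrite (le_trans _ (alive _ aY))// lee_fin.
- by rewrite g_E// mulr0 expR0.
have D0 : dividends N Z c x b w 0 = Dh 0 := D_Dh0.
rewrite lee_fin /= mul1r D0 /= lerD2l.
under [leRHS]eq_bigr do rewrite DE mulrDr.
rewrite big_split.
rewrite -[leLHS]add0r; apply: lerD.
  (* The gap is [0] at time [0], so the summation by parts loses nothing. *)
  have := @abel_ge R v e_ K v_ge0 v_nd (fun k => proj1 (andP (e_itv k))).
  by rewrite e_0 mulr0 oppr0.
apply: ler_sum => k _; rewrite {1}/v; case: ifPn => aY.
  by rewrite dividend_E// Y_nd.
rewrite mul0r /dividend /chain_dividend -/(Y a k w).
case: ifPn => Ya; first by rewrite mulr0.
(* A step that leads from above [a] to below [a] pays no dividend, because [a <= b]; the weight [0]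
   is exact there. *)
move: aY; rewrite -ltNge {1}/Y/= -/(Y a k w) (negbTE Ya) gt_min => /orP[h1|].
  by rewrite -/(J k) max_l ?mulr0// subr_le0 (le_trans (ltW h1)).
by rewrite ltNge ab.
Qed.

End pathwise.

(** * One step of the grid *)

Section smooth_value_theory.
Context {R : realType}.
Variables (mu sigma2 delta b L : R) (F F1 F2 : R -> R).
Hypothesis sv : smooth_value mu sigma2 delta b L F F1 F2.

Lemma smooth_value_L_ge0 : 0 <= L.
Proof. by have := sv_F2_bnd sv 0; apply: le_trans. Qed.

Let L_ge0 := smooth_value_L_ge0.

Lemma smooth_value_incr y z : 0 <= y -> y <= z -> F y <= F z <= F y + L * (z - y).
Proof.
move=> y0 yz.
have [||u] := @MVT_segment R F F1 y z yz.
- by move=> u _; exact: (sv_deriv1 sv).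
- by apply/derivable_within_continuous => u _; have [] := sv_deriv1 sv u.
rewrite in_itv/= => /andP[yu uz] E.
have /andP[F10 F1L] := sv_F1_bnd sv (le_trans y0 yu).
have : 0 <= F1 u * (z - y) by rewrite mulr_ge0// subr_ge0.
have : F1 u * (z - y) <= L * (z - y) by rewrite ler_wpM2r// subr_ge0.
by move: E; lra.
Qed.

Lemma smooth_value_ge0 y : 0 <= y -> 0 <= F y.
Proof. by move=> y0; have /andP[] := smooth_value_incr (lexx 0) y0; rewrite (sv_0 sv). Qed.

Lemma smooth_value_le y a : 0 <= a -> y <= a -> F y <= F a.
Proof.
move=> a0 ya; have [y0|y0] := leP 0 y; first by have /andP[] := smooth_value_incr y0 ya.
have := sv_neg sv (u := - y); rewrite opprK oppr_ge0 => /(_ (ltW y0))/andP[h _].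
by apply: (@le_trans _ _ 0); [rewrite -oppr_ge0|exact: smooth_value_ge0].
Qed.

(** The slope is taken at the right end because the generator is applied after the premium income of
    the step. *)
Lemma smooth_value_step y s : 0 <= s ->
  `|F (y + s) - F y - F1 (y + s) * s| <= L * s ^+ 2.
Proof.
move=> s0.
pose g z := F z - F1 (y + s) * z.
have gd (z : R) : is_derive z 1 g (F1 z - F1 (y + s)).
  have := sv_deriv1 sv z => ?.
  by apply: is_derive_eq; rewrite /GRing.scale/=; ring.
have -> : F (y + s) - F y - F1 (y + s) * s = g (y + s) - g y by rewrite /g; ring.
have -> : L * s ^+ 2 = L * s * `|y + s - y|.
  have -> : y + s - y = s by ring.
  by rewrite ger0_norm//; ring.
apply: (mvt_bound gd) => z; rewrite max_l ?lerDl// min_r ?lerDl// => /andP[yz zs].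
apply: (@le_trans _ _ (L * `|z - (y + s)|)).
  apply: (mvt_bound (sv_deriv2 sv)) => u _; exact: (sv_F2_bnd sv).
by rewrite ler_wpM2l// ler0_norm ?subr_le0//; lra.
Qed.

Lemma measurable_smooth_value : measurable_fun setT F.
Proof.
apply: continuous_measurable_fun => u.
apply/differentiable_continuous/derivable1_diffP.
by have [] := sv_deriv1 sv u.
Qed.

Lemma smooth_value_left_taylor y z : 0 <= z ->
  `|F (y - z) - F y + F1 y * z - F2 y / 2 * z ^+ 2| <= L * z ^+ 3.
Proof. exact: (left_taylor2 (sv_deriv1 sv) (sv_deriv2 sv) (sv_lip sv)). Qed.

End smooth_value_theory.

(** * Poisson probabilities of a short step *)

Section poisson_weights.
Context {R : realType} (r : R).
Hypothesis r_gt0 : 0 < r.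

Lemma poisson_pmf0E : poisson_pmf r 0 = expR (- r).
Proof. by rewrite /poisson_pmf r_gt0 expr0 fact0 invr1 !mul1r. Qed.

Lemma poisson_pmf1E : poisson_pmf r 1 = r * expR (- r).
Proof. by rewrite /poisson_pmf r_gt0 expr1 invr1 mulr1. Qed.

End poisson_weights.


(** All bounds come from [1 - r <= exp (- r) <= 1] and [(1 + r) exp (- r) <= 1]; the last one is the
    sign of the probability of two or more claims. *)
Lemma poisson_pmf01_bounds {R : realType} (r : R) : 0 < r ->
  [/\ 1 - r <= poisson_pmf r 0, r - r ^+ 2 <= poisson_pmf r 1 <= r &
      0 <= 1 - poisson_pmf r 0 - poisson_pmf r 1 <= r ^+ 2].
Proof.
move=> r0; rewrite poisson_pmf0E// poisson_pmf1E//.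
have e1 := expR_ge1Dx (- r).
have e2 : expR (- r) <= 1 by rewrite -expR0 ler_expR oppr_le0 ltW.
have e3 : (1 + r) * expR (- r) <= 1.
  by rewrite -[leRHS](@expRxMexpNx_1 _ r) ler_wpM2r ?expR_ge0// expR_ge1Dx.
have e4 : r * (1 - r) <= r * expR (- r) by rewrite ler_pM2l.
have e5 : r * expR (- r) <= r * 1 by rewrite ler_pM2l.
by split; [lra|apply/andP; split; lra|apply/andP; split; lra].
Qed.

(* In the next two lemmas [A] is the value after the premium income of a step
   during which the number of claims is 0, 1 or larger with probabilities
   [p0], [p1], [1 - p0 - p1], and [E] is the expectation after one claim. *)
Lemma poisson_step_ub {R : realType} (p0 p1 r A g q E M G : R) :
  0 <= p1 -> r - r ^+ 2 <= p1 <= r -> 0 <= 1 - p0 - p1 <= r ^+ 2 ->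
  0 <= A -> 0 <= M -> 0 <= q -> `|g| <= G -> E <= A + g + q ->
  p0 * A + p1 * E + (1 - p0 - p1) * M <= A + r * g + r * q + r ^+ 2 * (M + G).
Proof.
move=> p1_ge0 /andP[p1r p1r'] /andP[p01 p01'] A0 M0 q0;
  rewrite ler_norml => /andP[Gg gG] EA.
have h1 : p1 * E <= p1 * (A + g + q) by rewrite ler_wpM2l.
have h2 : p1 * q <= r * q by rewrite ler_wpM2r.
have h3 : (1 - p0 - p1) * M <= r ^+ 2 * M by rewrite ler_wpM2r.
have h4 : 0 <= (1 - p0 - p1) * A by rewrite mulr_ge0.
have G0 : 0 <= G by lra.
have h5 : 0 <= (r - p1) * (G + g) by rewrite mulr_ge0//; lra.
have h6 : (r - p1) * G <= r ^+ 2 * G by rewrite ler_wpM2r//; lra.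
by move: h1 h2 h3 h4 h5 h6; lra.
Qed.

Lemma poisson_step_lb {R : realType} (p0 p1 r A g q E M f : R) :
  0 <= r -> 1 - r <= p0 -> r - r ^+ 2 <= p1 ->
  0 <= A -> 0 <= E -> E <= M -> A + g - q - f <= E ->
  A + r * g - r * q - r * f - r ^+ 2 * M <= p0 * A + p1 * E.
Proof.
move=> r0 p0r p1r A0 E0 EM AE.
have h1 : (1 - r) * A <= p0 * A by rewrite ler_wpM2r.
have h2 : (r - r ^+ 2) * E <= p1 * E by rewrite ler_wpM2r.
have h3 : r ^+ 2 * E <= r ^+ 2 * M by rewrite ler_wpM2l// sqr_ge0.
have h4 : r * (A + g - q - f) <= r * E by rewrite ler_wpM2l.
by move: h1 h2 h3 h4; lra.
Qed.

(** [exp u] is at most [1 / (1 - u)], and [(1 - u) (1 + u + 2 u ^+ 2)] equals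
    [1 + u ^+ 2 (1 - 2 u)]. *)
Lemma expR_le_quadratic {R : realType} (u : R) : 0 <= u -> u <= 2^-1 ->
  expR u <= 1 + u + 2 * u ^+ 2.
Proof.
move=> u0 u1.
have h : expR u * (1 - u) <= 1.
  rewrite -[leRHS](@expRxMexpNx_1 _ u) ler_wpM2l ?expR_ge0//; exact: expR_ge1Dx.
have u2 := sqr_ge0 u.
rewrite -(@ler_pM2r _ (1 - u)); last by lra.
apply: (le_trans h).
have : 0 <= u ^+ 2 * (1 - 2 * u) by rewrite mulr_ge0//; lra.
lra.
Qed.

(** * The generator in one grid step *)

Section one_step.
Context {R : realType}.
Variables (lambda theta delta n m1 m2 m3 b L : R) (F F1 F2 : R -> R).
Let mu := theta * lambda * m1.
Let sigma2 := lambda * m2.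
Let sn := Num.sqrt n.
Let c := (sn + theta) * lambda * m1.
Hypotheses (lambda_gt0 : 0 < lambda) (theta_gt0 : 0 < theta) (delta_gt0 : 0 < delta)
  (n_gt0 : 0 < n) (m1_gt0 : 0 < m1) (m2_ge0 : 0 <= m2) (m3_ge0 : 0 <= m3).
Hypothesis sv : smooth_value mu sigma2 delta b L F F1 F2.

Let sn_gt0 : 0 < sn. Proof. by rewrite sqrtr_gt0. Qed.
Let sn2 : sn ^+ 2 = n. Proof. by rewrite sqr_sqrtr// ltW. Qed.
Let c_gt0 : 0 < c. Proof. by rewrite !mulr_gt0// addr_gt0. Qed.
Let L_ge0 := smooth_value_L_ge0 sv.

(** [g] is the mean change of [F] by one claim to second order, [q] bounds the Taylor remainder, and
    [G] bounds the modulus of [g] at nonnegative arguments. *)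
Let g y := - (F1 y * (m1 / sn)) + F2 y / 2 * (m2 / n).
Let q := L * (m3 / (n * sn)).
Let G := L * (m1 / sn + m2 / n).

Let q_ge0 : 0 <= q.
Proof. by rewrite mulr_ge0// divr_ge0// mulr_ge0// ltW. Qed.

Let g_bnd y : 0 <= y -> `|g y| <= G.
Proof.
move=> y0; have /andP[F10 F1L] := sv_F1_bnd sv y0; have F2L := sv_F2_bnd sv y.
rewrite (le_trans (ler_normD _ _))// normrN /G mulrDr.
have a1 : 0 <= m1 / sn by rewrite divr_ge0// ltW.
have a2 : 0 <= m2 / n by rewrite divr_ge0// ltW.
apply: lerD; first by rewrite (ger0_norm (mulr_ge0 F10 a1)) ler_wpM2r.
rewrite normrM (ger0_norm a2) ler_wpM2r// normrM (@ger0_norm _ 2^-1) ?invr_ge0//.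
by rewrite (le_trans _ F2L)// ler_piMr// invf_le1//; lra.
Qed.

(** The cancellation: rate times mean claim, [n lambda m1 / sn], equals [c - mu], and rate times
    second moment, [n lambda m2 / n], equals [sigma2]. *)
Let rg h y : n * lambda * h * g y = h * (mu * F1 y + sigma2 / 2 * F2 y) - c * h * F1 y.
Proof.
have sn0 := lt0r_neq0 sn_gt0.
by rewrite /g /c /mu /sigma2 -sn2; field.
Qed.

(** The source of the order [1 / sqrt n]: third moments [m3 / (n sn)] at rate [n lambda]. *)
Let rq h : n * lambda * h * q = h * (lambda * L * m3 / sn).
Proof.
have sn0 := lt0r_neq0 sn_gt0.
by rewrite /q -sn2; field.
Qed.

Variables (h y : R).
Hypotheses (h_gt0 : 0 < h) (y_itv : 0 <= y <= b).
Let y' := y + c * h.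
Let r := n * lambda * h.
Let p0 := poisson_pmf r 0.
Let p1 := poisson_pmf r 1.

Let y_ge0 : 0 <= y. Proof. by case/andP: y_itv. Qed.
Let ch_gt0 : 0 < c * h. Proof. by rewrite mulr_gt0. Qed.
Let y'_ge0 : 0 <= y'. Proof. by rewrite addr_ge0// ltW. Qed.
Let r_gt0 : 0 < r. Proof. by rewrite !mulr_gt0. Qed.

Let step : `|F y' - F y - c * h * F1 y'| <= L * (c * h) ^+ 2.
Proof. by rewrite (mulrC (c * h)); exact: (smooth_value_step sv y (ltW ch_gt0)). Qed.

Let y'E : y' - y = c * h. Proof. by rewrite /y'; ring. Qed.

Let F_incr : F y <= F y' <= F y + L * (c * h).
Proof.
have := @smooth_value_incr _ _ _ _ _ _ _ _ _ sv y y' y_ge0.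
by rewrite y'E lerDl; apply; exact: ltW.
Qed.

(** The terms [c h F1 y'] from premium and claims cancel, and [sv_gen_le] leaves the discount
    factor; the rest is [q] or of order [h ^+ 2]. The bonus [k] is carried along since
    [k <= expR (delta * h) * k]. *)
Lemma one_step_ub (k M E : R) : 0 <= k -> F y' + k <= M ->
  E <= F y' + k + g y' + q ->
  p0 * (F y' + k) + p1 * E + (1 - p0 - p1) * M <=
  expR (delta * h) * (F y + k) + h * (lambda * L * m3 / sn) +
  h ^+ 2 * (L * c ^+ 2 + delta * L * c + (n * lambda) ^+ 2 * (M + G)).
Proof.
move=> k0 FM EF.
have Fy'0 := smooth_value_ge0 sv y'_ge0; have Fy0 := smooth_value_ge0 sv y_ge0.
have [h1 h2 h3] := poisson_pmf01_bounds r_gt0.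
have := @poisson_step_ub _ p0 p1 r (F y' + k) (g y') q E M G (poisson_pmf_ge0 _ _) h2 h3.
rewrite addr_ge0// (le_trans _ FM) ?addr_ge0// q_ge0 g_bnd// => /(_ isT isT isT isT EF).
rewrite rg rq => ub; apply: (le_trans ub).
have gen : h * (mu * F1 y' + sigma2 / 2 * F2 y') <= h * (delta * F y').
  by rewrite ler_pM2l// (sv_gen_le sv).
have := step; rewrite ler_norml => /andP[_ st].
have /andP[_ inc] := F_incr.
have inc' : h * delta * F y' <= h * delta * (F y + L * (c * h)).
  by rewrite ler_pM2l// mulr_gt0.
have disc : (1 + delta * h) * (F y + k) <= expR (delta * h) * (F y + k).
  by rewrite ler_wpM2r ?addr_ge0// expR_ge1Dx.
have dhk : 0 <= delta * h * k by rewrite !mulr_ge0// ltW.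
have rE : r ^+ 2 * (M + G) = h ^+ 2 * ((n * lambda) ^+ 2 * (M + G)) by rewrite /r; ring.
rewrite rE; move: gen st inc' disc dhk; lra.
Qed.

(** The value after two or more claims is dropped. Killing below [a] costs at most [F a], which is
    of order [c h], and this only with the probability of a claim, so that the loss is of order
    [h ^+ 2]. *)
Lemma one_step_lb (a M E : R) : a <= 2 * (c * h) -> 0 <= a -> delta * h <= 2^-1 ->
  0 <= E -> E <= M -> F y <= M -> F y' + g y' - q - F a <= E ->
  expR (delta * h) * F y - h * (lambda * L * m3 / sn) -
  h ^+ 2 * (L * c ^+ 2 + delta * c + 2 * (n * lambda) * L * c +
    (n * lambda) ^+ 2 * M + 2 * delta ^+ 2 * M) <= p0 * F y' + p1 * E.
Proof.
move=> ach a0 dh1 E0 EM FM EF.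
have Fy'0 := smooth_value_ge0 sv y'_ge0; have Fy0 := smooth_value_ge0 sv y_ge0.
have [h1 /andP[h2 _] _] := poisson_pmf01_bounds r_gt0.
have lb := poisson_step_lb (ltW r_gt0) h1 h2 Fy'0 E0 EM EF.
apply: le_trans lb; rewrite rg rq.
have yb : y' <= b + c * h by rewrite lerD2r; case/andP: y_itv.
have gen : h * (delta * F y' - delta * (c * h)) <= h * (mu * F1 y' + sigma2 / 2 * F2 y').
  rewrite ler_pM2l//; exact: (sv_gen_ge sv y'_ge0 (ltW ch_gt0) yb).
have := step; rewrite ler_norml => /andP[st _].
have /andP[inc _] := F_incr.
have inc' : h * delta * F y <= h * delta * F y' by rewrite ler_pM2l// mulr_gt0.
have Fa : F a <= L * (2 * (c * h)).
  have /andP[_] := smooth_value_incr sv (lexx 0) a0; rewrite (sv_0 sv) add0r subr0 => h4.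
  by rewrite (le_trans h4)// ler_wpM2l.
have rFa : r * F a <= r * (L * (2 * (c * h))) by rewrite ler_pM2l.
have disc : expR (delta * h) * F y <= (1 + delta * h + 2 * (delta * h) ^+ 2) * F y.
  by rewrite ler_wpM2r// expR_le_quadratic// mulr_ge0// ltW.
have FM2 : 2 * (delta * h) ^+ 2 * F y <= 2 * (delta * h) ^+ 2 * M
  by rewrite ler_wpM2l// mulr_ge0// sqr_ge0.
have rE : r ^+ 2 * M = h ^+ 2 * ((n * lambda) ^+ 2 * M) by rewrite /r; ring.
have rE2 : r * (L * (2 * (c * h))) = h ^+ 2 * (2 * (n * lambda) * L * c) by rewrite /r;
  ring.
rewrite rE; rewrite rE2 in rFa; move: gen st inc' disc FM2 rFa; lra.
Qed.

End one_step.

(** * Expectations as real numbers *)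

Section expectation_of_integrable.
Context {R : realType} d (T : measurableType d) (P : probability T R).
Implicit Types (f g : T -> R).

Definition has_mean f := P.-integrable setT (EFin \o f).

Lemma has_mean_cst k : has_mean (fun=> k).
Proof. exact: finite_measure_integrable_cst. Qed.

Lemma has_meanD f g : has_mean f -> has_mean g -> has_mean (fun w => f w + g w).
Proof. by move=> mf mg; have := integrableD measurableT mf mg; apply: eq_integrable. Qed.

Lemma has_meanZ k f : has_mean f -> has_mean (fun w => k * f w).
Proof. by move=> mf; have := integrableZl measurableT k mf; apply: eq_integrable. Qed.

Lemma has_mean_dom f g : measurable_fun setT f -> (forall w, `|f w| <= g w) ->
  has_mean g -> has_mean f.
Proof.
move=> mf fg; apply: le_integrable => //; first exact/measurable_EFinP.
by move=> w _ /=; rewrite lee_fin (le_trans (fg w))// ler_norm.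
Qed.

Lemma mean_EFin f : has_mean f -> (\int[P]_w (f w)%:E = (\int[P]_w f w)%R%:E)%E.
Proof. by move=> mf; rewrite /Rintegral fineK// integrable_fin_num. Qed.

Lemma meanD f g : has_mean f -> has_mean g ->
  \int[P]_w (f w + g w) = \int[P]_w f w + \int[P]_w g w.
Proof. exact: RintegralD. Qed.

Lemma meanZ k f : has_mean f -> \int[P]_w (k * f w) = k * \int[P]_w f w.
Proof. exact: RintegralZl. Qed.

Lemma mean_cst k : \int[P]_w k = k.
Proof. by rewrite Rintegral_cst//= probability_setT mulr1. Qed.

Lemma le_mean f g : has_mean f -> has_mean g -> (forall w, f w <= g w) ->
  \int[P]_w f w <= \int[P]_w g w.
Proof. by move=> mf mg fg; apply: le_Rintegral => // w _; exact: fg. Qed.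

Lemma mean_gt0 f : has_mean f -> (forall w, 0 <= f w) ->
  {ae P, forall w, 0 < f w} -> 0 < \int[P]_w f w.
Proof.
move=> mf f0 f_gt0; have [//|E_le0] := ltP 0 (\int[P]_w f w).
have E0 : (\int[P]_w `|(f w)%:E| = 0)%E.
  under eq_integral do rewrite gee0_abs ?lee_fin//.
  rewrite mean_EFin//; congr EFin; apply/eqP; rewrite eq_le E_le0/=.
  exact: Rintegral_ge0.
have /(ae_eq_integral_abs _ measurableT (measurable_int _ mf)) f_eq0 := E0.
have [N [mN N0 subN]] : {ae P, forall w : T, False}.
  move: f_gt0 f_eq0; apply: filterS2 => w fw /(_ I) /= -[fw0].
  by rewrite fw0 ltxx in fw.
have NT : N = setT by apply/seteqP; split => // w _; apply: subN => /=.
have := @probability_setT _ _ _ P.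
by move: N0; rewrite NT => -> /eqP; rewrite eqe eq_sym oner_eq0.
Qed.

End expectation_of_integrable.

(** With [m = k.+1], the inequality [t <= exp t] at [t = e u / m] is raised to the power [m]. *)
Lemma expr_le_expR {R : realType} (e u : R) (k : nat) : 0 < e -> 0 <= u ->
  u ^+ k.+1 <= (k.+1%:R / e) ^+ k.+1 * expR (e * u).
Proof.
move=> e0 u0.
have m0 : (0 : R) < k.+1%:R by rewrite ltr0n.
have E (m : R) : 0 < m -> e * u = m * (e * u / m) /\ u = m / e * (e * u / m).
  by move=> m_gt0; split; field; rewrite ?gt_eqF.
have [E1 E2] := E _ m0.
rewrite E1 expRM_natl -exprMn; apply: lerXn2r; rewrite ?nnegrE//.
  by rewrite mulr_ge0 ?expR_ge0// divr_ge0// ltW.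
rewrite {1}E2 ler_wpM2l//; first by rewrite divr_ge0// ltW.
by apply: le_trans (expR_ge1Dx _); rewrite lerDr.
Qed.

(** * Moments and excess of a claim *)

Section claim_size.
Context {R : realType} d (T : measurableType d) (P : probability T R) (Y : {RV P >-> R}).
Hypothesis Y_gt0 : {ae P, forall w, 0 < Y w}.
Hypothesis Y_exp_moment :
  exists2 eps : R, 0 < eps & ('E_P[fun w => expR (eps * Y w)] < +oo)%E.
Hypothesis Y_exp_excess :
  exists2 eps : R, 0 < eps &
    (ereal_sup
      [set cond_expectation P [set w | (d < Y w)%R]
             (fun w => expR (eps * (Y w - d))%R)
      | d in [set d : R | (0 <= d)%R /\ 0 < P [set w | (d < Y w)%R]]]
     < +oo)%E.

(** [Y] is positive only almost surely; [W] has the same moments and makes pointwise bounds hold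
    everywhere. *)
Let W w := Num.max (Y w) 0.

Let mY : measurable_fun setT (Y : T -> R). Proof. exact: measurable_funPT. Qed.
Let mW : measurable_fun setT W. Proof. exact: measurable_maxr. Qed.
Let W_ge0 w : 0 <= W w. Proof. by rewrite /W le_max lexx orbT. Qed.

Let mean_exp eps : ('E_P[fun w => expR (eps * Y w)] < +oo)%E ->
  has_mean P (fun w => expR (eps * Y w)).
Proof.
rewrite unlock => Eoo; apply/integrableP; split.
  apply/measurable_EFinP; apply: (measurableT_comp (@measurable_expR R)).
  exact: measurable_funM.
by under eq_integral do rewrite /= ger0_norm ?expR_ge0//.
Qed.

Lemma claim_power_mean k : has_mean P (fun w => W w ^+ k.+1).
Proof.
have [e e0 /mean_exp me] := Y_exp_moment.
apply: has_mean_dom (has_meanZ ((k.+1%:R / e) ^+ k.+1) me).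
  exact: measurable_funX.
move=> w; rewrite ger0_norm ?exprn_ge0// /W; have [Yw|Yw] := leP (Y w) 0.
  by rewrite expr0n/= mulr_ge0 ?expR_ge0// exprn_ge0// divr_ge0// ltW.
by rewrite expr_le_expR// ltW.
Qed.

Lemma moment_claim k : moment Y k = \int[P]_w (W w ^+ k).
Proof.
rewrite /moment unlock /Rintegral; congr fine; apply: ae_eq_integral => //.
- by apply/measurable_EFinP; exact: measurable_funX.
- by apply/measurable_EFinP; exact: measurable_funX.
- move: Y_gt0; apply: filterS => w Yw _; rewrite /W max_l// ltW//.
Qed.

Lemma moment_gt0 k : 0 < moment Y k.+1.
Proof.
rewrite moment_claim; apply: mean_gt0; first exact: claim_power_mean.
  by move=> w; rewrite exprn_ge0.
move: Y_gt0; apply: filterS => w Yw.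
by rewrite exprn_gt0// /W lt_max Yw.
Qed.

(* The bound is uniform in the retention level [s]; it controls the deficit at ruin. *)
Lemma claim_excess (L : R) : 0 <= L ->
  exists2 K : R, 0 < K & forall s, 0 <= s ->
    has_mean P (fun w => if s < W w then L * ((W w - s) + (W w - s) ^+ 2) - K else 0) /\
    \int[P]_w (if s < W w then L * ((W w - s) + (W w - s) ^+ 2) - K else 0) <= 0.
Proof.
move=> L0; have [e e0 sup_oo] := Y_exp_excess.
set S := ereal_sup _ in sup_oo.
pose A (s : R) := [set w | s < Y w].
have mA s : measurable (A s).
  rewrite /A (_ : [set w | s < Y w] = Y @^-1` `]s, +oo[%classic).
    by rewrite -[X in measurable X]setTI; exact: mY.
  by apply/seteqP; split => w /=; rewrite in_itv/= andbT.
pose f s w := expR (e * (Y w - s)) * \1_(A s) w.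
have f_ge0 s w : 0 <= f s w by rewrite mulr_ge0 ?expR_ge0.
have mf s : measurable_fun setT (f s).
  apply: measurable_funM; last exact: measurable_indic.
  apply: (measurableT_comp (@measurable_expR R)).
  by apply: measurable_funM => //; exact: measurable_funB.
(* The maximum with [0] keeps the bound finite also for a supremum over no [d] at all. *)
pose M := fine (Order.max S 0%E).
have M0 : 0 <= M by rewrite fine_ge0// le_max lexx orbT.
have ME : (S <= M%:E)%E.
  rewrite /M fineK; first by rewrite le_max lexx.
  by rewrite ge0_fin_numE ?le_max ?lexx ?orbT// gt_max sup_oo ltry.
have f_exc s : 0 <= s -> (\int[P]_w (f s w)%:E <= M%:E * P (A s))%E.
  move=> s0.
  have -> : (\int[P]_w (f s w)%:E = \int[P]_(w in A s) (expR (e * (Y w - s)))%:E)%E.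
    rewrite [RHS]integral_mkcond; apply: eq_integral => w _.
    rewrite /f patchE indicE; case: (w \in A s); by rewrite ?mulr1 ?mulr0.
  (* Levels [s] of probability [0] are outside the supremum, but there the integral vanishes. *)
  have [PA0|PA_gt0] := eqVneq (P (A s)) 0%E.
    rewrite PA0 mule0 null_set_integral//.
    apply/measurable_EFinP; apply: measurable_funTS.
    apply: (measurableT_comp (@measurable_expR R)).
    by apply: measurable_funM => //; exact: measurable_funB.
  have PAE : P (A s) = (fine (P (A s)))%:E by rewrite fineK// fin_num_measure.
  have PAp : 0 < fine (P (A s)).
    by rewrite -lte_fin -PAE lt0e PA_gt0 measure_ge0.
  rewrite PAE -lee_pdivrMr//; apply: le_trans ME.
  apply: ereal_sup_ubound; exists s; first by split => //; rewrite lt0e PA_gt0 measure_ge0.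
  by rewrite /cond_expectation -/(A s) PAE inver gt_eqF.
have mean_f s : 0 <= s -> has_mean P (f s).
  move=> s0; apply/integrableP; split; first exact/measurable_EFinP.
  under eq_integral do rewrite /= ger0_norm//.
  rewrite (le_lt_trans (f_exc _ s0))// lte_mul_pinfty// ?lee_fin//.
  by rewrite (le_lt_trans (probability_le1 P (mA s)))// ltry.
(* [C] turns linear and quadratic excess into exponential excess. The mean of [H] below is then at
   most [(C * M - K) * P (A s)], so [K] is chosen above [C * M]. *)
pose C := L * (1%:R / e + (2%:R / e) ^+ 2).
have C0 : 0 <= C by rewrite mulr_ge0// addr_ge0 ?sqr_ge0// divr_ge0// ltW.
pose K := C * M + 1.
have K0 : 0 < K by rewrite ltr_wpDl// mulr_ge0.
exists K => // s s0.
have WA w : (s < W w) = (w \in A s).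
  apply/idP/idP; rewrite inE /A /W /= lt_max.
    by case/orP => //; rewrite ltNge s0.
  by move=> ->.
set B := fun w => _.
have mB : measurable_fun setT B.
  apply: measurable_fun_ifT => //; first exact: measurable_fun_ltr.
  apply: measurable_funB => //; apply: measurable_funM => //.
  by apply: measurable_funD; [|apply: measurable_funX]; exact: measurable_funB.
have mean_1 : has_mean P \1_(A s).
  apply: has_mean_dom (has_mean_cst P 1) => [|w]; first exact: measurable_indic.
  by rewrite indicE; case: (_ \in _); rewrite ?normr1 ?normr0.
pose H w := C * f s w + (- K) * \1_(A s) w.
have mean_H : has_mean P H by apply: has_meanD; apply: has_meanZ => //; exact: mean_f.
have BH w : B w <= H w.
  rewrite /B /H /f WA indicE; case: (boolP (w \in A s)) => wA; last by rewrite !mulr0 addr0.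
  rewrite !mulr1 lerD2r /C -mulrA ler_wpM2l//.
  have -> : W w = Y w.
    by move: wA; rewrite inE /A /= /W => sY; rewrite max_l// (le_trans s0)// ltW.
  have u0 : 0 <= Y w - s by move: wA; rewrite inE /A /= => sY; rewrite subr_ge0 ltW.
  rewrite mulrDl; apply: lerD; last exact: expr_le_expR.
  by have := expr_le_expR 0 e0 u0; rewrite !expr1.
have mean_B : has_mean P B.
  have mHK : has_mean P (fun w => C * f s w + K * \1_(A s) w).
    by apply: has_meanD; apply: has_meanZ => //; exact: mean_f.
  apply: has_mean_dom mHK => // w.
  have := BH w; rewrite /H ler_norml => BHw; apply/andP; split; last first.
    apply: (le_trans BHw); rewrite lerD2l ler_wpM2r//; lra.
  rewrite /B WA indicE; case: (boolP (w \in A s)) => wA; last first.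
    by rewrite oppr_le0 mulr0 addr0 mulr_ge0.
  rewrite !mulr1.
  have : 0 <= L * (W w - s + (W w - s) ^+ 2).
    by rewrite mulr_ge0// addr_ge0 ?sqr_ge0// subr_ge0 ltW// WA.
  have : 0 <= C * f s w by rewrite mulr_ge0.
  lra.
split => //; apply: (le_trans (le_mean mean_B mean_H BH)).
rewrite meanD; [|apply: has_meanZ; exact: mean_f|exact: has_meanZ].
rewrite !meanZ//; last exact: mean_f.
have e1 : \int[P]_w \1_(A s) w = fine (P (A s)).
  by rewrite /Rintegral integral_indic// setIT.
have e2 : \int[P]_w f s w <= M * fine (P (A s)).
  have := f_exc _ s0; rewrite mean_EFin; last exact: mean_f.
  by rewrite -(fineK (fin_num_measure P _ (mA s))) -EFinM lee_fin.
rewrite e1; have PA0 : 0 <= fine (P (A s)) by rewrite fine_ge0.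
have e3 : C * (\int[P]_w f s w) <= C * (M * fine (P (A s))) by rewrite ler_wpM2l.
by move: e3; rewrite /K; lra.
Qed.

End claim_size.

(* The threshold [a] is [0] in the upper bound; in the lower bound it is [2 c h], which
   guarantees that the surplus is nonnegative between the grid times too. *)
Definition killed_value {R : realType} (F : R -> R) (k a v : R) : R :=
  if a <= v then F v + k else 0.

(** * Expected value after a single claim *)

Section one_claim.
Context {R : realType} d (T : measurableType d) (P : probability T R) (Y : {RV P >-> R}).
Variables (mu sigma2 delta b L : R) (F F1 F2 : R -> R) (n : R).
Hypothesis sv : smooth_value mu sigma2 delta b L F F1 F2.
Hypothesis n_ge1 : 1 <= n.
Let W w := Num.max (Y w) 0.
Hypothesis W_mean : forall k, has_mean P (fun w => W w ^+ k.+1).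
Let m k := \int[P]_w (W w ^+ k).
Let sn := Num.sqrt n.

Let n_gt0 : 0 < n. Proof. exact: lt_le_trans n_ge1. Qed.
Let sn_ge1 : 1 <= sn. Proof. by rewrite -[leLHS]sqrtr1 ler_wsqrtr. Qed.
Let sn_gt0 : 0 < sn. Proof. exact: lt_le_trans sn_ge1. Qed.
Let sn2 : sn ^+ 2 = n. Proof. by rewrite sqr_sqrtr// ltW. Qed.
Let mW : measurable_fun setT W. Proof. by apply: measurable_maxr => //;
  exact: measurable_funPT. Qed.
Let W_ge0 w : 0 <= W w. Proof. by rewrite /W le_max lexx orbT. Qed.
Let L_ge0 := smooth_value_L_ge0 sv.
Let V_ge0 w : 0 <= W w / sn. Proof. by rewrite divr_ge0// ltW. Qed.

Lemma measurable_killed_value (k a : R) : measurable_fun setT (killed_value F k a).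
Proof.
apply: measurable_fun_ifT => //; first exact: measurable_fun_ler.
by apply: measurable_funD => //; exact: (measurable_smooth_value sv).
Qed.

Lemma killed_value_itv (k a v : R) (y : R) : 0 <= k -> 0 <= a -> 0 <= y -> v <= y ->
  0 <= killed_value F k a v <= F y + k.
Proof.
move=> k0 a0 y0 vy; rewrite /killed_value; case: ifPn => av.
  rewrite addr_ge0 ?(smooth_value_ge0 sv (le_trans a0 av))//= lerD2r.
  exact: (smooth_value_le sv).
by rewrite lexx addr_ge0// (smooth_value_ge0 sv).
Qed.

Lemma killed_value_mean k a y : 0 <= k -> 0 <= a -> 0 <= y ->
  has_mean P (fun w => killed_value F k a (y - W w / sn)).
Proof.
move=> k0 a0 y0; apply: has_mean_dom (has_mean_cst P (F y + k)) => [|w].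
  apply: (measurableT_comp (measurable_killed_value k a)).
  by apply: measurable_funB => //; exact: measurable_funM.
have /andP[h1 h2] : 0 <= killed_value F k a (y - W w / sn) <= F y + k.
  by apply: killed_value_itv => //; rewrite gerBl.
by rewrite ger0_norm.
Qed.

Let taylor y w := F y + - (F1 y / sn) * W w ^+ 1 + F2 y / 2 / n * W w ^+ 2.
Let rem w := L / (n * sn) * W w ^+ 3.

Let taylor_bnd y w : `|F (y - W w / sn) - taylor y w| <= rem w.
Proof.
have := smooth_value_left_taylor sv y (V_ge0 w); congr (`|_| <= _).
  by rewrite /taylor -sn2; field; exact: lt0r_neq0.
by rewrite /rem -sn2; field; exact: lt0r_neq0.
Qed.

Let taylor_mean y : has_mean P (taylor y).
Proof.
apply: has_meanD; last by apply: has_meanZ; exact: W_mean.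
by apply: has_meanD; [exact: has_mean_cst|apply: has_meanZ; exact: W_mean].
Qed.

Let rem_mean : has_mean P rem. Proof. by apply: has_meanZ; exact: W_mean. Qed.

Let mean_taylor y : \int[P]_w taylor y w =
  F y + - (F1 y * (m 1 / sn)) + F2 y / 2 * (m 2 / n).
Proof.
rewrite /taylor meanD; last by apply: has_meanZ; exact: W_mean.
  rewrite meanD; [|exact: has_mean_cst|by apply: has_meanZ; exact: W_mean].
  by rewrite mean_cst !meanZ; [rewrite /m; ring|exact: W_mean|exact: W_mean].
by apply: has_meanD; [exact: has_mean_cst|apply: has_meanZ; exact: W_mean].
Qed.

Let mean_rem : \int[P]_w rem w = L * (m 3 / (n * sn)).
Proof. by rewrite /rem meanZ; [rewrite /m; ring|exact: W_mean]. Qed.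

(** The claim ruins when [W > sn y], so the excess bound is used at [s = sn y]. At ruin the killed
    value is [0], whereas [F] may be as low as [- L (u + u ^+ 2)]; the correction [B / sn] makes up
    for this and withdraws the bonus [K / sn], and its mean is nonpositive. *)
Lemma one_claim_ub (K y : R) : 0 <= K -> 0 <= y ->
  (forall s, 0 <= s ->
    has_mean P (fun w => if s < W w then L * ((W w - s) + (W w - s) ^+ 2) - K else 0) /\
    \int[P]_w (if s < W w then L * ((W w - s) + (W w - s) ^+ 2) - K else 0) <= 0) ->
  \int[P]_w killed_value F (K / sn) 0 (y - W w / sn) <=
  F y + K / sn + (- (F1 y * (m 1 / sn)) + F2 y / 2 * (m 2 / n)) + L * (m 3 / (n * sn)).
Proof.
move=> K0 y0 /(_ (sn * y)); rewrite mulr_ge0 ?(ltW sn_gt0)// => /(_ isT)[].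
set B := fun w => _ => mB B0.
have k0 : 0 <= K / sn by rewrite divr_ge0// ltW.
pose H w := taylor y w + (K / sn + (rem w + sn^-1 * B w)).
have mRB : has_mean P (fun w => rem w + sn^-1 * B w) by apply: has_meanD => //;
  exact: has_meanZ.
have mKRB : has_mean P (fun w => K / sn + (rem w + sn^-1 * B w)).
  by apply: has_meanD => //; exact: has_mean_cst.
have mH : has_mean P H by apply: has_meanD.
have GH w : killed_value F (K / sn) 0 (y - W w / sn) <= H w.
  have := taylor_bnd y w; rewrite ler_norml => /andP[_ tb].
  rewrite /killed_value /H /B subr_ge0 ler_pdivrMr// (mulrC y).
  have [Wy|yW] := leP (W w) (sn * y).
    by rewrite mulr0 addr0; lra.
  pose u := W w / sn - y.
  have u0 : 0 <= u by rewrite subr_ge0 ler_pdivlMr// mulrC ltW.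
  have := sv_neg sv u0; have -> : - u = y - W w / sn by rewrite /u; ring.
  move=> /andP[_ neg].
  have sn0 := lt0r_neq0 sn_gt0.
  have uE : W w - sn * y = sn * u by rewrite /u; field.
  (* Scaling turns [u ^+ 2] into [sn * u ^+ 2], an upper bound because [sn >= 1]. *)
  have h1 : L * (u + u ^+ 2) <= sn^-1 * (L * (W w - sn * y + (W w - sn * y) ^+ 2)).
    rewrite uE; have -> : sn^-1 * (L * (sn * u + (sn * u) ^+ 2)) = L * (u + sn * u ^+
      2) by field.
    by rewrite ler_wpM2l// lerD2l ler_peMl// sqr_ge0.
  have h2 : sn^-1 * (L * (W w - sn * y + (W w - sn * y) ^+ 2) - K) =
    sn^-1 * (L * (W w - sn * y + (W w - sn * y) ^+ 2)) - K / sn by ring.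
  by rewrite h2; lra.
have mG := killed_value_mean k0 (lexx 0) y0.
apply: (le_trans (le_mean mG mH GH)).
rewrite (meanD (taylor_mean y) mKRB) (meanD (has_mean_cst P (K / sn)) mRB).
rewrite (meanD rem_mean (has_meanZ sn^-1 mB)) mean_taylor mean_cst mean_rem meanZ//.
have : sn^-1 * (\int[P]_w B w) <= 0 by rewrite pmulr_rle0// invr_gt0.
lra.
Qed.

(** Below [a] the killed value is [0] and [F] is at most [F a]; subtracting [F a] everywhere covers
    both cases. *)
Lemma one_claim_lb (a y : R) : 0 <= a -> a <= y ->
  F y + (- (F1 y * (m 1 / sn)) + F2 y / 2 * (m 2 / n)) - L * (m 3 / (n * sn)) - F a <=
  \int[P]_w killed_value F 0 a (y - W w / sn).
Proof.
move=> a0 ay; have y0 := le_trans a0 ay.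
pose H w := taylor y w + ((- 1) * rem w + - F a).
have mR : has_mean P (fun w => (- 1) * rem w + - F a).
  by apply: has_meanD; [exact: has_meanZ|exact: has_mean_cst].
have mH : has_mean P H by apply: has_meanD.
have GH w : H w <= killed_value F 0 a (y - W w / sn).
  have := taylor_bnd y w; rewrite ler_norml => /andP[tb _].
  have Fa := smooth_value_ge0 sv a0.
  rewrite /killed_value /H; have [av|av] := leP a (y - W w / sn); first by lra.
  by have := smooth_value_le sv a0 (ltW av); lra.
have mG := killed_value_mean (lexx 0) a0 y0.
apply: le_trans (le_mean mH mG GH).
rewrite (meanD (taylor_mean y) mR).
rewrite (meanD (has_meanZ (- 1) rem_mean) (has_mean_cst P (- F a))) mean_taylor
  mean_cst meanZ// mean_rem.
lra.
Qed.

End one_claim.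

(** * Conditioning on the number of claims in a step *)

Section model_step.
Context {R : realType} {d0} {T0 : measurableType d0} {P0 : probability T0 R}
  (Y : {RV P0 >-> R}) (lambda n : R)
  {d} {T : measurableType d} {P : probability T R}
  (N : counting_process P) (Z : nat -> {RV P >-> R}).
Hypotheses (lambda_gt0 : 0 < lambda) (n_gt0 : 0 < n).
Hypothesis CL : cramer_lundberg Y lambda n N Z.
Variables (h s a b x : R).
Hypothesis h_gt0 : 0 < h.

(** The claims are nonnegative only almost surely; with positive parts the bounds on the chain hold
    on every path. *)
Let pos (z : R) := Num.max z 0.
Let M (k : nat) (w : T) : nat := N (k%:R * h) w.
Let Zp i w := pos (Z i w).
Let chain := killed_chain M Zp s a b x.
Let div := chain_dividend M Zp s a b x.
Let rate := n * lambda.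
Let sn := Num.sqrt n.
Let incr (k m : nat) : set T := [set w | (M k.+1 w - M k w)%N = m].
Let next k w := Z (M k w) w.

Let mpos : measurable_fun setT pos. Proof. exact: measurable_maxr. Qed.

Let rate_gt0 : 0 < rate. Proof. exact: mulr_gt0. Qed.

Let Z_law i (B : set R) : measurable B -> P (Z i @^-1` B) = P (Z 0%N @^-1` B).
Proof. by move=> mB; rewrite !(claim_law CL). Qed.

Lemma claim_mean (f : R -> \bar R) : measurable_fun setT f -> (forall z, 0 <= f z)%E ->
  (\int[P]_w f (Z 0%N w) = \int[P0]_w f (Y w / sn)%R)%E.
Proof.
move=> mf f0.
have mYs : measurable_fun setT (fun w => Y w / sn).
  by apply: measurable_funM => //; exact: measurable_funPT.
pose Ys : {mfun T0 >-> R} := HB.pack (fun w => Y w / sn) (isMeasurableFun.Build _ _ _ _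
  _ mYs).
have := @ge0_integral_distribution _ _ _ _ _ P (Z 0%N) f mf f0.
have := @ge0_integral_distribution _ _ _ _ _ P0 Ys f mf f0.
rewrite /= => <- <-; apply: eq_measure_integral => A mA _.
by have := claim_law CL 0 mA.
Qed.

Let mchain k : measurable_fun setT (chain k).
Proof. exact: measurable_chain. Qed.

Let mnext k : measurable_fun setT (next k).
Proof. exact: measurable_next_claim. Qed.

Let m_incr k m : measurable (incr k m).
Proof. exact: (measurable_incr N h_gt0). Qed.

(** Combines the independence of the next claim with its law, that of [Y / sn], and passes to real
    integrals, for which [phi] is bounded. *)
Lemma step_mean k m (phi : R * R -> R) (B : R) :
  measurable_fun setT phi -> (forall z, 0 <= phi z <= B) ->
  has_mean P (fun w => \int[P0]_v phi (chain k w, Y v / sn)) /\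
  \int[P]_w (\1_(incr k m) w * phi (chain k w, next k w)) =
    poisson_pmf (rate * h) m * \int[P]_w \int[P0]_v phi (chain k w, Y v / sn).
Proof.
move=> mphi phiB.
have phi0 z : 0 <= phi z by case/andP: (phiB z).
have mYs : measurable_fun setT (fun w => Y w / sn).
  by apply: measurable_funM => //; exact: measurable_funPT.
have mean_phi y : has_mean P0 (fun v => phi (y, Y v / sn)).
  apply: has_mean_dom (has_mean_cst P0 B) => [|v].
    by apply: (measurableT_comp mphi); exact: measurable_fun_pair.
  by rewrite ger0_norm; have /andP[] := phiB (y, Y v / sn).
have inner y : (\int[P]_v (phi (y, Z 0%N v))%:E = (\int[P0]_v phi (y, Y v / sn))%R%:E)%E.
  rewrite (claim_mean (f := fun z => (phi (y, z))%:E)) => [||z]; last by rewrite lee_fin.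
    by rewrite (mean_EFin (mean_phi y)).
  by apply/measurable_EFinP; apply: (measurableT_comp mphi); exact: measurable_fun_pair.
have bnd y : 0 <= \int[P0]_v phi (y, Y v / sn) <= B.
  rewrite Rintegral_ge0//=; apply: (le_trans (le_mean (mean_phi y) (has_mean_cst P0 B) _)).
    by move=> v; case/andP: (phiB (y, Y v / sn)).
  by rewrite mean_cst.
have mphi2 : measurable_fun setT (fun w => \int[P0]_v phi (chain k w, Y v / sn)).
  have m1 : measurable_fun setT (fun y => (\int[P0]_v phi (y, Y v / sn))%R).
    apply/measurable_EFinP.
    rewrite (_ : EFin \o _ = fun y => (\int[P]_v (phi (y, Z 0%N v))%:E)%E); last first.
      by apply/funext => y; rewrite inner.
    have mf : measurable_fun setT (fun z : R * T => (phi (z.1, Z 0%N z.2))%:E).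
      apply/measurable_EFinP; apply: (measurableT_comp mphi);
        apply: measurable_fun_pair => //.
      by apply: measurableT_comp => //; exact: measurable_funPT.
    by apply: (measurable_fun_fubini_tonelli_F (m2 := P) _ mf) => z; rewrite lee_fin.
  exact: (measurableT_comp m1).
have mean2 : has_mean P (fun w => \int[P0]_v phi (chain k w, Y v / sn)).
  apply: has_mean_dom (has_mean_cst P B) => // w.
  by rewrite ger0_norm; have /andP[] := bnd (chain k w).
split => //; apply: EFin_inj; rewrite EFinM -(mean_EFin mean2).
have mean1 : has_mean P (fun w => \1_(incr k m) w * phi (chain k w, next k w)).
  apply: has_mean_dom (has_mean_cst P B) => [|w].
    apply: measurable_funM; first exact: measurable_indic.
    by apply: (measurableT_comp mphi); exact: measurable_fun_pair.
  have /andP[p0 pB] := phiB (chain k w, next k w).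
  rewrite indicE; case: (w \in _); rewrite ?mul1r ?mul0r ?normr0 ?ger0_norm//.
  exact: le_trans pB.
rewrite -(mean_EFin mean1).
under [X in _ = (_ * X)%E]eq_integral do rewrite -inner.
rewrite -(@ge0_integral_chain _ _ _ _ N Z rate h rate_gt0 h_gt0 (claim_number_poisson CL)
  (claims_independent CL) (claims_indep_number CL) Z_law s a b x pos mpos k m
  (fun z => (phi z)%:E)).
- rewrite [RHS]integral_mkcond; apply: eq_integral => w _.
  by rewrite patchE indicE; case: ifPn => _; rewrite ?mul1r ?mul0r.
- exact/measurable_EFinP.
- by move=> z; rewrite lee_fin.
Qed.

End model_step.

(** * The recursion *)

Section recursion.
Context {R : realType} {d0} {T0 : measurableType d0} {P0 : probability T0 R}
  (Y : {RV P0 >-> R}) (lambda n : R)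
  {d} {T : measurableType d} {P : probability T R}
  (N : counting_process P) (Z : nat -> {RV P >-> R}).
Hypotheses (lambda_gt0 : 0 < lambda) (n_gt0 : 0 < n).
Hypothesis CL : cramer_lundberg Y lambda n N Z.
Variables (h s a b x : R).
Hypotheses (h_gt0 : 0 < h) (s_gt0 : 0 < s) (a_ge0 : 0 <= a) (a_le_b : a <= b) (x_le_b :
  x <= b).
Variables (mu sigma2 delta L k : R) (F F1 F2 : R -> R).
Hypothesis sv : smooth_value mu sigma2 delta b L F F1 F2.
Hypothesis k_ge0 : 0 <= k.

Let pos (z : R) := Num.max z 0.
Let M (i : nat) (w : T) : nat := N (i%:R * h) w.
Let Zp i w := pos (Z i w).
Let chain := killed_chain M Zp s a b x.
Let div := chain_dividend M Zp s a b x.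
Let rate := n * lambda.
Let sn := Num.sqrt n.
Let incr (i m : nat) : set T := [set w | (M i.+1 w - M i w)%N = m].
Let next i w := Z (M i w) w.
Let J := claims_between M Zp.
Let G := killed_value F k a.
Let B := F (b + s) + k.
Let W v := Num.max (Y v) 0.
Let E1 y := \int[P0]_v G (y + s - W v / sn).
Let p0 := poisson_pmf (rate * h) 0.
Let p1 := poisson_pmf (rate * h) 1.

Let sn_gt0 : 0 < sn. Proof. by rewrite sqrtr_gt0. Qed.
Let b_ge0 : 0 <= b. Proof. exact: le_trans a_le_b. Qed.
Let bs_ge0 : 0 <= b + s. Proof. by rewrite addr_ge0// ltW. Qed.
Let mpos : measurable_fun setT pos. Proof. exact: measurable_maxr. Qed.
Let pos_ge0 z : 0 <= pos z. Proof. by rewrite /pos le_max lexx orbT. Qed.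
Let mG : measurable_fun setT G. Proof. exact: (measurable_killed_value sv). Qed.

Let G_itv v : v <= b + s -> 0 <= G v <= B.
Proof. exact: (killed_value_itv sv). Qed.

Let B_ge0 : 0 <= B.
Proof. by have /andP[/le_trans] := G_itv (lexx (b + s)); apply. Qed.

Let chain_le i w : chain i w <= b. Proof. exact: killed_chain_le. Qed.

Let J_ge0 i w : 0 <= J i w.
Proof. by apply: sumr_ge0 => l _; exact: pos_ge0. Qed.

Let mchain i : measurable_fun setT (chain i).
Proof. exact: measurable_chain. Qed.

Let mZp i : measurable_fun setT (Zp i).
Proof. by apply: measurableT_comp => //; exact: measurable_funPT. Qed.

Let mJ i : measurable_fun setT (J i).
Proof. by apply: measurable_claims_between => //; exact: measurable_funPT. Qed.

Let ndM i w : (M i w <= M i.+1 w)%N.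
Proof. by apply: counting_nd; rewrite ?mulr_ge0 ?ler_pM2r ?ler_nat// ltW. Qed.

Lemma measurable_chain_dividend i : measurable_fun setT (div i).
Proof.
apply: measurable_fun_ifT; first exact: measurable_fun_ltr.
  exact: measurable_cst.
apply: measurable_maxr => //; apply: measurable_funB => //.
by apply: measurable_funB => //; exact: measurable_funD.
Qed.

Let post i w := if chain i w < a then 0 else G (chain i w + s - J i w).

Let post_itv i w : 0 <= post i w <= B.
Proof.
rewrite /post; case: ifP => _; first by rewrite lexx B_ge0.
by apply: G_itv; have := chain_le i w; have := J_ge0 i w; lra.
Qed.

(** When the overflow is paid out, [a <= b] ensures that the chain put back to [b] is still alive
    and keeps its bonus [k]. *)
Let postE i w : G (chain i.+1 w) + div i w = post i w.
Proof.
rewrite /post /div /chain_dividend -/(chain i w) /chain/= -/(chain i w) -/(J i w).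
case: ifPn => [ya|_]; first by rewrite /G /killed_value leNgt ya addr0.
set v := _ + s - _; have [vb|vb] := leP v b.
  by rewrite max_l ?addr0// subr_le0.
rewrite max_r ?subr_ge0 ?(ltW vb)// /G /killed_value a_le_b (le_trans a_le_b (ltW vb)).
by rewrite (sv_linear sv (ltW vb)); ring.
Qed.

Lemma chain_dividend_ge0 i w : 0 <= div i w.
Proof. by rewrite /div /chain_dividend; case: ifP => // _; rewrite le_max lexx. Qed.

Lemma killed_value_chain_mean i : has_mean P (fun w => G (chain i w)).
Proof.
apply: has_mean_dom (has_mean_cst P B) => [|w]; first exact: measurableT_comp.
have /andP[G0 GB] : 0 <= G (chain i w) <= B.
  by apply: G_itv; rewrite (le_trans (chain_le i w))// lerDl ltW.
by rewrite ger0_norm.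
Qed.

Lemma chain_dividend_mean i : has_mean P (div i).
Proof.
apply: has_mean_dom (has_mean_cst P B) => [|w]; first exact: measurable_chain_dividend.
rewrite ger0_norm ?chain_dividend_ge0//.
have /andP[_] := post_itv i w; apply: le_trans; rewrite -postE lerDr.
by have /andP[] : 0 <= G (chain i.+1 w) <= B; first (apply: G_itv;
  rewrite (le_trans (chain_le i.+1 w))// lerDl ltW).
Qed.

Let post_mean i : has_mean P (post i).
Proof.
have := has_meanD (killed_value_chain_mean i.+1) (chain_dividend_mean i).
by congr has_mean; apply/funext => w; rewrite postE.
Qed.

Let mean_post i : \int[P]_w post i w =
  \int[P]_w G (chain i.+1 w) + \int[P]_w div i w.
Proof.
rewrite -(meanD (killed_value_chain_mean i.+1) (chain_dividend_mean i)).
by apply: eq_Rintegral => w _; rewrite postE.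
Qed.

(** The chain never exceeds [b], and frozen paths have value [0]; the cut-off makes [phi0] and
    [phi1] bounded on the whole plane, as [step_mean] demands. *)
Let inside (z : R * R) := a <= z.1 <= b.
Let phi0 (z : R * R) := if inside z then G (z.1 + s) else 0.
Let phi1 (z : R * R) := if inside z then G (z.1 + s - pos z.2) else 0.

Let m_inside : measurable_fun setT inside.
Proof.
by apply: measurable_and; [apply: measurable_fun_ler|apply: measurable_fun_ler].
Qed.

Let mphi0 : measurable_fun setT phi0.
Proof.
apply: measurable_fun_ifT => //.
by apply: (measurableT_comp mG); exact: measurable_funD.
Qed.

Let mphi1 : measurable_fun setT phi1.
Proof.
apply: measurable_fun_ifT => //.
apply: (measurableT_comp mG); apply: measurable_funB; first exact: measurable_funD.
exact: measurableT_comp.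
Qed.

Let phi0_itv z : 0 <= phi0 z <= B.
Proof.
rewrite /phi0; case: ifP => [/andP[_ zb]|_]; last by rewrite lexx B_ge0.
by apply: G_itv; rewrite lerD2r.
Qed.

Let phi1_itv z : 0 <= phi1 z <= B.
Proof.
rewrite /phi1; case: ifP => [/andP[_ zb]|_]; last by rewrite lexx B_ge0.
by apply: G_itv; have := pos_ge0 z.2; lra.
Qed.

Let one (z : R * R) : R := 1.

Let sm i m phi := @step_mean _ _ _ _ Y lambda n _ _ _ N Z lambda_gt0 n_gt0 CL h s a b x
  h_gt0 i m phi.

Let mean_incr i m : \int[P]_w \1_(incr i m) w = poisson_pmf (rate * h) m.
Proof.
have [||_] := @sm i m one 1.
- exact: measurable_cst.
- by move=> z; rewrite /one ler01 lexx.
move=> E; rewrite /one (mean_cst P0) (mean_cst P) mulr1 in E.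
by rewrite -E; apply: eq_Rintegral => w _; rewrite mulr1.
Qed.

Let inner0 w i : \int[P0]_v phi0 (chain i w, Y v / sn) = phi0 (chain i w, 0).
Proof. exact: (mean_cst P0 (phi0 (chain i w, 0))). Qed.

Let inner1 w i : \int[P0]_v phi1 (chain i w, Y v / sn) =
  if a <= chain i w then E1 (chain i w) else 0.
Proof.
rewrite /phi1 /inside /= chain_le andbT; case: ifP => _; last by rewrite mean_cst.
apply: eq_Rintegral => v _; congr (G (_ - _)).
by rewrite /pos /W maxr_pMl ?invr_ge0 ?(ltW sn_gt0)// mul0r.
Qed.

Let post_incr i w : post i w =
  \1_(incr i 0) w * phi0 (chain i w, next i w) +
  \1_(incr i 1) w * phi1 (chain i w, next i w) +
  (1 - \1_(incr i 0) w - \1_(incr i 1) w) * post i w.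
Proof.
have inE' m : (w \in incr i m) = ((M i.+1 w - M i w)%N == m).
  by apply/idP/eqP; rewrite inE.
rewrite !indicE !inE' /post /phi0 /phi1 /inside /= chain_le andbT ltNge.
have JE : J i w = \sum_(M i w <= l < M i.+1 w) Zp l w by [].
have [] := eqVneq (M i.+1 w - M i w)%N 0%N => [E0|N0].
  have ME : M i.+1 w = M i w.
    by apply/eqP; rewrite eqn_leq ndM andbT -subn_eq0 E0.
  rewrite JE E0 ME big_geq//=.
  by case: (a <= chain i w) => /=; rewrite ?subr0; ring.
have [E1'|N1] := eqVneq (M i.+1 w - M i w)%N 1%N; last by rewrite /=; ring.
have ME : M i.+1 w = (M i w).+1.
  by rewrite -(subnK (ndM i w)) E1'.
rewrite JE ME big_nat1 /= /Zp -/(next i w).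
by case: (a <= chain i w) => /=; rewrite ?subr0; ring.
Qed.

Let rest_ge0 i w : 0 <= 1 - \1_(incr i 0) w - \1_(incr i 1) w :> R.
Proof.
rewrite !indicE; case: (boolP (w \in incr i 0)) => [|_]; last by case: (_ \in _);
  rewrite /=; lra.
rewrite inE /incr /= => E0; rewrite memNset/=; last by rewrite /= E0.
lra.
Qed.

Let mean_ind i m : has_mean P \1_(incr i m).
Proof.
apply: has_mean_dom (has_mean_cst P 1) => [|w].
  by apply: measurable_indic; exact: (measurable_incr N h_gt0).
by rewrite indicE; case: (_ \in _); rewrite ?normr1 ?normr0.
Qed.

Let term_mean i m (phi : R * R -> R) : measurable_fun setT phi ->
  (forall z, 0 <= phi z <= B) ->
  has_mean P (fun w => \1_(incr i m) w * phi (chain i w, next i w)).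
Proof.
move=> mphi phiB; apply: has_mean_dom (has_mean_cst P B) => [|w].
  apply: measurable_funM.
    by apply: measurable_indic; exact: (measurable_incr N h_gt0).
  apply: (measurableT_comp mphi); apply: measurable_fun_pair => //.
  exact: measurable_next_claim.
have /andP[q0 qB] := phiB (chain i w, next i w).
by rewrite indicE; case: (w \in _); rewrite ?mul1r ?mul0r ?normr0 ?ger0_norm.
Qed.

Let mean0 i : has_mean P (fun w => phi0 (chain i w, 0)).
Proof.
have [+ _] := @sm i 0%N phi0 B mphi0 phi0_itv.
by congr has_mean; apply/funext => w; rewrite inner0.
Qed.

Let mean1 i : has_mean P (fun w => if a <= chain i w then E1 (chain i w) else 0).
Proof.
have [+ _] := @sm i 1%N phi1 B mphi1 phi1_itv.
by congr has_mean; apply/funext => w; rewrite inner1.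
Qed.

Let int0 i : \int[P]_w (\1_(incr i 0) w * phi0 (chain i w, next i w)) =
  p0 * \int[P]_w phi0 (chain i w, 0).
Proof.
have [_ ->] := @sm i 0%N phi0 B mphi0 phi0_itv; congr (_ * _).
by apply: eq_Rintegral => w _; rewrite inner0.
Qed.

Let int1 i : \int[P]_w (\1_(incr i 1) w * phi1 (chain i w, next i w)) =
  p1 * \int[P]_w (if a <= chain i w then E1 (chain i w) else 0).
Proof.
have [_ ->] := @sm i 1%N phi1 B mphi1 phi1_itv; congr (_ * _).
by apply: eq_Rintegral => w _; rewrite inner1.
Qed.

Variables (D err : R).

(** Two or more claims are charged with the full bound [B] on every path, even on frozen ones, whose
    value is [0]; the assumption on [err] covers those. *)
Lemma recursion_ub i : 0 <= D -> (1 - p0 - p1) * B <= err ->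
  (forall y, a <= y <= b -> p0 * G (y + s) + p1 * E1 y + (1 - p0 - p1) * B <= D * G y +
    err) ->
  \int[P]_w G (chain i.+1 w) + \int[P]_w div i w <= D * \int[P]_w G (chain i w) + err.
Proof.
move=> D0 errB hyp; rewrite -mean_post.
have t0 := term_mean i 0 mphi0 phi0_itv; have t1 := term_mean i 1 mphi1 phi1_itv.
have tr : has_mean P (fun w => B + (- B * \1_(incr i 0) w + - B * \1_(incr i 1) w)).
  apply: has_meanD; first exact: has_mean_cst.
  by apply: has_meanD; apply: has_meanZ.
have tall := has_meanD (has_meanD t0 t1) tr.
apply: (@le_trans _ _ (\int[P]_w (\1_(incr i 0) w * phi0 (chain i w, next i w) +
  \1_(incr i 1) w * phi1 (chain i w, next i w) +
  (B + (- B * \1_(incr i 0) w + - B * \1_(incr i 1) w))))).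
  apply: le_mean => // w; rewrite {1}post_incr lerD2l.
  have -> : B + (- B * \1_(incr i 0) w + - B * \1_(incr i 1) w) =
    (1 - \1_(incr i 0) w - \1_(incr i 1) w) * B by ring.
  by rewrite ler_wpM2l//; have /andP[] := post_itv i w.
rewrite (meanD (has_meanD t0 t1) tr) (meanD t0 t1) int0 int1.
rewrite (meanD (has_mean_cst P B) (has_meanD (has_meanZ (- B) (mean_ind i 0))
  (has_meanZ (- B) (mean_ind i 1)))).
rewrite (meanD (has_meanZ (- B) (mean_ind i 0)) (has_meanZ (- B) (mean_ind i 1))).
rewrite mean_cst (meanZ (- B) (mean_ind i 0)) (meanZ (- B) (mean_ind i 1)) !mean_incr.
have r0 := has_meanZ p0 (mean0 i); have r1 := has_meanZ p1 (mean1 i).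
have rc := has_mean_cst P ((1 - p0 - p1) * B).
have := @le_mean _ _ _ P _ _ (has_meanD (has_meanD r0 r1) rc)
  (has_meanD (has_meanZ D (killed_value_chain_mean i)) (has_mean_cst P err)).
rewrite (meanD (has_meanD r0 r1) rc) (meanD r0 r1) (meanZ _ (mean0 i)) (meanZ _ (mean1
  i)) !mean_cst.
rewrite (meanD (has_meanZ D (killed_value_chain_mean i)) (has_mean_cst P err)) (meanZ _
  (killed_value_chain_mean i)) mean_cst.
rewrite -/p0 -/p1 => le1; apply: le_trans (le1 _); first by lra.
move=> w; rewrite /phi0 /inside /= chain_le andbT; case: ifPn => aw.
  by apply: hyp; rewrite aw chain_le.
by rewrite /G /killed_value (negbTE aw) !mulr0 !add0r.
Qed.

Lemma recursion_lb i : 0 <= err ->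
  (forall y, a <= y <= b -> D * G y - err <= p0 * G (y + s) + p1 * E1 y) ->
  D * \int[P]_w G (chain i w) - err <= \int[P]_w G (chain i.+1 w) + \int[P]_w div i w.
Proof.
move=> err0 hyp; rewrite -mean_post.
have t0 := term_mean i 0 mphi0 phi0_itv; have t1 := term_mean i 1 mphi1 phi1_itv.
apply: (@le_trans _ _ (\int[P]_w (\1_(incr i 0) w * phi0 (chain i w, next i w) +
  \1_(incr i 1) w * phi1 (chain i w, next i w)))); last first.
  apply: le_mean => //; first exact: has_meanD.
  move=> w; rewrite [leRHS]post_incr lerDl mulr_ge0//.
  by have /andP[] := post_itv i w.
rewrite (meanD t0 t1) int0 int1.
have r0 := has_meanZ p0 (mean0 i); have r1 := has_meanZ p1 (mean1 i).
have := @le_mean _ _ _ P _ _ 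
  (has_meanD (has_meanZ D (killed_value_chain_mean i)) (has_mean_cst P (- err)))
    (has_meanD r0 r1).
rewrite (meanD r0 r1) (meanZ _ (mean0 i)) (meanZ _ (mean1 i)).
rewrite (meanD (has_meanZ D (killed_value_chain_mean i)) (has_mean_cst P (- err)))
  (meanZ _ (killed_value_chain_mean i)) mean_cst.
apply => w; rewrite /phi0 /inside /= chain_le andbT; case: ifPn => aw.
  by apply: hyp; rewrite aw chain_le.
by rewrite /G /killed_value (negbTE aw) !mulr0 add0r addr0 oppr_le0.
Qed.

End recursion.

(** * Bounds on the payoff *)

(** Multiplied by [D^-1 ^+ k.+1] the recursion telescopes, and the errors form a geometric series
    bounded by [err / (D - 1)]. With [D = expR (delta * h)] an error [h C] per step thus costs at
    most [C / delta]. *)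
Lemma geometric_ub {R : realType} (u e : nat -> R) (D err : R) (K : nat) : 1 < D ->
  (forall k, 0 <= u k) -> 0 <= err -> (forall k, u k.+1 + e k <= D * u k + err) ->
  \sum_(k < K) D^-1 ^+ k.+1 * e k <= u 0%N + err / (D - 1).
Proof.
move=> D1 u0 err0 ue; have D0 : 0 < D by exact: lt_trans D1.
have r0 k : 0 < D^-1 ^+ k by rewrite exprn_gt0// invr_gt0.
have E0 : 0 <= err / (D - 1) by rewrite divr_ge0// subr_ge0 ltW.
suff : \sum_(k < K) D^-1 ^+ k.+1 * e k + D^-1 ^+ K * u K <=
    u 0%N + err / (D - 1) * (1 - D^-1 ^+ K).
  have : 0 <= D^-1 ^+ K * u K by rewrite mulr_ge0// ltW.
  have : 0 <= err / (D - 1) * D^-1 ^+ K by rewrite mulr_ge0// ltW.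
  lra.
elim: K => [|K IH]; first by rewrite big_ord0 !expr0 subrr mulr0 mul1r add0r addr0.
rewrite big_ord_recr/=.
have h1 : D^-1 ^+ K.+1 * (u K.+1 + e K) <= D^-1 ^+ K.+1 * (D * u K + err).
  by rewrite ler_pM2l.
have h2 : D^-1 ^+ K.+1 * (D * u K + err) = D^-1 ^+ K * u K + D^-1 ^+ K.+1 * err.
  by rewrite exprS; field; exact: lt0r_neq0.
have h3 : err / (D - 1) * (1 - D^-1 ^+ K.+1) =
    err / (D - 1) * (1 - D^-1 ^+ K) + D^-1 ^+ K.+1 * err.
  by rewrite exprS; field; rewrite !gt_eqF ?subr_gt0.
by move: IH h1; rewrite h2 h3; lra.
Qed.

Lemma geometric_lb {R : realType} (u e : nat -> R) (D err : R) (K : nat) : 1 < D ->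
  0 <= err -> (forall k, D * u k - err <= u k.+1 + e k) ->
  u 0%N - err / (D - 1) - D^-1 ^+ K * u K <= \sum_(k < K) D^-1 ^+ k.+1 * e k.
Proof.
move=> D1 err0 ue; have D0 : 0 < D by exact: lt_trans D1.
have r0 k : 0 < D^-1 ^+ k by rewrite exprn_gt0// invr_gt0.
have E0 : 0 <= err / (D - 1) by rewrite divr_ge0// subr_ge0 ltW.
suff : u 0%N - err / (D - 1) * (1 - D^-1 ^+ K) <=
    \sum_(k < K) D^-1 ^+ k.+1 * e k + D^-1 ^+ K * u K.
  have : 0 <= err / (D - 1) * D^-1 ^+ K by rewrite mulr_ge0// ltW.
  lra.
elim: K => [|K IH]; first by rewrite big_ord0 !expr0 subrr mulr0 mul1r add0r subr0.
rewrite big_ord_recr/=.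
have h1 : D^-1 ^+ K.+1 * (D * u K - err) <= D^-1 ^+ K.+1 * (u K.+1 + e K).
  by rewrite ler_pM2l.
have h2 : D^-1 ^+ K.+1 * (D * u K - err) = D^-1 ^+ K * u K - D^-1 ^+ K.+1 * err.
  by rewrite exprS; field; exact: lt0r_neq0.
have h3 : err / (D - 1) * (1 - D^-1 ^+ K.+1) =
    err / (D - 1) * (1 - D^-1 ^+ K) + D^-1 ^+ K.+1 * err.
  by rewrite exprS; field; rewrite !gt_eqF ?subr_gt0.
by move: IH h1; rewrite h2 h3; lra.
Qed.

Lemma eq_chain_dividend (R : realType) (T : Type) (M : nat -> T -> nat)
    (Z Z' : nat -> T -> R) (s a b x : R) (w : T) (k : nat) :
  (forall k, (M k w <= M k.+1 w)%N) -> (forall i, Z i w = Z' i w) ->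
  chain_dividend M Z s a b x k w = chain_dividend M Z' s a b x k w.
Proof.
move=> ndM ZZ'; rewrite /chain_dividend (eq_killed_chain (Z' := Z'))//.
by congr (if _ then _ else Num.max _ (_ - _ - _)); apply: eq_big_nat.
Qed.

Lemma ereal_le_vanishing {R : realType} (p : \bar R) (A B h0 : R) : 0 < h0 -> 0 <= B ->
  (forall h, 0 < h -> h <= h0 -> (p <= (A + B * h)%:E)%E) -> (p <= A%:E)%E.
Proof.
move=> h0_gt0 B0 pAB; apply/lee_addgt0Pr => e e0.
have B1 : 0 < B + 1 by rewrite ltr_wpDl.
pose h := Num.min h0 (e / (B + 1)).
have h_gt0 : 0 < h by rewrite lt_min h0_gt0 divr_gt0.
apply: (le_trans (pAB h h_gt0 _)); first by rewrite ge_min lexx.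
rewrite -EFinD lee_fin lerD2l.
have he : h * (B + 1) <= e by rewrite -ler_pdivlMr// ge_min lexx orbT.
lra.
Qed.

Lemma ereal_ge_vanishing {R : realType} (p : \bar R) (A B h0 : R) : 0 < h0 -> 0 <= B ->
  (forall h, 0 < h -> h <= h0 -> ((A - B * h)%:E <= p)%E) -> (A%:E <= p)%E.
Proof.
move=> h0_gt0 B0 pAB; rewrite -leeN2; apply: (ereal_le_vanishing h0_gt0 B0) => h h1 h2.
by rewrite leeNl -EFinN opprD opprK; exact: pAB.
Qed.

Section payoff_bounds.
Context {R : realType} {d0} {T0 : measurableType d0} {P0 : probability T0 R}
  (Y : {RV P0 >-> R}) (lambda theta delta n : R)
  {d} {T : measurableType d} {P : probability T R}
  (N : counting_process P) (Z : nat -> {RV P >-> R}).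
Hypotheses (lambda_gt0 : 0 < lambda) (theta_gt0 : 0 < theta) (delta_gt0 : 0 < delta)
  (n_ge1 : 1 <= n).
Hypothesis CL : cramer_lundberg Y lambda n N Z.
Hypothesis Y_gt0 : {ae P0, forall w, 0 < Y w}.
Let W w := Num.max (Y w) 0.
Hypothesis W_mean : forall k, has_mean P0 (fun w => W w ^+ k.+1).
Let m k := \int[P0]_w (W w ^+ k).
Hypothesis m_gt0 : forall k, 0 < m k.+1.
Variables (b L x : R) (F F1 F2 : R -> R).
Hypotheses (b_gt0 : 0 < b) (x_ge0 : 0 <= x).
Hypothesis sv : smooth_value (theta * lambda * m 1) (lambda * m 2) delta b L F F1 F2.

Let sn := Num.sqrt n.
Let c := (sn + theta) * lambda * m 1.
Let payoff := barrier_payoff N Z c x b delta.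
Let x0 := Num.min x b.

Let n_gt0 : 0 < n. Proof. exact: lt_le_trans n_ge1. Qed.
Let sn_gt0 : 0 < sn. Proof. by rewrite sqrtr_gt0. Qed.
Let c_gt0 : 0 < c. Proof. by rewrite /c mulr_gt0 ?mulr_gt0 ?addr_gt0. Qed.
Let L_ge0 := smooth_value_L_ge0 sv.
Let x0_itv : 0 <= x0 <= b.
Proof. by rewrite /x0 le_min x_ge0 (ltW b_gt0)/= ge_min lexx orbT. Qed.

Let good : set T := \bigcap_i (Z i @^-1` `[0, +oo[%classic).

Let mgood : measurable good.
Proof.
apply: bigcapT_measurable => i; rewrite -[X in measurable X]setTI.
exact: measurable_funPT.
Qed.

Let bad0 : P (~` good) = 0%E.
Proof.
have badE : ~` good = \bigcup_i (Z i @^-1` `]-oo, 0[%classic).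
  rewrite /good setC_bigcap; apply: eq_bigcupr => i _.
  by apply/seteqP; split => w /=; rewrite !in_itv/= andbT ltNge => /negP.
rewrite badE; apply/eqP; rewrite eq_le measure_ge0 andbT.
have mZ i : measurable (Z i @^-1` `]-oo, (0 : R)[%classic).
  by rewrite -[X in measurable X]setTI; exact: measurable_funPT.
apply: (le_trans (measure_sigma_subadditive _ mZ (bigcupT_measurable _ mZ)
  (@subset_refl _ _))).
rewrite eseries0// => i _ _; rewrite /= (claim_law CL)//.
apply: measure_negligible.
  rewrite [X in measurable X](_ : _ = Y @^-1` `]-oo, 0[%classic).
    by rewrite -[X in measurable X]setTI; exact: measurable_funPT.
  by apply/seteqP; split => w /=; rewrite !in_itv/= pmulr_llt0 ?invr_gt0.
apply: negligibleS Y_gt0 => w /=; rewrite in_itv/= pmulr_llt0 ?invr_gt0// => Yw Y0.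
by have := lt_trans Yw Y0; rewrite ltxx.
Qed.

Let good_ae : {ae P, forall w, good w}.
Proof. by exists (~` good); split => //; exact: measurableC. Qed.

(** * From paths to expectations at a fixed grid width *)

Section fixed_step.
Variables (h a : R).
Hypotheses (h_gt0 : 0 < h) (a_ge0 : 0 <= a) (a_le_b : a <= b).

Let M (k : nat) (w : T) : nat := N (k%:R * h) w.
Let Zp i w := Num.max (Z i w) 0.
Let chain := killed_chain M Zp (c * h) a b x0.
Let div := chain_dividend M Zp (c * h) a b x0.
Let D := expR (delta * h).

Let D_gt1 : 1 < D. Proof. by rewrite expR_gt1 mulr_gt0. Qed.
Let ch_gt0 : 0 < c * h. Proof. by rewrite mulr_gt0. Qed.
Let ndM k w : (M k w <= M k.+1 w)%N.
Proof. by apply: counting_nd; rewrite ?mulr_ge0 ?ler_pM2r ?ler_nat// ltW. Qed.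

Let div_good k w : good w ->
  chain_dividend M (fun i w => Z i w) (c * h) a b x0 k w = div k w.
Proof.
move=> gw; apply: eq_chain_dividend => [j|i]; first exact: ndM.
by have := gw i I; rewrite /= in_itv/= andbT /Zp => /max_l ->.
Qed.

Let discE k : expR (- delta * (k%:R * h)) = D^-1 ^+ k.
Proof. by rewrite -expRN -expRM_natl; congr expR; ring. Qed.

Let mdiv k : measurable_fun setT (div k).
Proof. exact: measurable_chain_dividend. Qed.

Let div_ge0 k w : 0 <= div k w. Proof. exact: chain_dividend_ge0. Qed.

Let div_mean k : has_mean P (div k).
Proof.
have /andP[_ x0b] := x0_itv.
exact: (chain_dividend_mean N Z h ch_gt0 a_ge0 a_le_b x0b sv (lexx 0)).
Qed.

Lemma payoff_step_ub (S : R) : a = 0 ->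
  (forall K, \sum_(k < K) D^-1 ^+ k.+1 * \int[P]_w div k w <= S) ->
  (payoff <= (Num.max 0 (x - b) + c * h + D * S)%:E)%E.
Proof.
move=> a0 sumS.
pose U w := ((Num.max 0 (x - b) + c * h)%:E +
  \sum_(k <oo) (D^-1 ^+ k * div k w)%:E)%E.
have Dk k : 0 <= D^-1 ^+ k by rewrite exprn_ge0// invr_ge0 expR_ge0.
have term_ge0 k w : (0 <= (D^-1 ^+ k * div k w)%:E)%E by rewrite lee_fin mulr_ge0.
have cst_ge0 : 0 <= Num.max 0 (x - b) + c * h.
  by rewrite addr_ge0 ?(ltW ch_gt0)// le_max lexx.
have mterm k : measurable_fun setT (fun w => (D^-1 ^+ k * div k w)%:E).
  by apply/measurable_EFinP; exact: measurable_funM.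
have S_ge0 w : (0 <= \sum_(k <oo) (D^-1 ^+ k * div k w)%:E)%E by exact: nneseries_ge0.
have mS : measurable_fun setT (fun w => \sum_(k <oo) (D^-1 ^+ k * div k w)%:E)%E.
  by apply: ge0_emeasurable_sum => [k w _ _|k _]; [exact: term_ge0|exact: mterm].
have U_ge0 w : (0 <= U w)%E by rewrite adde_ge0.
have mU : measurable_fun setT U by exact: emeasurable_funD.
(* [lower_integral_le] wants the inequality on every path; the value [+oo] on the null set outside
   [good] does not change the integral. *)
pose V w := if w \in good then U w else +oo%E.
have V_ge0 w : (0 <= V w)%E by rewrite /V; case: ifP.
have mV : measurable_fun setT V.
  apply: measurable_fun_ifT => //.
  by apply: (measurable_fun_bool true); rewrite setTI (_ : _ @^-1` _ = good)//;
     apply/seteqP; split => w /=; [exact: set_mem|exact: mem_set].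
apply: (@le_trans _ _ (\int[P]_w V w)%E).
  apply: lower_integral_le => w; first exact: integral_ge0.
  rewrite /V; case: ifPn => [|_]; last by rewrite leey.
  rewrite inE => gw.
  have Zw i : 0 <= Z i w by have := gw i I; rewrite /= in_itv/= andbT.
  apply: (le_trans (path_payoff_le N x b c_gt0 h_gt0 delta_gt0 Zw)).
  have dE k : chain_dividend M (fun i w => Z i w) (c * h) 0 b x0 k w = div k w.
    by rewrite -div_good// a0.
  rewrite /U leeD2l//; apply: lee_nneseries => [k _|k _].
    by move=> _; rewrite lee_fin dE mulr_ge0 ?expR_ge0.
  by rewrite discE dE.
rewrite (ge0_ae_eq_integral (g := U))//; last first.
  by move: good_ae; apply: filterS => w gw _; rewrite /V mem_set.
rewrite /U ge0_integralD// integral_cst//= probability_setT mule1 [leRHS]EFinD leeD2l//.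
rewrite integral_nneseries//; apply: lime_le.
  by apply: is_cvg_nneseries => k _ _; exact: integral_ge0.
apply: nearW => K; rewrite big_mkord.
have D0 : 0 < D := expR_gt0 _.
have E k : (\int[P]_w (D^-1 ^+ k * div k w)%:E =
    (D * (D^-1 ^+ k.+1 * \int[P]_w div k w))%:E)%E.
  rewrite (mean_EFin (has_meanZ (D^-1 ^+ k) (div_mean k))) (meanZ _ (div_mean k)).
  by congr EFin; rewrite exprS; field; exact: lt0r_neq0.
under eq_bigr do rewrite E.
by rewrite sumEFin lee_fin -mulr_sumr ler_pM2l.
Qed.

Lemma payoff_step_lb (K : nat) : 2 * (c * h) <= a ->
  ((Num.max 0 (x - b) + \sum_(k < K) D^-1 ^+ k.+1 * \int[P]_w div k w)%:E <= payoff)%E.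
Proof.
move=> cha.
have Dk k : 0 <= D^-1 ^+ k by rewrite exprn_ge0// invr_ge0 expR_ge0.
pose U w := Num.max 0 (x - b) + \sum_(k < K) D^-1 ^+ k.+1 * div k w.
have U_ge0 w : 0 <= U w.
  by rewrite addr_ge0 ?le_max ?lexx// sumr_ge0// => k _; rewrite mulr_ge0.
have mU : measurable_fun setT U.
  apply: measurable_funD => //; apply: measurable_sum => k; exact: measurable_funM.
(* Outside [good] the payoff is merely known to be nonnegative. *)
pose V w := if w \in good then (U w)%:E else 0%E.
have V_ge0 w : (0 <= V w)%E by rewrite /V; case: ifP => // _; rewrite lee_fin.
have mV : measurable_fun setT V.
  apply: measurable_fun_ifT => //; last exact/measurable_EFinP.
  by apply: (measurable_fun_bool true); rewrite setTI (_ : _ @^-1` _ = good)//;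
     apply/seteqP; split => w /=; [exact: set_mem|exact: mem_set].
have sum_mean J : has_mean P (fun w => \sum_(k < J) D^-1 ^+ k.+1 * div k w) /\
    \int[P]_w (\sum_(k < J) D^-1 ^+ k.+1 * div k w) =
    \sum_(k < J) D^-1 ^+ k.+1 * \int[P]_w div k w.
  elim: J => [|J [IH1 IH2]].
    rewrite big_ord0; under eq_Rintegral do rewrite big_ord0.
    split; last exact: mean_cst.
    rewrite (_ : (fun w => _) = fun=> 0); first exact: has_mean_cst.
    by apply/funext => w; rewrite big_ord0.
  have t := has_meanZ (D^-1 ^+ J.+1) (div_mean J).
  have SE : (fun w => \sum_(k < J.+1) D^-1 ^+ k.+1 * div k w) =
      fun w => \sum_(k < J) D^-1 ^+ k.+1 * div k w + D^-1 ^+ J.+1 * div J w.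
    by apply/funext => w; rewrite big_ord_recr.
  rewrite SE; split; first exact: has_meanD.
  by rewrite (meanD IH1 t) IH2 (meanZ _ (div_mean J)) big_ord_recr.
have [mS ES] := sum_mean K.
apply: (@le_trans _ _ (\int[P]_w V w)%E); last first.
  apply: lower_integral_le => // w.
  rewrite /V; case: ifPn => [|_]; last exact: integral_ge0.
  rewrite inE => gw.
  have Zw i : 0 <= Z i w by have := gw i I; rewrite /= in_itv/= andbT.
  apply: le_trans (path_payoff_ge N x c_gt0 h_gt0 delta_gt0 Zw K cha a_le_b).
  rewrite lee_fin lerD2l; apply: ler_sum => k _.
  by rewrite discE div_good.
rewrite (ge0_ae_eq_integral (g := fun w => (U w)%:E))//.
- have mUU := has_meanD (has_mean_cst P (Num.max 0 (x - b))) mS.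
  rewrite (mean_EFin mUU) (meanD (has_mean_cst P (Num.max 0 (x - b))) mS).
  by rewrite mean_cst ES.
- exact/measurable_EFinP.
- by move=> w _; rewrite lee_fin.
- by move: good_ae; apply: filterS => w gw _; rewrite /V mem_set.
Qed.

End fixed_step.

(** * Vanishing grid width *)

Let C3 := lambda * L * m 3.

Let C3_ge0 : 0 <= C3. Proof. by rewrite !mulr_ge0// ltW. Qed.

Let F_b_step h : 0 <= h -> F (b + c * h) = F b + c * h.
Proof.
move=> h0; have ch : 0 <= c * h by rewrite mulr_ge0// ltW.
by rewrite (sv_linear sv) ?lerDl//; ring.
Qed.

Let D_ge h : 0 < h -> delta * h <= expR (delta * h) - 1.
Proof. by move=> h0; rewrite lerBrDl expR_ge1Dx. Qed.

Lemma payoff_ub (K : R) : 0 <= K ->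
  (forall s, 0 <= s ->
    has_mean P0 (fun w => if s < W w then L * ((W w - s) + (W w - s) ^+ 2) - K else 0) /\
    \int[P0]_w (if s < W w then L * ((W w - s) + (W w - s) ^+ 2) - K else 0) <= 0) ->
  (payoff <= (Num.max 0 (x - b) + F x0 + (K + C3 / delta) / sn)%:E)%E.
Proof.
move=> K0 excess; have /andP[x0_ge0 x0_le] := x0_itv.
pose k := K / sn; have k0 : 0 <= k by rewrite divr_ge0// ltW.
pose G0 := L * (m 1 / sn + m 2 / n).
have G0_ge0 : 0 <= G0 by rewrite mulr_ge0// addr_ge0// divr_ge0// ltW.
have Fb0 : 0 <= F b by rewrite (smooth_value_ge0 sv)// ltW.
have c0 : 0 <= c := ltW c_gt0.
(* Bounds the coefficient of [h ^+ 2] in [err] for all [h <= 1]. *)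
pose Cn := L * c ^+ 2 + delta * L * c + (n * lambda) ^+ 2 * (F b + c + k + G0).
have Lc2 : 0 <= L * c ^+ 2 by rewrite mulr_ge0// sqr_ge0.
have dLc : 0 <= delta * L * c by rewrite mulr_ge0// mulr_ge0// ltW.
have Cn0 : 0 <= Cn.
  by rewrite addr_ge0 ?addr_ge0// mulr_ge0 ?sqr_ge0// addr_ge0// addr_ge0// addr_ge0.
pose Q := F x0 + k + C3 / sn / delta.
have Q0 : 0 <= Q.
  by rewrite !addr_ge0 ?(smooth_value_ge0 sv)// !divr_ge0// ltW.
have QE : Num.max 0 (x - b) + F x0 + (K + C3 / delta) / sn = Num.max 0 (x - b) + Q.
  by rewrite /Q /k; ring.
(* [c] is the pathwise error, [Cn / delta] comes from [err / (D - 1)], and the rest from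
   [D <= 1 + 2 * (delta * h)]. *)
pose Bh := c + Cn / delta + 2 * delta * Q + 2 * Cn.
have Bh0 : 0 <= Bh.
  have dQ : 0 <= delta * Q by rewrite mulr_ge0// ltW.
  have Cd : 0 <= Cn / delta by rewrite divr_ge0// ltW.
  rewrite /Bh; lra.
pose h0 := Num.min 1 (2^-1 / delta).
have h0_gt0 : 0 < h0 by rewrite lt_min ltr01 divr_gt0.
rewrite QE; apply: (ereal_le_vanishing h0_gt0 Bh0) => h h_gt0.
rewrite le_min ler_pdivlMr// (mulrC h) => /andP[h_le1 dh].
pose D := expR (delta * h).
have D1 : 1 < D by rewrite expR_gt1 mulr_gt0.
have ch0 : 0 < c * h by rewrite mulr_gt0.
pose Mh := F (b + c * h) + k.
have MhE : Mh = F b + c * h + k by rewrite /Mh F_b_step// ltW.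
have Mh0 : 0 <= Mh by rewrite MhE !addr_ge0// ltW.
pose err := h * (C3 / sn) + h ^+ 2 * (L * c ^+ 2 + delta * L * c + (n * lambda) ^+ 2 *
  (Mh + G0)).
have rate0 : 0 < n * lambda * h by rewrite !mulr_gt0.
have [_ _ /andP[rest0 rest_le]] := poisson_pmf01_bounds rate0.
have errM : (1 - poisson_pmf (n * lambda * h) 0 - poisson_pmf (n * lambda * h) 1) * Mh
  <= err.
  apply: (@le_trans _ _ ((n * lambda * h) ^+ 2 * Mh)); first by rewrite ler_wpM2r.
  have -> : (n * lambda * h) ^+ 2 * Mh = h ^+ 2 * ((n * lambda) ^+ 2 * Mh) by ring.
  have a1 : 0 <= h * (C3 / sn) by rewrite mulr_ge0 ?divr_ge0// ltW.
  have a4 : 0 <= (n * lambda) ^+ 2 * G0 by rewrite mulr_ge0// sqr_ge0.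
  rewrite ler_wpDl// ler_wpM2l ?sqr_ge0//; lra.
have err0 : 0 <= err by apply: le_trans errM; rewrite mulr_ge0.
pose S := F x0 + k + err / (D - 1).
have step y : 0 <= y <= b ->
    poisson_pmf (n * lambda * h) 0 * killed_value F k 0 (y + c * h) +
    poisson_pmf (n * lambda * h) 1 *
      (\int[P0]_v killed_value F k 0 (y + c * h - W v / sn)) +
    (1 - poisson_pmf (n * lambda * h) 0 - poisson_pmf (n * lambda * h) 1) * Mh <=
    D * killed_value F k 0 y + err.
  move=> y_itv; have /andP[y0 yb] := y_itv.
  have y'0 : 0 <= y + c * h by rewrite addr_ge0// ltW.
  rewrite {1}/killed_value y'0 {2}/killed_value y0 /err addrA.
  apply: (one_step_ub lambda_gt0 theta_gt0 delta_gt0 n_gt0 (m_gt0 0) (ltW (m_gt0 1))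
    (ltW (m_gt0 2)) sv h_gt0 y_itv k0).
    by rewrite lerD2r (smooth_value_le sv) ?lerD2r// addr_ge0// ltW.
  exact: (one_claim_ub sv n_ge1 W_mean K0 y'0 excess).
have rec i := recursion_ub lambda_gt0 n_gt0 CL h_gt0 ch0 (lexx 0) (ltW b_gt0) x0_le sv k0
  i (ltW (lt_trans ltr01 D1)) errM step.
apply: (le_trans (@payoff_step_ub h 0 h_gt0 (lexx 0) (ltW b_gt0) S erefl _)).
  move=> J; apply: (le_trans (geometric_ub J D1 _ err0 rec)).
    move=> i; apply: Rintegral_ge0 => w _.
    by case/andP: (killed_value_itv sv k0 (lexx 0) (ltW b_gt0)
      (killed_chain_le (fun i w => N (i%:R * h) w) (fun i w => Num.max (Z i w) 0)
        (c * h) 0 w i x0_le)).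
  by rewrite /S lerD2r /= mean_cst /killed_value x0_ge0.
rewrite lee_fin -/D.
suff : c * h + D * S <= Q + Bh * h by lra.
have err_le : err / (D - 1) <= C3 / sn / delta + h * (Cn / delta).
  rewrite ler_pdivrMr ?subr_gt0//.
  apply: (@le_trans _ _ ((C3 / sn / delta + h * (Cn / delta)) * (delta * h))); last first.
    rewrite ler_wpM2l ?D_ge//; apply: addr_ge0.
      by rewrite !divr_ge0// ltW.
    by rewrite mulr_ge0 ?divr_ge0// ltW.
  have -> : (C3 / sn / delta + h * (Cn / delta)) * (delta * h) = h * (C3 / sn) + h ^+ 2
    * Cn.
    by field; rewrite !gt_eqF.
  rewrite /err lerD2l ler_wpM2l ?sqr_ge0// /Cn lerD2l ler_wpM2l ?sqr_ge0// lerD2r MhE.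
  have : c * h <= c by rewrite ler_piMr.
  lra.
have D_le : D <= 1 + 2 * (delta * h).
  have := @expR_le_quadratic _ (delta * h);
    rewrite mulr_ge0 ?(ltW delta_gt0) ?(ltW h_gt0)// => /(_ isT dh).
  have : (delta * h) ^+ 2 <= 2^-1 * (delta * h).
    by rewrite expr2 ler_wpM2r// mulr_ge0 ?(ltW delta_gt0) ?(ltW h_gt0).
  rewrite -/D; lra.
have S_le : S <= Q + h * (Cn / delta) by rewrite /S /Q; lra.
have S0 : 0 <= S.
  by rewrite /S !addr_ge0 ?(smooth_value_ge0 sv)// divr_ge0// subr_ge0 ltW.
have DS : D * S <= (1 + 2 * (delta * h)) * (Q + h * (Cn / delta)).
  apply: ler_pM => //; exact: ltW (lt_trans ltr01 D1).
have DE : (1 + 2 * (delta * h)) * (Q + h * (Cn / delta)) =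
    Q + h * (Cn / delta + 2 * delta * Q) + h * h * (2 * Cn).
  by field; rewrite gt_eqF.
have hh : h * h * (2 * Cn) <= h * (2 * Cn).
  by rewrite ler_wpM2r ?mulr_ge0// ler_piMr// ltW.
by move: DS hh; rewrite DE /Bh; lra.
Qed.

Lemma payoff_lb :
  ((Num.max 0 (x - b) + F x0 - C3 / delta / sn)%:E <= payoff)%E.
Proof.
have /andP[x0_ge0 x0_le] := x0_itv.
have Fb0 : 0 <= F b by rewrite (smooth_value_ge0 sv)// ltW.
have c0 : 0 <= c := ltW c_gt0.
pose Cn := L * c ^+ 2 + delta * c + 2 * (n * lambda) * L * c +
    (n * lambda) ^+ 2 * (F b + c) + 2 * delta ^+ 2 * (F b + c).
have d_ge0 := ltW delta_gt0; have nl_ge0 : 0 <= n * lambda by rewrite mulr_ge0// ltW.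
have Lc2 : 0 <= L * c ^+ 2 by rewrite mulr_ge0// sqr_ge0.
have dc : 0 <= delta * c by rewrite mulr_ge0.
have nLc : 0 <= 2 * (n * lambda) * L * c by rewrite mulr_ge0// mulr_ge0// mulr_ge0.
have quad_ge0 M : 0 <= M -> 0 <= L * c ^+ 2 + delta * c + 2 * (n * lambda) * L * c +
    (n * lambda) ^+ 2 * M + 2 * delta ^+ 2 * M.
  move=> M0; rewrite addr_ge0//; last by rewrite mulr_ge0// mulr_ge0// sqr_ge0.
  rewrite addr_ge0//; last by rewrite mulr_ge0// sqr_ge0.
  by rewrite addr_ge0// addr_ge0.
have Cn0 : 0 <= Cn by apply: quad_ge0; rewrite addr_ge0.
(* [2 * L * c] pays for the killing threshold, [F a <= L * (2 * (c * h))]. *)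
pose Bh := Cn / delta + 2 * L * c.
have Bh0 : 0 <= Bh.
  apply: addr_ge0; first by rewrite divr_ge0.
  by rewrite mulr_ge0// mulr_ge0.
(* The last bound makes the threshold [2 * (c * h)] at most [b]. *)
pose h0 := Num.min (Num.min 1 (2^-1 / delta)) (b / (2 * c)).
have c2 : 0 < 2 * c by rewrite (mulr_gt0 _ c_gt0).
have h0_gt0 : 0 < h0.
  by rewrite /h0 !lt_min ltr01/= !divr_gt0.
apply: (ereal_ge_vanishing h0_gt0 Bh0) => h h_gt0.
rewrite !le_min !ler_pdivlMr// (mulrC h delta) => /andP[/andP[h_le1 dh] hb].
pose D := expR (delta * h).
have D1 : 1 < D by rewrite expR_gt1 mulr_gt0.
have ch0 : 0 < c * h by rewrite mulr_gt0.
pose a := 2 * (c * h).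
have a0 : 0 <= a by rewrite mulr_ge0// ltW.
have ab : a <= b by rewrite /a; move: hb; lra.
pose Mh := F (b + c * h) + 0.
have MhE : Mh = F b + c * h by rewrite /Mh F_b_step ?addr0// ltW.
have Mh0 : 0 <= Mh by rewrite MhE addr_ge0// ltW.
have Mh_le : Mh <= F b + c by rewrite MhE lerD2l ler_piMr.
pose err := h * (C3 / sn) + h ^+ 2 * (L * c ^+ 2 + delta * c + 2 * (n * lambda) * L * c +
    (n * lambda) ^+ 2 * Mh + 2 * delta ^+ 2 * Mh).
have err0 : 0 <= err.
  apply: addr_ge0; first by rewrite mulr_ge0 ?divr_ge0// ltW.
  by rewrite mulr_ge0 ?sqr_ge0 ?quad_ge0.
have step y : a <= y <= b -> D * killed_value F 0 a y - err <=
    poisson_pmf (n * lambda * h) 0 * killed_value F 0 a (y + c * h) +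
    poisson_pmf (n * lambda * h) 1 *
      (\int[P0]_v killed_value F 0 a (y + c * h - W v / sn)).
  move=> /andP[ay yb].
  have y_itv : 0 <= y <= b by rewrite (le_trans a0 ay).
  have y0 := le_trans a0 ay.
  have ay' : a <= y + c * h by rewrite (le_trans ay)// lerDl ltW.
  have y'0 := le_trans a0 ay'.
  have F_le : F (y + c * h) + 0 <= Mh.
    by rewrite lerD2r (smooth_value_le sv) ?lerD2r// addr_ge0// ltW.
  have E_le : \int[P0]_v killed_value F 0 a (y + c * h - W v / sn) <= Mh.
    rewrite -[leRHS](mean_cst P0); apply: le_mean; [|exact: has_mean_cst|move=> v].
      exact: (killed_value_mean Y sv n_ge1 (lexx 0) a0 y'0).
    have V0 : y + c * h - W v / sn <= y + c * h.
      by rewrite gerBl divr_ge0 ?(ltW sn_gt0)// /W le_max lexx orbT.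
    by have /andP[_ /le_trans] := killed_value_itv sv (lexx 0) a0 y'0 V0; apply.
  have E_ge0 : 0 <= \int[P0]_v killed_value F 0 a (y + c * h - W v / sn).
    apply: Rintegral_ge0 => v _; rewrite /killed_value; case: ifPn => // av.
    by rewrite addr0 (smooth_value_ge0 sv)// (le_trans a0 av).
  have Fy_le : F y <= Mh.
    rewrite /Mh addr0; apply: (smooth_value_le sv); first by rewrite addr_ge0// ltW.
    by rewrite (le_trans yb)// lerDl ltW.
  have kv y1 : a <= y1 -> killed_value F 0 a y1 = F y1 by move=> ay1;
    rewrite /killed_value ay1 addr0.
  have := one_step_lb (m3 := m 3) lambda_gt0 theta_gt0 delta_gt0 n_gt0 (m_gt0 0) sv
    h_gt0 y_itv (lexx a) a0 dh E_ge0 E_le Fy_le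
    (one_claim_lb sv n_ge1 W_mean a0 ay').
  rewrite !kv// => le1; apply: le_trans le1.
  by rewrite /err /D /C3 /c /sn; lra.
have rec i := recursion_lb lambda_gt0 n_gt0 CL h_gt0 ch0 a0 ab x0_le sv (lexx 0) i err0
  step.
pose A := Num.max 0 (x - b) + F x0 - F a - err / (D - 1).
have A_le : (A%:E <= payoff)%E.
  (* The horizon [J] tends to infinity: the terminal value is at most [Mh] and its discount
     [D^-1 ^+ J] falls below any [e]. *)
  apply: (@ereal_ge_vanishing _ _ _ Mh 1) => // e e_gt0 _.
  have [J DJ] : exists J, D^-1 ^+ J <= e.
    have D0 : 0 < D := expR_gt0 _.
    have : D^-1 ^+ J @[J --> \oo] --> (0 : R).
      by apply: cvg_expr; rewrite ger0_norm ?invr_ge0 ?(ltW D0)// invf_lt1.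
    move/cvgrPdist_le => /(_ _ e_gt0)[J _ HJ]; exists J.
    by have := HJ J (leqnn J); rewrite sub0r normrN ger0_norm// exprn_ge0// invr_ge0 ltW.
  apply: le_trans (@payoff_step_lb h a h_gt0 a0 ab J (lexx a)).
  rewrite lee_fin /A -!addrA lerD2l.
  apply: le_trans (geometric_lb J D1 err0 rec).
  have u0 : F x0 - F a <= \int[P]_w killed_value F 0 a (killed_chain
      (fun i w => N (i%:R * h) w) (fun i w => Num.max (Z i w) 0) (c * h) a b x0 0 w).
    rewrite /= mean_cst /killed_value.
    have Fa := smooth_value_ge0 sv a0.
    have [ax|xa] := leP a x0; first by lra.
    by have := smooth_value_le sv a0 (ltW xa); lra.
  have uJ : \int[P]_w killed_value F 0 a (killed_chain
      (fun i w => N (i%:R * h) w) (fun i w => Num.max (Z i w) 0) (c * h) a b x0 J w) <= Mh.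
    rewrite -[leRHS](mean_cst P); apply: le_mean; [|exact: has_mean_cst|move=> w].
      exact: (killed_value_chain_mean N Z h ch0 a0 ab x0_le sv (lexx 0)).
    have /andP[_ /le_trans] := killed_value_itv sv (lexx 0) a0 (ltW b_gt0)
      (killed_chain_le (fun i w => N (i%:R * h) w) (fun i w => Num.max (Z i w) 0) (c *
        h) a w J x0_le).
    by apply; rewrite MhE addr0 lerDl ltW.
  have uJ' := ler_pM _ _ DJ uJ.
  have : D^-1 ^+ J * \int[P]_w killed_value F 0 a (killed_chain
      (fun i w => N (i%:R * h) w) (fun i w => Num.max (Z i w) 0) (c * h) a b x0 J w) <=
        e * Mh.
    apply: uJ'; first by rewrite exprn_ge0// invr_ge0 expR_ge0.
    apply: Rintegral_ge0 => w _; rewrite /killed_value; case: ifPn => // av.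
    by rewrite addr0 (smooth_value_ge0 sv)// (le_trans a0 av).
  by move: u0; lra.
apply: le_trans A_le; rewrite lee_fin /A.
have Fa : F a <= L * a.
  by have /andP[_] := smooth_value_incr sv (lexx 0) a0; rewrite (sv_0 sv) add0r subr0.
have err_le : err / (D - 1) <= C3 / delta / sn + h * (Cn / delta).
  rewrite ler_pdivrMr ?subr_gt0//.
  apply: (@le_trans _ _ ((C3 / delta / sn + h * (Cn / delta)) * (delta * h))); last first.
    rewrite ler_wpM2l ?D_ge//; apply: addr_ge0.
      by rewrite !divr_ge0// ltW.
    by rewrite mulr_ge0 ?divr_ge0// ltW.
  have -> : (C3 / delta / sn + h * (Cn / delta)) * (delta * h) = h * (C3 / sn) + h ^+ 2
    * Cn.
    by field; rewrite !gt_eqF.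
  rewrite /err lerD2l ler_wpM2l ?sqr_ge0// /Cn -!addrA !lerD2l.
  by apply: lerD; rewrite ler_wpM2l ?sqr_ge0// mulr_ge0 ?sqr_ge0.
by move: Fa err_le; rewrite /Bh /a; lra.
Qed.

End payoff_bounds.

Theorem theorem3p2 (R : realType) (d0 : measure_display)
    (T0 : measurableType d0) (P0 : probability T0 R) (Y : {RV P0 >-> R})
    (lambda theta delta : R)
    (lambda_gt0 : 0 < lambda) (theta_gt0 : 0 < theta) (delta_gt0 : 0 < delta)
    (Y_gt0 : {ae P0, forall w, 0 < Y w})
    (Y_exp_moment :
      exists2 eps : R, 0 < eps & ('E_P0[fun w => expR (eps * Y w)] < +oo)%E)
    (Y_exp_excess :
      exists2 eps : R, 0 < eps &
        (ereal_sup
          [set cond_expectation P0 [set w | (d < Y w)%R]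
                 (fun w => expR (eps * (Y w - d))%R)
          | d in [set d : R | (0 <= d)%R /\ 0 < P0 [set w | (d < Y w)%R]]]
         < +oo)%E) :
  let mu := theta * lambda * moment Y 1 in
  let sigma2 := lambda * moment Y 2 in
  let bD := diffusion_barrier mu sigma2 delta in
  exists C' N1 N2 : R, [/\ 0 < C', 0 < N1, 0 < N2 &
    forall n : R, Num.max N1 N2 < n -> forall x : R, 0 <= x ->
    forall (d : measure_display) (T : measurableType d) (P : probability T R)
      (N : counting_process P) (Z : nat -> {RV P >-> R}),
      cramer_lundberg Y lambda n N Z ->
      (`| barrier_payoff N Z (scaled_premium Y lambda theta n) x bD delta
          - (diffusion_value mu sigma2 delta x)%:E | <=
         (C' / Num.sqrt n)%:E)%E].
Proof.
move=> mu sigma2 bD.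
have W_mean := claim_power_mean Y_exp_moment.
have mk := moment_claim Y_gt0.
have m_gt0 k : 0 < \int[P0]_w (Num.max (Y w) 0 ^+ k.+1).
  by rewrite -mk; exact: moment_gt0.
have mu_gt0 : 0 < mu by rewrite !mulr_gt0// mk.
have sigma2_gt0 : 0 < sigma2 by rewrite mulr_gt0// mk.
have [F [F1 [F2 [L [sv FV]]]]] := diffusion_value_smooth mu_gt0 sigma2_gt0 delta_gt0.
have bD_gt0 : 0 < bD := diffusion_barrier_gt0 mu_gt0 sigma2_gt0 delta_gt0.
have L_ge0 := smooth_value_L_ge0 sv.
have [K K_gt0 excess] := claim_excess Y_exp_excess L_ge0.
pose C3 := lambda * L * (\int[P0]_w (Num.max (Y w) 0 ^+ 3)) / delta.
have C3_ge0 : 0 <= C3.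
  by rewrite divr_ge0 ?mulr_ge0 ?(ltW (m_gt0 2)) ?(ltW lambda_gt0) ?(ltW delta_gt0).
(* [K] pays for the deficit at ruin and [C3] for the Taylor remainder; the thresholds are [1]
   because both bounds hold for [n >= 1]. *)
exists (K + C3), 1, 1; split => //; first by rewrite ltr_wpDr.
move=> n; rewrite maxxx => n_gt1 x x_ge0 d T P N Z CL.
have n_ge1 := ltW n_gt1.
have sn_gt0 : 0 < Num.sqrt n by rewrite sqrtr_gt0 (lt_trans ltr01).
have -> : scaled_premium Y lambda theta n = (Num.sqrt n + theta) * lambda *
    (\int[P0]_w (Num.max (Y w) 0 ^+ 1)).
  by rewrite /scaled_premium -mk; ring.
have sv' : smooth_value (theta * lambda * (\int[P0]_w (Num.max (Y w) 0 ^+ 1)))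
    (lambda * (\int[P0]_w (Num.max (Y w) 0 ^+ 2))) delta bD L F F1 F2.
  by rewrite -!mk.
have ub := payoff_ub lambda_gt0 theta_gt0 delta_gt0 n_ge1 CL Y_gt0 W_mean m_gt0
  bD_gt0 x_ge0 sv' (ltW K_gt0) excess.
have lb := payoff_lb lambda_gt0 theta_gt0 delta_gt0 n_ge1 CL Y_gt0 W_mean m_gt0
  bD_gt0 x_ge0 sv'.
(* Above the barrier the lump sum moves the start to [bD], and the unit slope of [V_D] accounts for
   it. *)
have VE : Num.max 0 (x - bD) + F (Num.min x bD) = diffusion_value mu sigma2 delta x.
  rewrite -FV//; have [xb|bx] := leP x bD.
    by rewrite max_l ?add0r// subr_le0.
  by rewrite max_r ?subr_ge0 ?(ltW bx)// (sv_linear sv (ltW bx)) addrC.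
(* The payoff is an extended real; the two bounds exclude infinite values. *)
move: ub lb; rewrite VE; case: barrier_payoff => [p| |].
- rewrite !lee_fin ler_norml -/C3 !mulrDl => ub lb.
  have k0 : 0 <= K / Num.sqrt n by rewrite divr_ge0// ltW.
  have c0 : 0 <= C3 / Num.sqrt n by rewrite divr_ge0// ltW.
  by apply/andP; split; lra.
- by rewrite leye_eq.
- by rewrite leeNy_eq.
Qed.
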